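(* Let $F$ be a finite Orlicz function. Suppose that either (1) $F$ is doubling near infinity and the mapping $t\mapsto F(t)t^{-2}$ is essentially increasing on $[1,\infty)$, or (2) $F^*$ is doubling near infinity and the mapping $t\mapsto F(t)t^{-2}$ is essentially decreasing on $[1,\infty)$. Then any complemented subsymmetric basic sequence in $L_F$ is equivalent to the unit vector system of $\ell_2$ or to the unit vector system of $\ell_G$ for some $G\in C_F$ such that $G^*$ is equivalent (near zero) to a function in $C_{F^*}$.
   Context: An Orlicz function is a convex non-decreasing function $F\colon[0,\infty)\to[0,\infty]$, not identically zero, with $F(0)=0$ and $F(c)<\infty$ for some $c>0$; it is finite if it never takes the value $\infty$. Its complementary function is $F^*(u)=\sup\{tu-F(t):0<t<\infty\}$. $L_F$ denotes the Orlicz space over $[0,1)$ with Lebesgue measure: measurable (real or complex) $f$ with $\|f\|=\inf\{t>0:\int_0^1F(|f|/t)\,dx\le 1\}<\infty$. For an Orlicz function $G$, $\ell_G$ is the Orlicz sequence space with norm $\|(a_n)\|=\inf\{t>0:\sum_nG(|a_n|/t)\le1\}$. An Orlicz function $F$ is doubling near infinity if it is finite and $\sup_{t\ge1}F(2t)/F(t)<\infty$. A nonnegative function $h$ is essentially increasing (resp. decreasing) on $[1,\infty)$ if there is a constant $C$ with $h(s)\le Ch(t)$ (resp. $h(t)\le Ch(s)$) for $1\le s\le t$. Two Orlicz functions $G,H$ are equivalent near zero if there are constants $K,k,t_0>0$ with $K^{-1}H(k^{-1}t)\le G(t)\le KH(kt)$ for $0\le t\le t_0$. For a finite Orlicz function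 $F$ and $s>0$ with $F(s)>0$ set $F_s(t)=F(st)/F(s)$, $t\ge0$. For $b\ge0$ let $C_{F,b}$ be the closure in $(\mathcal C([0,1/2]),\|\cdot\|_\infty)$ of the convex hull of $\{F_s: s>b\}$ (restricted to $[0,1/2]$), and $C_F=\bigcap_{b\ge0}C_{F,b}$; $C_{F^*}$ is defined in the same way from $F^*$ (which is finite under either hypothesis). Each function $G$ in such a set is extended to an Orlicz function on $[0,\infty)$ by requiring it to be linear (affine) on $[1/2,\infty)$ with $G(1)=1$; so $\ell_G$ and $G^*$ make sense. A basic sequence is a Schauder basis of its closed linear span; it is complemented if that span is the range of a bounded projection; unconditional if every rearrangement is a basic sequence, spreading if it is equivalent to each of its subsequences, subsymmetric if unconditional and spreading. Two sequences are equivalent if there is an isomorphism between their closed linear spans mapping one to the other termwise. *)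

(* Defs.v *)
From HB Require Import structures.
From mathcomp Require Import all_boot all_order all_algebra.
From mathcomp Require Import all_classical all_reals all_analysis.
From mathcomp Require Import complex.

Set Implicit Arguments.
Unset Strict Implicit.
Unset Printing Implicit Defensive.

Import Order.TTheory GRing.Theory Num.Theory.
Import numFieldNormedType.Exports.

Local Open Scope classical_set_scope.
Local Open Scope ring_scope.

Variant scalar_kind := real_scalars | complex_scalars.

Definition scalar (R : realType) (k : scalar_kind) : numFieldType :=
  match k with
  | real_scalars => R
  | complex_scalars => R[i]
  end.

(* The norm of R[i] is R[i]-valued in the library; the modulus is R-valued. *)
Definition modulus (R : realType) (k : scalar_kind) : scalar R k -> R :=
  match k return scalar R k -> R with
  | real_scalars => fun z : R => `|z|
  | complex_scalars => fun z : R[i] => Normc.normc z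
  end.

Definition measurable_scalar (R : realType) (k : scalar_kind) (D : set R) :
    (R -> scalar R k) -> Prop :=
  match k return (R -> scalar R k) -> Prop with
  | real_scalars => fun f : R -> R => measurable_fun D f
  | complex_scalars => fun f : R -> R[i] =>
      measurable_fun D (fun x => complex.Re (f x)) /\
      measurable_fun D (fun x => complex.Im (f x))
  end.

(* A normed space is presented before quotienting: a set [carrier] of vectors of
   an ambient module with a seminorm on it.  Vectors at distance 0 are
   identified, so equality of vectors is [same] below and a map between such
   spaces only has to be linear up to [same].  For L_F, [same] is equality
   almost everywhere on [0, 1). *)
Record nspace (R : realType) (K : numFieldType) := NSpace {
  vec :> lmodType K ;
  carrier : set vec ;
  nrm : vec -> R }.

Section banach.
Context {R : realType} {K : numFieldType}.
Implicit Types X Y : nspace R K.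

Definition same X (u v : X) : Prop := nrm (u - v) = 0.

Definition partial_sum X (x : nat -> X) (a : nat -> K) (n : nat) : X :=
  \sum_(i < n) a i *: x i.

Definition closed_span X (x : nat -> X) : set X :=
  [set v | carrier v /\ forall e : R, 0 < e ->
     exists (n : nat) (a : nat -> K), nrm (v - partial_sum x a n) < e].

Definition expansion X (x : nat -> X) (v : X) (a : nat -> K) : Prop :=
  (fun n => nrm (v - partial_sum x a n)) @ \oo --> (0 : R).

Definition basic_sequence X (x : nat -> X) : Prop :=
  (forall n, carrier (x n)) /\
  (forall v, closed_span x v -> exists! a : nat -> K, expansion x v a).

(* bounded linear maps from the subspace A of X to the subspace B of Y *)
Definition bounded_linear X Y (A : set X) (B : set Y) (T : X -> Y) : Prop :=
  [/\ forall u, A u -> B (T u),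
      forall (c : K) u v, A u -> A v ->
        same (T (c *: u + v)) (c *: T u + T v) &
      exists M : R, forall u, A u -> nrm (T u) <= M * nrm u].

Definition projection_onto X (A : set X) (P : X -> X) : Prop :=
  [/\ bounded_linear (@carrier _ _ X) (@carrier _ _ X) P,
      forall u, carrier u -> same (P (P u)) (P u) &
      forall v, A v <-> carrier v /\ exists2 u, carrier u & same (P u) v].

Definition complemented X (x : nat -> X) : Prop :=
  exists P : X -> X, projection_onto (closed_span x) P.

Definition equivalent X Y (x : nat -> X) (y : nat -> Y) : Prop :=
  exists (T : X -> Y) (S : Y -> X),
  [/\ bounded_linear (closed_span x) (closed_span y) T,
      bounded_linear (closed_span y) (closed_span x) S,
      forall u, closed_span x u -> same (S (T u)) u,
      forall v, closed_span y v -> same (T (S v)) v &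
      forall n, same (T (x n)) (y n)].

Definition unconditional X (x : nat -> X) : Prop :=
  forall s : nat -> nat, bijective s -> basic_sequence (x \o s).

Definition spreading X (x : nat -> X) : Prop :=
  forall s : nat -> nat, {homo s : m n / (m < n)%N} -> equivalent x (x \o s).

Definition subsymmetric X (x : nat -> X) : Prop :=
  unconditional x /\ spreading x.

End banach.

(* Orlicz functions are total functions R -> \bar R of which only the
   restriction to [0, +oo) matters. *)
Section orlicz_functions.
Context {R : realType}.
Implicit Types F G H : R -> \bar R.

Definition orlicz F : Prop :=
  [/\ F 0 = 0%E,
      forall s t : R, 0 <= s -> s <= t -> (F s <= F t)%E,
      forall l s t : R, 0 <= l <= 1 -> 0 <= s -> 0 <= t ->
        (F (l * s + (1 - l) * t)%R <= l%:E * F s + (1 - l)%R%:E * F t)%E,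
      exists2 t : R, 0 <= t & F t <> 0%E &
      exists2 c : R, 0 < c & (F c < +oo)%E].

Definition finite_orlicz F : Prop :=
  orlicz F /\ forall t, 0 <= t -> (F t < +oo)%E.

Definition complementary F : R -> \bar R :=
  fun u => ereal_sup [set ((t * u)%:E - F t)%E | t in [set t : R | 0 < t]].

(* For an Orlicz function the bound forces F > 0 on [1, +oo), so it says that
   the quotients F (2 t) / F t are defined and bounded there. *)
Definition doubling_infty F : Prop :=
  finite_orlicz F /\
  exists C : R, forall t, 1 <= t -> (F (2 * t)%R <= C%:E * F t)%E.

Definition ess_increasing (h : R -> R) : Prop :=
  exists C : R, forall s t, 1 <= s -> s <= t -> h s <= C * h t.

Definition ess_decreasing (h : R -> R) : Prop :=
  exists C : R, forall s t, 1 <= s -> s <= t -> h t <= C * h s.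

Definition equivalent_near_zero G H : Prop :=
  exists M k t0 : R, [/\ 0 < M, 0 < k, 0 < t0 &
    forall t, 0 <= t <= t0 ->
      ((M^-1)%:E * H (k^-1 * t)%R <= G t)%E /\
      (G t <= M%:E * H (k * t)%R)%E].

Definition rescaled F (s : R) : R -> R :=
  fun t => fine (F (s * t)) / fine (F s).

Definition rescalings F (b : R) : set (R -> R^o) :=
  [set rescaled F s | s in [set s : R | [/\ 0 < s, (0 < F s)%E & b < s]]].

Definition convex_hull (A : set (R -> R^o)) : set (R -> R^o) :=
  smallest (@convex_set R (R -> R^o)) A.

(* C([0, 1/2]) is the set of total functions that are continuous on [0, 1/2],
   with the topology of uniform convergence on [0, 1/2]. *)
Definition C_ F (b : R) : set (R -> R) :=
  [set g : R -> R | {within `[0%R, 2^-1 : R]%classic, continuous g} /\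
    @closure {uniform` `[0%R, 2^-1 : R]%classic -> R^o}
      (convex_hull (rescalings F b)) g].

(* continuation from [0, 1/2] that is affine on [1/2, +oo) with value 1 at 1 *)
Definition affine_extension (g : R -> R) : R -> \bar R :=
  fun t => (if t <= 2^-1 then g t
            else g 2^-1 + 2 * (1 - g 2^-1) * (t - 2^-1))%:E.

Definition C_infty F : set (R -> \bar R) :=
  affine_extension @` \bigcap_(b in [set b | 0 <= b]) C_ F b.

End orlicz_functions.

Section spaces.
Context {R : realType} (k : scalar_kind).
Local Notation K := (scalar R k).

Definition luxemburg (F : R -> \bar R) (f : R -> K) : \bar R :=
  ereal_inf [set t%:E | t in [set t : R | 0 < t /\
    (\int[lebesgue_measure]_(x in `[0%R, 1%R[) F (modulus (f x) / t)%R
      <= 1)%E]].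

(* Values of f outside [0, 1) are irrelevant. *)
Definition L_ (F : R -> \bar R) : nspace R K :=
  @NSpace R K (R -> K^o)
    [set f | measurable_scalar `[0, 1[ f /\ (luxemburg F f < +oo)%E]
    (fun f => fine (luxemburg F f)).

Definition luxemburg_seq (G : R -> \bar R) (a : nat -> K) : \bar R :=
  ereal_inf [set t%:E | t in [set t : R | 0 < t /\
    (\sum_(0 <= n <oo) G (modulus (a n) / t)%R <= 1)%E]].

Definition ell_ (G : R -> \bar R) : nspace R K :=
  @NSpace R K (nat -> K^o)
    [set a | (luxemburg_seq G a < +oo)%E]
    (fun a => fine (luxemburg_seq G a)).

Definition sum_squares (a : nat -> K) : \bar R :=
  (\sum_(0 <= n <oo) (modulus (a n) ^+ 2)%:E)%E.

Definition ell2 : nspace R K :=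
  @NSpace R K (nat -> K^o)
    [set a | (sum_squares a < +oo)%E]
    (fun a => Num.sqrt (fine (sum_squares a))).

Definition unit_vector (n : nat) : nat -> K^o := fun m => (m == n)%:R.

End spaces.

Arguments L_ {R} k F.
Arguments ell_ {R} k G.
Arguments ell2 R k : clear implicits.
Arguments unit_vector R k n : clear implicits.

(* Main.v *)
Require Import Defs.
From mathcomp Require Import all_boot all_order all_algebra.
From mathcomp Require Import all_classical all_reals all_analysis.
From mathcomp Require Import measurable_realfun complex.
From mathcomp Require Import ring lra zify.

Import Order.TTheory GRing.Theory Num.Theory.
Import numFieldNormedType.Exports.

Local Open Scope classical_set_scope.
Local Open Scope ring_scope.

(** Let x be a complemented subsymmetric basic sequence in L_F, and extend its
    coordinate functionals to psi_i on L_F by means of the projection. The sums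
    f |-> sum_(i in A) psi_i(f) x_i over finite sets A are uniformly bounded
    (span_proj_bounded, complemented_usystem), which has two consequences: the
    sequence is unconditional in the quantitative sense, and the diagonal
    inequality tong_diagonal bounds sum_i psi_i(g_i) x_i by the average norm of
    sum_i e_i g_i over signs e. Because x is spreading, it suffices to identify
    some subsequence y of x up to equivalence. What matters is where the coordinate
    psi_i(y_i) = 1 comes from.

    Suppose first that for some M the part of y_i where |y_i| <= M carries at least
    half of the coordinate for infinitely many i. Then y is equivalent to the basis
    of l_2 (concave_hilbertian, convex_hilbertian): sums with random signs behave
    like the square function by the inequalities of Khinchin, F (sqrt u) is concave
    or convex up to constants for u >= 1, and the diagonal inequality passes between
    y_i and its bounded part. This is the only place where the comparison of F with
    t^2 enters, apart from the doubling property and the finiteness of F^*, which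
    follow from the hypotheses in both cases.

    Otherwise the coordinates come from large values of the y_i. These are taken on
    small sets, so along a subsequence there are disjoint sets A_i, cut into pieces
    E_ij on which |y_i| is about s_ij, such that the parts of y_i on A_i carry at
    least 1/4 of the coordinates and s_ij tends to infinity with i
    (disjoint_selection). The norm of sum_i a_i y_i is at least that of the disjoint
    parts by averaging over signs, and at most a multiple of it by the diagonal
    inequality (pieces_lower, pieces_upper). Hence, with m_ij the measure of E_ij, it
    is comparable to the norm given by sum_i G_i(|a_i| / t) <= 1, where
    G_i(t) = sum_j m_ij F(s_ij t / r_i) and r_i normalizes G_i(1) = 1. As G_i is a
    convex combination of functions F_s with s large, a fast uniform limit G of a
    subsequence lies in C_F, and y is equivalent to the basis of l_G
    (disjoint_sequence_orlicz).

    For the conjugate function let w_ij be the modulus of psi_i on the part of y_i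
    over E_ij, and let tau_ij = w_ij / (s_ij m_ij). The normalized mixtures
    H_i(v) = sum_j m_ij F^*(tau_ij v / q_i) have a limit H in C_{F^*}, once small
    tau_ij are discarded. Young's inequality bounds G^* by H. Conversely, near
    maximizers in the definition of F^*, used for about 1 / G^*(u) indices at once,
    yield admissible coefficients whose pairing with u is bounded, and this bounds H
    by G^* (mixture_duality). *)

(** * Real and complex scalars *)
Section scalars.
Set Implicit Arguments.
Unset Strict Implicit.
Context {R : realType} {k : scalar_kind}.
Local Notation K := (Defs.scalar R k).

(** Real and imaginary parts that make sense for both kinds of scalars, so that
    estimates are proved once for both. *)
Definition scalar_re (z : K) : R :=
  match k return Defs.scalar R k -> R with
  | real_scalars => fun z : R => z
  | complex_scalars => fun z : R[i] => complex.Re z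
  end z.

Definition scalar_im (z : K) : R :=
  match k return Defs.scalar R k -> R with
  | real_scalars => fun=> 0
  | complex_scalars => fun z : R[i] => complex.Im z
  end z.

Definition scalar_of (k' : scalar_kind) (a b : R) : Defs.scalar R k' :=
  match k' return Defs.scalar R k' with
  | real_scalars => a
  | complex_scalars => Complex a b
  end.

Lemma modulusE (z : K) :
  modulus z = Num.sqrt (scalar_re z ^+ 2 + scalar_im z ^+ 2).
Proof.
rewrite /modulus /scalar_re /scalar_im; move: z; case: k => /= z.
  by rewrite expr0n addr0 sqrtr_sqr.
by case: z.
Qed.

Lemma modulus_ge0 (z : K) : 0 <= modulus z.
Proof. by rewrite modulusE sqrtr_ge0. Qed.

Lemma modulus_sqr (z : K) :
  modulus z ^+ 2 = scalar_re z ^+ 2 + scalar_im z ^+ 2.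
Proof. by rewrite modulusE sqr_sqrtr// addr_ge0// sqr_ge0. Qed.

Lemma modulusM (z w : K) : modulus (z * w) = modulus z * modulus w.
Proof.
rewrite /modulus; move: z w; case: k => /= z w; first exact: normrM.
exact: Normc.normcM.
Qed.

Lemma ler_modulusD (z w : K) : modulus (z + w) <= modulus z + modulus w.
Proof.
rewrite /modulus; move: z w; case: k => /= z w; first exact: ler_normD.
exact: le_normcD.
Qed.

Lemma modulus0 : modulus (0 : K) = 0.
Proof. by rewrite /modulus; case: k => /=; [exact: normr0|exact: Normc.normc0]. Qed.

Lemma modulus1 : modulus (1 : K) = 1.
Proof. by rewrite /modulus; case: k => /=; [exact: normr1|exact: Normc.normc1]. Qed.

Lemma modulus_eq0 (z : K) : modulus z = 0 -> z = 0.
Proof.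
rewrite /modulus; move: z; case: k => /= z; first exact: normr0_eq0.
exact: Normc.eq0_normc.
Qed.

Lemma modulus_gt0 (z : K) : z != 0 -> 0 < modulus z.
Proof.
move=> z0; rewrite lt0r modulus_ge0 andbT; apply: contra z0 => /eqP.
by move=> /modulus_eq0 ->.
Qed.

Lemma modulusN (z : K) : modulus (- z) = modulus z.
Proof.
rewrite /modulus; move: z; case: k => /= z; first exact: normrN.
exact: normcN.
Qed.

Lemma modulusV (z : K) : modulus (z^-1) = (modulus z)^-1.
Proof.
have [->|z0] := eqVneq z 0; first by rewrite invr0 modulus0 invr0.
apply: (mulfI (lt0r_neq0 (modulus_gt0 z0))).
by rewrite -modulusM !divff ?modulus1// lt0r_neq0// modulus_gt0.
Qed.

Lemma modulus_sum I (r : seq I) (f : I -> K) :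
  modulus (\sum_(i <- r) f i) <= \sum_(i <- r) modulus (f i).
Proof.
elim: r => [|i r IH]; first by rewrite !big_nil modulus0.
by rewrite !big_cons (le_trans (ler_modulusD _ _))// lerD2l.
Qed.

Lemma modulusB (z w : K) : `|modulus z - modulus w| <= modulus (z - w).
Proof.
have h (u v : K) : modulus u - modulus v <= modulus (u - v).
  by rewrite lerBlDr (le_trans _ (ler_modulusD _ _))// subrK.
rewrite ler_norml h andbT lerNl opprB -(modulusN (z - w)) opprB.
exact: h.
Qed.

Lemma scalar_reD (z w : K) : scalar_re (z + w) = scalar_re z + scalar_re w.
Proof. by rewrite /scalar_re; move: z w; case: k => //= -[? ?] [? ?]. Qed.

Lemma scalar_imD (z w : K) : scalar_im (z + w) = scalar_im z + scalar_im w.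
Proof.
by rewrite /scalar_im; move: z w; case: k => /= [_ _|[? ?] [? ?]//]; rewrite addr0.
Qed.

Lemma scalar_reM (z w : K) : scalar_re (z * w) =
  scalar_re z * scalar_re w - scalar_im z * scalar_im w.
Proof.
rewrite /scalar_re /scalar_im; move: z w; case: k => /= [z w|[? ?] [? ?]//].
by rewrite mulr0 subr0.
Qed.

Lemma scalar_imM (z w : K) : scalar_im (z * w) =
  scalar_re z * scalar_im w + scalar_im z * scalar_re w.
Proof.
rewrite /scalar_re /scalar_im; move: z w; case: k => /= [z w|[? ?] [? ?]//].
by rewrite mulr0 mul0r addr0.
Qed.

Lemma scalar_reN (z : K) : scalar_re (- z) = - scalar_re z.
Proof. by rewrite /scalar_re; move: z; case: k => //= -[? ?]. Qed.

Lemma scalar_imN (z : K) : scalar_im (- z) = - scalar_im z.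
Proof.
by rewrite /scalar_im; move: z; case: k => /= [_|[? ?]//]; rewrite oppr0.
Qed.

Lemma scalar_re_le (z : K) : `|scalar_re z| <= modulus z.
Proof.
by rewrite modulusE -sqrtr_sqr ler_wsqrtr// lerDl sqr_ge0.
Qed.

Lemma scalar_im_le (z : K) : `|scalar_im z| <= modulus z.
Proof.
by rewrite modulusE -sqrtr_sqr ler_wsqrtr// lerDr sqr_ge0.
Qed.

Lemma modulus_le_re_im (z : K) : modulus z <= `|scalar_re z| + `|scalar_im z|.
Proof.
rewrite -ler_sqr ?nnegrE ?modulus_ge0// ?addr_ge0//.
rewrite modulus_sqr sqrrD !real_normK ?num_real// -addrA lerD2l lerDr.
by rewrite mulrn_wge0// mulr_ge0.
Qed.

Lemma measurable_scalarP (D : set R) (f : R -> K) :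
  measurable_scalar D f <->
  measurable_fun D (scalar_re \o f) /\ measurable_fun D (scalar_im \o f).
Proof.
rewrite /measurable_scalar /scalar_re /scalar_im; move: f; case: k => /= f //.
split => [mf|[]//]; split => //; exact: measurable_cst.
Qed.

End scalars.

Lemma scalar_re_of {R : realType} (k : scalar_kind) (a b : R) :
  scalar_re (scalar_of k a b) = a.
Proof. by case: k. Qed.

Lemma scalar_im_of {R : realType} (k : scalar_kind) (a b : R) :
  (k = real_scalars -> b = 0) -> scalar_im (scalar_of k a b) = b.
Proof. by case: k => //= ->. Qed.

Lemma cvg0P {R : realType} (u : nat -> R) (u_ge0 : forall n, 0 <= u n) :
  (u @ \oo --> (0 : R)) <->
  forall e, 0 < e -> exists N, forall n, (N <= n)%N -> u n < e.
Proof.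
split => [/cvgrPdist_lt + e e0|h].
  move=> /(_ e e0)[N _ hN]; exists N => n Nn.
  by have := hN n Nn; rewrite sub0r normrN ger0_norm.
apply/cvgrPdist_lt => e e0; have [N hN] := h e e0.
by exists N => // n Nn; rewrite sub0r normrN ger0_norm//; exact: hN.
Qed.

(** * Seminormed spaces and expansions *)
Section seminormed.
Set Implicit Arguments.
Unset Strict Implicit.
Context {R : realType} {k : scalar_kind}.
Local Notation K := (Defs.scalar R k).

Record seminormed (X : nspace R K) : Prop := Seminormed {
  carrier0 : carrier (0 : X);
  carrierL : forall c (u v : X), carrier u -> carrier v -> carrier (c *: u + v);
  nrm_ge0 : forall u : X, carrier u -> 0 <= nrm u;
  nrmZ : forall c (u : X), carrier u -> nrm (c *: u) = modulus c * nrm u;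
  ler_nrmD : forall u v : X, carrier u -> carrier v ->
    nrm (u + v) <= nrm u + nrm v }.

(** Completeness is only asked of series with geometrically small terms, with
    the speed of convergence that they have. *)
Definition complete (X : nspace R K) : Prop :=
  forall f : nat -> X, (forall n, carrier (f n)) ->
  (forall n, nrm (f n) <= 2^-1 ^+ n) ->
  exists v : X, carrier v /\
    forall n, nrm (v - \sum_(i < n) f i) <= 2 * 2^-1 ^+ n.

Context {X : nspace R K}.
Hypothesis sX : seminormed X.
Implicit Types (u v : X) (x : nat -> X).

Lemma carrierD u v : carrier u -> carrier v -> carrier (u + v).
Proof. by move=> cu cv; have := carrierL sX 1 cu cv; rewrite scale1r. Qed.

Lemma carrierZ c u : carrier u -> carrier (c *: u).
Proof.
by move=> cu; have := carrierL sX c cu (carrier0 sX); rewrite addr0.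
Qed.

Lemma carrierN u : carrier u -> carrier (- u).
Proof. by move=> cu; rewrite -scaleN1r; exact: carrierZ. Qed.

Lemma carrierB u v : carrier u -> carrier v -> carrier (u - v).
Proof. by move=> cu cv; apply: carrierD => //; exact: carrierN. Qed.

Lemma carrier_sum I (r : seq I) (f : I -> X) :
  (forall i, carrier (f i)) -> carrier (\sum_(i <- r) f i).
Proof.
move=> cf; elim: r => [|i r IH]; first by rewrite big_nil; exact: carrier0.
by rewrite big_cons; exact: carrierD.
Qed.

Lemma nrm0 : nrm (0 : X) = 0.
Proof. by rewrite -(scale0r 0) nrmZ ?modulus0 ?mul0r//; exact: carrier0. Qed.

Lemma nrmN u : carrier u -> nrm (- u) = nrm u.
Proof. by move=> cu; rewrite -scaleN1r nrmZ// modulusN modulus1 mul1r. Qed.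

Lemma nrm_subC u v : carrier u -> carrier v -> nrm (u - v) = nrm (v - u).
Proof. by move=> cu cv; rewrite -nrmN ?opprB//; exact: carrierB. Qed.

Lemma ler_nrmB u v : carrier u -> carrier v -> nrm (u - v) <= nrm u + nrm v.
Proof.
move=> cu cv; rewrite -(nrmN cv); apply: ler_nrmD => //; exact: carrierN.
Qed.

Lemma ler_nrm_sum I (r : seq I) (f : I -> X) : (forall i, carrier (f i)) ->
  nrm (\sum_(i <- r) f i) <= \sum_(i <- r) nrm (f i).
Proof.
move=> cf; elim: r => [|i r IH]; first by rewrite !big_nil nrm0.
rewrite !big_cons (le_trans (ler_nrmD sX _ _))//; first exact: carrier_sum.
by rewrite lerD2l.
Qed.

Lemma ler_nrm_dist u v : carrier u -> carrier v -> nrm u <= nrm v + nrm (u - v).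
Proof.
move=> cu cv; rewrite -{1}(subrKC v u); apply: ler_nrmD => //.
exact: carrierB.
Qed.

Lemma nrm_triangle u v w : carrier u -> carrier v -> carrier w ->
  nrm (u - w) <= nrm (u - v) + nrm (v - w).
Proof.
move=> cu cv cw; rewrite -(subrKA v); apply: ler_nrmD => //; exact: carrierB.
Qed.

Lemma same_nrm u v : carrier u -> carrier v -> same u v -> nrm u = nrm v.
Proof.
move=> cu cv suv; apply/eqP; rewrite eq_le.
have h := suv; rewrite /same nrm_subC// in h.
have := ler_nrm_dist cu cv; rewrite [nrm (u - v)]suv addr0 => ->/=.
by have := ler_nrm_dist cv cu; rewrite h addr0.
Qed.

Lemma partial_sumS x a n :
  partial_sum x a n.+1 = partial_sum x a n + a n *: x n.
Proof. by rewrite /partial_sum big_ord_recr. Qed.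

Lemma partial_sum_iota x a n :
  partial_sum x a n = \sum_(i <- iota 0 n) a i *: x i.
Proof. by rewrite /partial_sum -(big_mkord xpredT (fun i => a i *: x i)) /index_iota subn0. Qed.

Lemma partial_sumL x c a b n :
  partial_sum x (fun i => c * a i + b i) n =
  c *: partial_sum x a n + partial_sum x b n.
Proof.
rewrite /partial_sum scaler_sumr -big_split; apply: eq_bigr => i _ /=.
by rewrite scalerDl scalerA.
Qed.

Lemma partial_sum_trunc x a n m : (n <= m)%N ->
  partial_sum x (fun i => if (i < n)%N then a i else 0) m = partial_sum x a n.
Proof.
move=> nm; elim: m nm => [|m IH].
  by rewrite leqn0 => /eqP ->; rewrite /partial_sum !big_ord0.
rewrite leq_eqVlt => /orP[/eqP ->|]; first by apply: eq_bigr => i _; rewrite ltn_ord.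
by move=> nm; rewrite partial_sumS ltnNge -ltnS nm/= scale0r addr0 IH.
Qed.

Lemma carrier_partial_sum x a n :
  (forall i, carrier (x i)) -> carrier (partial_sum x a n).
Proof. by move=> cx; apply: carrier_sum => i; exact: carrierZ. Qed.

Section span.
Variable x : nat -> X.
Hypothesis cx : forall i, carrier (x i).

Lemma closed_span_carrier v : closed_span x v -> carrier v.
Proof. by case. Qed.

Lemma closed_span_partial_sum a n : closed_span x (partial_sum x a n).
Proof.
split=> [|e e0]; first exact: carrier_partial_sum.
by exists n, a; rewrite subrr nrm0.
Qed.

Lemma closed_spanL c u v :
  closed_span x u -> closed_span x v -> closed_span x (c *: u + v).
Proof.
move=> [cu hu] [cv hv]; split=> [|e e0]; first exact: carrierL.
have m0 := modulus_ge0 c.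
have [|n [a ha]] := hu (e / 2 / (modulus c + 1)).
  by rewrite !divr_gt0// ltr_wpDl.
have [|m [b hb]] := hv (e / 2); first by rewrite divr_gt0.
exists (maxn n m), (fun i => c * (if (i < n)%N then a i else 0) +
                             (if (i < m)%N then b i else 0)).
rewrite partial_sumL !partial_sum_trunc ?leq_maxl ?leq_maxr//.
rewrite opprD addrACA -scalerBr.
have cp y p : carrier (partial_sum x y p) by exact: carrier_partial_sum.
have := ler_nrmD sX (carrierZ c (carrierB cu (cp a n))) (carrierB cv (cp b m)).
move=> /le_lt_trans; apply; rewrite (nrmZ sX); last exact: carrierB.
rewrite (splitr e); apply: ler_ltD => //.
apply: (@le_trans _ _ (modulus c * (e / 2 / (modulus c + 1)))).
  by rewrite ler_wpM2l// ltW.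
rewrite mulrA ler_pdivrMr ?ltr_wpDl// mulrC ler_wpM2l// ?lerDl//.
by rewrite divr_ge0// ltW.
Qed.

Lemma closed_span0 : closed_span x 0.
Proof.
by have := closed_span_partial_sum (fun=> 0) 0; rewrite /partial_sum big_ord0.
Qed.

Lemma closed_spanZ c u : closed_span x u -> closed_span x (c *: u).
Proof.
by move=> hu; have := closed_spanL c hu closed_span0; rewrite addr0.
Qed.

Lemma closed_spanD u v :
  closed_span x u -> closed_span x v -> closed_span x (u + v).
Proof. by move=> hu hv; have := closed_spanL 1 hu hv; rewrite scale1r. Qed.

Lemma closed_spanB u v :
  closed_span x u -> closed_span x v -> closed_span x (u - v).
Proof. by move=> hu hv; have := closed_spanL (-1) hv hu; rewrite scaleN1r addrC. Qed.

Lemma closed_span_mem n : closed_span x (x n).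
Proof.
have -> : x n = partial_sum x (fun i => (i == n)%:R) n.+1.
  rewrite partial_sumS eqxx scale1r /partial_sum big1 ?add0r// => i _.
  by rewrite ltn_eqF// scale0r.
exact: closed_span_partial_sum.
Qed.

Lemma closed_span_sum I (r : seq I) (f : I -> X) :
  (forall i, closed_span x (f i)) -> closed_span x (\sum_(i <- r) f i).
Proof.
move=> cf; elim: r => [|i r IH]; first by rewrite big_nil; exact: closed_span0.
by rewrite big_cons; exact: closed_spanD.
Qed.

Lemma closed_span_closed v : carrier v ->
  (forall e : R, 0 < e -> exists2 u, closed_span x u & nrm (v - u) < e) ->
  closed_span x v.
Proof.
move=> cv h; split=> // e e0; have e20 : 0 < e / 2 by rewrite divr_gt0.
have [u [cu hu] uv] := h _ e20; have [n [a ha]] := hu _ e20.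
exists n, a; have ca := carrier_partial_sum a n cx.
apply: le_lt_trans (nrm_triangle cv cu ca) _.
by rewrite (splitr e) ltrD.
Qed.

Lemma expansionP v a : carrier v -> expansion x v a <->
  forall e, 0 < e -> exists N, forall n, (N <= n)%N ->
    nrm (v - partial_sum x a n) < e.
Proof.
move=> cv; apply: cvg0P => n; apply: (nrm_ge0 sX).
by apply: carrierB => //; exact: carrier_partial_sum.
Qed.

Lemma expansion_closed_span v a : carrier v ->
  expansion x v a -> closed_span x v.
Proof.
move=> cv /(expansionP _ cv) h; split => // e e0; have [N hN] := h e e0.
by exists N, a; exact: hN.
Qed.

Lemma expansionL c u v a b : carrier u -> carrier v ->
  expansion x u a -> expansion x v b ->
  expansion x (c *: u + v) (fun i => c * a i + b i).
Proof.
move=> cu cv /(expansionP _ cu) ha /(expansionP _ cv) hb.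
apply/expansionP; first exact: carrierL.
move=> e e0; have m0 := modulus_ge0 c.
have [|n hn] := ha (e / 2 / (modulus c + 1)).
  by rewrite !divr_gt0// ltr_wpDl.
have [|m hm] := hb (e / 2); first by rewrite divr_gt0.
exists (maxn n m) => p; rewrite geq_max => /andP[np mp].
rewrite partial_sumL opprD addrACA -scalerBr.
have cp y q : carrier (partial_sum x y q) by exact: carrier_partial_sum.
have := ler_nrmD sX (carrierZ c (carrierB cu (cp a p))) (carrierB cv (cp b p)).
move=> /le_lt_trans; apply; rewrite (nrmZ sX); last exact: carrierB.
rewrite (splitr e); apply: ler_ltD; last exact: hm.
apply: (@le_trans _ _ (modulus c * (e / 2 / (modulus c + 1)))).
  by rewrite ler_wpM2l// ltW// hn.
rewrite mulrA ler_pdivrMr ?ltr_wpDl// mulrC ler_wpM2l// ?lerDl//.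
by rewrite divr_ge0// ltW.
Qed.

Lemma expansion_partial_sum a n :
  expansion x (partial_sum x a n) (fun i => if (i < n)%N then a i else 0).
Proof.
apply/expansionP; first exact: carrier_partial_sum.
by move=> e e0; exists n => m nm; rewrite partial_sum_trunc// subrr nrm0.
Qed.

Lemma expansion_same u v a : carrier u -> carrier v -> same u v ->
  expansion x u a -> expansion x v a.
Proof.
move=> cu cv uv /(expansionP _ cu) h; apply/expansionP => // e e0.
have [N hN] := h e e0; exists N => n Nn.
have cp : carrier (partial_sum x a n) by exact: carrier_partial_sum.
rewrite (le_lt_trans (nrm_triangle cv cu cp))//.
by rewrite nrm_subC// [nrm (u - v)]uv add0r hN.
Qed.

End span.
End seminormed.

(** * Equivalent sequences and uniform boundedness *)
Section maps.
Set Implicit Arguments.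
Unset Strict Implicit.
Context {R : realType} {k : scalar_kind}.
Local Notation K := (Defs.scalar R k).
Context {X Y : nspace R K}.
Hypotheses (sX : seminormed X) (sY : seminormed Y).
Variables (x : nat -> X) (y : nat -> Y).
Hypotheses (cx : forall i, carrier (x i)) (cy : forall i, carrier (y i)).

Lemma bounded_linear_bound (A : set X) (B : set Y) T : bounded_linear A B T ->
  (forall u, A u -> 0 <= nrm u) ->
  exists2 M : R, 0 < M & forall u, A u -> nrm (T u) <= M * nrm u.
Proof.
move=> [_ _ [M hM]] pA; exists (`|M| + 1); first by rewrite ltr_wpDl.
move=> u Au; rewrite (le_trans (hM _ Au))// ler_wpM2r ?pA//.
by rewrite (le_trans (ler_norm _))// lerDl.
Qed.

Lemma bounded_linear_partial_sum T a n :
  bounded_linear (closed_span x) (closed_span y) T ->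
  (forall i, same (T (x i)) (y i)) ->
  same (T (partial_sum x a n)) (partial_sum y a n).
Proof.
move=> bT Txy; have [TE Tlin _] := bT.
have [M M0 hM] := bounded_linear_bound bT (fun u hu => nrm_ge0 sX hu.1).
have cT u : closed_span x u -> carrier (T u).
  by move=> /TE; exact: closed_span_carrier.
have cp p : carrier (partial_sum y a p) by exact: carrier_partial_sum.
have ep p : closed_span x (partial_sum x a p) by exact: closed_span_partial_sum.
have ex i := closed_span_mem sX cx i.
elim: n => [|n IH].
  rewrite /partial_sum !big_ord0 /same subr0; apply/eqP; rewrite eq_le.
  have h0 := closed_span0 sX cx.
  rewrite (nrm_ge0 sY (cT _ h0)) andbT (le_trans (hM _ h0))//.
  by rewrite (nrm0 sX) mulr0.
rewrite !partial_sumS /same (addrC (partial_sum x _ _)) (addrC (partial_sum y _ _)).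
apply/eqP; rewrite eq_le; apply/andP; split; last first.
  apply: (nrm_ge0 sY); apply: (carrierB sY); last exact: (carrierL sY).
  by apply: cT; exact: closed_spanL.
have c1 : carrier (T (a n *: x n + partial_sum x a n)).
  by apply: cT; exact: closed_spanL.
have c2 : carrier (a n *: T (x n) + T (partial_sum x a n)).
  by apply: (carrierL sY); exact: cT.
have c3 : carrier (a n *: y n + partial_sum y a n) by exact: (carrierL sY).
apply: le_trans (nrm_triangle sY c1 c2 c3) _.
rewrite (Tlin _ _ _ (ex n) (ep n)) add0r opprD addrACA -scalerBr.
have d1 : carrier (T (x n) - y n) by apply: (carrierB sY) => //; exact: cT.
have d2 : carrier (T (partial_sum x a n) - partial_sum y a n).
  by apply: (carrierB sY) => //; exact: cT.
apply: le_trans (ler_nrmD sY (carrierZ sY _ d1) d2) _.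
by rewrite (nrmZ sY)// [nrm (T (x n) - y n)](Txy n) mulr0 add0r IH.
Qed.

(** The form in which equivalence is used: the maps between the spans disappear
    and only norms of finite combinations are compared. *)
Lemma equivalent_partial_sum : equivalent x y ->
  exists2 M : R, 0 < M & forall a n,
    nrm (partial_sum y a n) <= M * nrm (partial_sum x a n).
Proof.
move=> [T [S [bT bS ST TS Txy]]].
have [M M0 hM] := bounded_linear_bound bT (fun u hu => nrm_ge0 sX hu.1).
exists M => // a n.
have ep := closed_span_partial_sum sX cx a n.
rewrite -(same_nrm sY _ _ (bounded_linear_partial_sum a n bT Txy)).
- exact: hM.
- by case: bT => + _ _ => /(_ _ ep) [].
- exact: carrier_partial_sum.
Qed.

(** One half of being a basic sequence passes to an equivalent sequence. *)
Lemma equivalent_expansion v : equivalent x y -> basic_sequence x ->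
  closed_span y v -> exists a, expansion y v a.
Proof.
move=> [T [S [bT bS ST TS Txy]]] bx yv.
have [_ /(_ (S v))[]] := bx; first by case: bS => + _ _; apply.
move=> a [/(expansionP sX cx)ha _].
have [M M0 hM] := bounded_linear_bound bT (fun u hu => nrm_ge0 sX hu.1).
have xSv : closed_span x (S v) by case: bS => + _ _; apply.
have cSv := xSv.1.
exists a; apply/(expansionP sY cy); first by case: yv.
move=> e e0; have [|N hN] := ha cSv (e / M); first by rewrite divr_gt0.
exists N => n Nn; have ep := closed_span_partial_sum sX cx a n.
have [TE Tlin _] := bT.
have c1 := (TE _ xSv).1; have c2 := (TE _ ep).1.
have cp : carrier (partial_sum y a n) by exact: carrier_partial_sum.
have cv : carrier v by case: yv.
apply: le_lt_trans (nrm_triangle sY cv c1 cp) _.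
rewrite (nrm_subC sY)// (TS _ yv) add0r.
apply: le_lt_trans (nrm_triangle sY c1 c2 cp) _.
rewrite (bounded_linear_partial_sum a n bT Txy) addr0.
have : same (T (-1 *: partial_sum x a n + S v))
            (-1 *: T (partial_sum x a n) + T (S v)) by exact: Tlin.
rewrite !scaleN1r ![- _ + _]addrC => /(same_nrm sY) <-.
- have hD := closed_spanB sX cx xSv ep.
  apply: le_lt_trans (hM _ hD) _.
  by rewrite mulrC -ltr_pdivlMr// hN.
- by apply: (TE _ _).1; exact: closed_spanB.
- exact: (carrierB sY).
Qed.

End maps.

Lemma expr_half_small {R : realType} (e : R) : 0 < e ->
  exists n, (2^-1 : R) ^+ n < e.
Proof.
move=> e0; exists (Num.bound e^-1).
have h := archi_boundP (ltW (eqbRL (invr_gt0 e) e0)).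
rewrite exprVn -[ltRHS]invrK ltf_pV2 ?posrE ?invr_gt0 ?exprn_gt0//.
apply: (lt_le_trans h); rewrite -natrX ler_nat ltnW//.
exact: ltn_expl.
Qed.

Section uniform_boundedness.
Set Implicit Arguments.
Unset Strict Implicit.
Context {R : realType} {k : scalar_kind}.
Local Notation K := (Defs.scalar R k).
Context {X : nspace R K}.
Hypotheses (sX : seminormed X) (kX : complete X).
Variables (x : nat -> X) (J : Type) (T : J -> X -> X).
Hypotheses (cx : forall i, carrier (x i)).
Local Notation E := (closed_span x).
Hypothesis TE : forall j u, E u -> carrier (T j u).
Hypothesis Tlin : forall j c u v, E u -> E v ->
  T j (c *: u + v) = c *: T j u + T j v.
Hypothesis Tbound : forall j, exists2 c : R, 0 <= c &
  forall u, E u -> nrm (T j u) <= c * nrm u.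
Hypothesis Tptwise : forall u, E u ->
  exists C : R, forall j, nrm (T j u) <= C.

Let opn j := inf [set c : R | 0 <= c /\ forall u, E u -> nrm (T j u) <= c * nrm u].

Let E_nrm u : E u -> 0 <= nrm u.
Proof. by move=> [cu _]; exact: nrm_ge0. Qed.

Let opn_has_inf j :
  has_inf [set c : R | 0 <= c /\ forall u, E u -> nrm (T j u) <= c * nrm u].
Proof.
split; last by exists 0 => c [].
by have [c c0 hc] := Tbound j; exists c.
Qed.

Let opn_ge0 j : 0 <= opn j.
Proof. by apply: lb_le_inf => [|c []//]; case: (opn_has_inf j). Qed.

Let opn_le j u : E u -> nrm (T j u) <= opn j * nrm u.
Proof.
move=> Eu; have := E_nrm Eu; rewrite le_eqVlt => /orP[/eqP u0|u0].
  by have [c c0 /(_ u Eu)] := Tbound j; rewrite -u0 !mulr0.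
rewrite -ler_pdivrMr//; apply: lb_le_inf; first by case: (opn_has_inf j).
by move=> c [_ /(_ u Eu)]; rewrite ler_pdivrMr.
Qed.

Let opn_attained j (r : R) : 0 < opn j -> 0 < r ->
  exists w, [/\ E w, nrm w = r & 2 / 3 * opn j * r <= nrm (T j w)].
Proof.
move=> o0 r0.
have [v [Ev hv]] : exists v, E v /\ 2 / 3 * opn j * nrm v < nrm (T j v).
  apply: contrapT => /forallNP h.
  have : opn j <= 2 / 3 * opn j.
    apply: ge_inf; first by case: (opn_has_inf j).
    split; first lra.
    move=> u Eu; rewrite leNgt; apply/negP => hu; exact: (h u).
  lra.
have v0 : 0 < nrm v.
  rewrite lt_neqAle E_nrm// andbT; apply/eqP => v0.
  by have := opn_le j Ev; rewrite -v0 mulr0 leNgt; move: hv; rewrite -v0 mulr0 => ->.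
pose c : K := scalar_of k (r / nrm v) 0.
have mc : modulus c = r / nrm v.
  rewrite modulusE scalar_re_of scalar_im_of// expr0n addr0 sqrtr_sqr ger0_norm//.
  by rewrite divr_ge0// ltW.
exists (c *: v); split; first exact: closed_spanZ.
  by rewrite (nrmZ sX) ?mc ?divfK ?gt_eqF//; case: Ev.
have T0 : T j 0 = 0.
  have E0 := closed_span0 sX cx.
  by have := Tlin j (-1) E0 E0; rewrite scaler0 addr0 scaleN1r addNr.
have := Tlin j c Ev (closed_span0 sX cx).
rewrite addr0 T0 addr0 => ->; rewrite (nrmZ sX) ?mc; last exact: TE.
rewrite [leRHS]mulrAC ler_pdivlMr//.
have -> : 2 / 3 * opn j * r * nrm v = r * (2 / 3 * opn j * nrm v) by ring.
by rewrite ler_wpM2l// ltW.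
Qed.

(** Gliding hump: if the norms were unbounded one could add vectors w_n of size
    4^-n with suitable signs so that the n-th operator is large on the sum. *)
Lemma uniform_boundedness : exists2 C : R, 0 < C &
  forall j u, E u -> nrm (T j u) <= C * nrm u.
Proof.
have [[C hC]|] := pselect (exists C, forall j, opn j <= C).
  exists (`|C| + 1) => [|j u Eu]; first by rewrite ltr_wpDl.
  rewrite (le_trans (opn_le j Eu))// ler_wpM2r ?E_nrm//.
  by rewrite (le_trans (hC j))// (le_trans (ler_norm _))// lerDl.
move=> /forallNP unb.
pose q n : R := 4^-1 ^+ n.
have q0 n : 0 < q n by rewrite exprn_gt0// invr_gt0.
have /choice[jw hjw] n : exists jw : J * X, [/\ E jw.2, nrm jw.2 = q n,
    2 / 3 * opn jw.1 * q n <= nrm (T jw.1 jw.2) &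
    3 * n%:R <= opn jw.1 * q n].
  have /existsNP[j /negP] := unb (1 + 3 * n%:R / q n); rewrite -ltNge => hj.
  have p0 : 0 <= 3 * n%:R / q n by rewrite divr_ge0 ?mulr_ge0// ltW.
  have [|w [Ew nw Tw]] := @opn_attained j (q n) _ (q0 n); first lra.
  exists (j, w); split => //=; rewrite -ler_pdivrMr//; lra.
pose j n := (jw n).1; pose w n := (jw n).2.
have Ew n : E (w n) by case: (hjw n).
pose step n u := if nrm (T (j n) (w n)) <= nrm (T (j n) (u + w n))
                 then u + w n else u - w n.
pose u := fix u n := if n is m.+1 then step m (u m) else 0.
have Eu n : E (u n).
  elim: n => [|n IH] /=; first exact: closed_span0.
  by rewrite /step; case: ifP => _; [exact: closed_spanD|exact: closed_spanB].
have uS n : nrm (u n.+1 - u n) <= q n.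
  have [_ nw _ _] := hjw n.
  rewrite /= /step; case: ifP => _; rewrite addrC addKr ?nw//.
  by rewrite (nrmN sX) ?nw//; case: (Ew n).
have Tu n : nrm (T (j n) (w n)) <= nrm (T (j n) (u n.+1)).
  rewrite /= /step; case: ifPn => //; rewrite -ltNge => h.
  have e1 : T (j n) (u n + w n) = T (j n) (u n) + T (j n) (w n).
    by have := Tlin (j n) 1 (Eu n) (Ew n); rewrite !scale1r.
  have e2 : T (j n) (u n - w n) = T (j n) (u n) - T (j n) (w n).
    by have := Tlin (j n) (-1) (Ew n) (Eu n); rewrite !scaleN1r ![- _ + _]addrC.
  have cu := TE (j n) (Eu n); have cw := TE (j n) (Ew n).
  have := ler_nrmB sX (carrierD sX cu cw) (carrierB sX cu cw).
  rewrite opprB addrC addrA subrK -{1 2}(scale1r (T (j n) (w n))) -scalerDl.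
  rewrite (nrmZ sX)// -{1}e1 -e2.
  have -> : modulus (1 + 1 : K) = 2.
    rewrite modulusE scalar_reD scalar_imD.
    have -> : scalar_re (1 : K) = 1 by rewrite /scalar_re; case: (k).
    have -> : scalar_im (1 : K) = 0 by rewrite /scalar_im; case: (k).
    by rewrite addr0 expr0n addr0 sqrtr_sqr ger0_norm// addr_ge0.
  rewrite e1 in h *; lra.
have q1 n : q n <= 2^-1 ^+ n.
  by rewrite /q lerXn2r ?nnegrE ?invr_ge0// lef_pV2 ?posrE// ler_nat.
have [v [cv hv]] := kX (f := fun n => u n.+1 - u n)
  (fun n => carrierB sX (Eu n.+1).1 (Eu n).1) (fun n => le_trans (uS n) (q1 n)).
have uE n : \sum_(i < n) (u i.+1 - u i) = u n.
  rewrite -(big_mkord xpredT (fun i => u i.+1 - u i)).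
  by rewrite telescope_sumr// subr0.
have vu n : nrm (v - u n.+1) <= q n / 3.
  apply/ler_addgt0Pr => e e0.
  have [m hm] := expr_half_small (divr_gt0 e0 (ltr0Sn _ 1)).
  have um p : nrm (u (n.+1 + p)%N - u n.+1) <= (q n - q (n + p)%N) / 3.
    elim: p => [|p IH]; first by rewrite !addn0 !subrr mul0r (nrm0 sX).
    have := nrm_triangle sX (Eu (n.+1 + p.+1)%N).1 (Eu (n.+1 + p)%N).1 (Eu n.+1).1.
    move=> /le_trans; apply; rewrite (addnS n.+1 p) (addnS n p).
    have qS i : q i.+1 = q i / 4 by rewrite /q exprS mulrC.
    by have := uS (n.+1 + p)%N; move: IH; rewrite addSn !qS; lra.
  have := nrm_triangle sX cv (Eu (n.+1 + m)%N).1 (Eu n.+1).1.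
  move=> /le_trans; apply; rewrite addrC lerD//.
    by apply: le_trans (um m) _; have := q0 (n + m)%N; lra.
  have := hv (n.+1 + m)%N; rewrite uE => /le_trans; apply.
  rewrite exprD; have : (2^-1 : R) ^+ n.+1 <= 1.
    by rewrite exprn_ile1// ?invr_ge0// invf_le1// ler1n.
  have : 0 < (2^-1 : R) ^+ m by rewrite exprn_gt0// invr_gt0.
  move: hm; set a := _ ^+ m; set b := _ ^+ n.+1 => hm a0 b1; nra.
have Ev : E v.
  apply: (closed_span_closed sX cx cv) => e e0.
  have [m hm] := expr_half_small e0; exists (u m.+1) => //.
  apply: le_lt_trans (vu m) (le_lt_trans _ hm).
  by apply: le_trans (q1 m); have := q0 m; lra.
have [C hC] := Tptwise Ev.
have [n hn] : exists n : nat, C < n%:R.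
  by exists (Num.bound `|C|); rewrite (le_lt_trans (ler_norm _))// archi_boundP.
have [_ _ h1 h2] := hjw n.
have := ler_nrm_dist sX (TE (j n) (Eu n.+1)) (TE (j n) Ev).
have -> : T (j n) (u n.+1) - T (j n) v = T (j n) (u n.+1 - v).
  by have := Tlin (j n) (-1) Ev (Eu n.+1); rewrite !scaleN1r ![- _ + _]addrC.
have := opn_le (j n) (closed_spanB sX cx (Eu n.+1) Ev).
rewrite (nrm_subC sX (Eu n.+1).1 cv) => h3.
have := hC (j n); have := Tu n.
have : opn (j n) * nrm (v - u n.+1) <= opn (j n) * (q n / 3).
  by rewrite ler_wpM2l.
move: h1 h2 h3; rewrite -/(j n) -/(w n); move: hn; lra.
Qed.

End uniform_boundedness.

(** * Coordinate functionals of subsymmetric sequences *)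
Section bump_rearrangement.
Set Implicit Arguments.
Unset Strict Implicit.

(** The rearrangement is read off an increasing chain of duplicate-free lists:
    the k-th list is continued by a set beyond its entries and then by the
    missing numbers up to k, so that every number occurs. *)
Lemma block_rearrangement (A : nat -> seq nat) :
  (forall n, uniq (A n)) -> (forall n, all (leq n) (A n)) ->
  exists s : nat -> nat, bijective s /\
    forall k, exists p n, [/\ (k <= p)%N, (k <= n)%N &
      [seq s i | i <- iota p (size (A n))] = A n].
Proof.
move=> uA lA.
pose bd (l : seq nat) := foldr maxn 0 (map succn l).
have bdP l i : i \in l -> (i < bd l)%N.
  elim: l => //= a l IH; rewrite inE => /orP[/eqP ->|/IH].
    by rewrite leq_max leqnn.
  by rewrite leq_max => ->; rewrite orbT.
pose m k (l : seq nat) := maxn k (bd l).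
pose L1 k l := l ++ A (m k l).
pose step k l := L1 k l ++ [seq i <- iota 0 k.+1 | i \notin L1 k l].
pose L := fix L k := if k is j.+1 then step j (L j) else [::].
have uL1 k l : uniq l -> uniq (L1 k l).
  move=> ul; rewrite /L1 cat_uniq ul uA andbT/=; apply/hasPn => i iA.
  apply/negP => il; have := bdP _ _ il; apply/negP; rewrite -leqNgt.
  by apply: leq_trans (leq_maxr k _) (allP (lA _) _ iA).
have uL k : uniq (L k).
  elim: k => // k IH; rewrite [L _]/(step _ _) /step cat_uniq uL1//.
  by rewrite filter_uniq ?iota_uniq// andbT; apply/hasPn => i; rewrite mem_filter => /andP[].
have LS j : exists l, L j.+1 = L j ++ l.
  by rewrite /= /step /L1 -catA; eexists.
have Lle j k : (j <= k)%N -> exists l, L k = L j ++ l.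
  move=> /subnK <-; elim: (k - j)%N => [|p [l IH]].
    by exists [::]; rewrite cats0.
  by have [l' ->] := LS (p + j)%N; rewrite IH -catA; eexists.
have inL k i : (i < k)%N -> i \in L k.
  case: k => // k ik; rewrite [L _]/(step _ _) /step mem_cat mem_filter mem_iota ik.
  by rewrite leq0n !andbT orbN.
have szL k : (k <= size (L k))%N.
  rewrite -{1}(size_iota 0 k); apply: uniq_leq_size; first exact: iota_uniq.
  by move=> i; rewrite mem_iota add0n => /inL.
pose s n := nth 0%N (L n.+1) n.
have sE k n : (n < size (L k))%N -> s n = nth 0%N (L k) n.
  move=> nk; have n1 : (n < size (L n.+1))%N by exact: szL.
  rewrite /s; case: (leqP k n.+1) => [/Lle[l ->]|/ltnW /Lle[l ->]].
    by rewrite nth_cat nk.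
  by rewrite nth_cat n1.
have sP n : s n \in L n.+1 by apply: mem_nth; exact: szL.
pose t i := index i (L i.+1).
have ti i : s (t i) = i.
  have iL := inL i.+1 i (ltnSn i).
  by rewrite (sE i.+1) ?index_mem// nth_index.
have sI : injective s.
  move=> a b; set M := maxn a b; have aM : (a < size (L M.+1))%N.
    by rewrite (leq_trans _ (szL _))// ltnS leq_maxl.
  have bM : (b < size (L M.+1))%N.
    by rewrite (leq_trans _ (szL _))// ltnS leq_maxr.
  by rewrite (sE M.+1)// (sE M.+1)// => /eqP; rewrite nth_uniq// => /eqP.
exists s; split; first by exists t => // a; apply: sI.
move=> k; exists (size (L k)), (m k (L k)); split => //; first exact: leq_maxl.
set l := A _; have h : L k.+1 = L k ++ l ++ [seq i <- iota 0 k.+1 | i \notin L1 k (L k)].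
  by rewrite /= /step /L1 -catA.
apply: (@eq_from_nth _ 0%N); first by rewrite size_map size_iota.
move=> i; rewrite size_map size_iota => il.
rewrite (nth_map 0%N) ?size_iota// nth_iota// (sE k.+1); last first.
  by rewrite h !size_cat ltn_add2l ltn_addr.
by rewrite h nth_cat ltnNge leq_addr/= addKn nth_cat il.
Qed.

End bump_rearrangement.

Section basis.
Set Implicit Arguments.
Unset Strict Implicit.
Context {R : realType} {k : scalar_kind}.
Local Notation K := (Defs.scalar R k).
Context {X : nspace R K}.
Hypotheses (sX : seminormed X) (kX : complete X).

Definition coef (x : nat -> X) (v : X) : nat -> K :=
  xget (fun=> 0) [set a | expansion x v a].

Variable x : nat -> X.
Hypothesis bx : basic_sequence x.
Local Notation E := (closed_span x).

Let cx : forall i, carrier (x i). Proof. by case: bx. Qed.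

Lemma coef_expansion v : E v -> expansion x v (coef x v).
Proof.
by move=> /bx.2 [a [ha _]]; rewrite /coef; case: xgetP => [b _ //|/(_ a)].
Qed.

Lemma coef_unique v a : carrier v -> expansion x v a -> coef x v = a.
Proof.
move=> cv ha; have Ev := expansion_closed_span sX cx cv ha.
have [b [hb ub]] := bx.2 _ Ev.
by rewrite -(ub _ ha) -(ub _ (coef_expansion Ev)).
Qed.

Lemma coefL c u v : E u -> E v ->
  coef x (c *: u + v) = (fun i => c * coef x u i + coef x v i).
Proof.
move=> Eu Ev; apply: coef_unique; first by apply: (carrierL sX); [case: Eu|case: Ev].
by apply: (expansionL sX cx); [case: Eu|case: Ev|exact: coef_expansion..].
Qed.

Lemma coef_same u v : carrier u -> E v -> same v u -> coef x u = coef x v.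
Proof.
move=> cu Ev vu; apply: coef_unique => //.
apply: (expansion_same sX cx _ cu vu); first by case: Ev.
exact: coef_expansion.
Qed.

Lemma coef_partial_sum a n :
  coef x (partial_sum x a n) = (fun i => if (i < n)%N then a i else 0).
Proof.
apply: coef_unique; first exact: carrier_partial_sum.
exact: (expansion_partial_sum sX cx).
Qed.

Lemma coef_basis n : coef x (x n) = (fun i => (i == n)%:R).
Proof.
have -> : x n = partial_sum x (fun i => (i == n)%:R) n.+1.
  rewrite partial_sumS eqxx scale1r /partial_sum big1 ?add0r// => i _.
  by rewrite ltn_eqF// scale0r.
rewrite coef_partial_sum; apply/funext => i; case: ifPn => //.
by rewrite -leqNgt => ni; rewrite gtn_eqF.
Qed.

Lemma partial_sum_bump a n m : (n <= m)%N ->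
  partial_sum x a m.+1 =
  a n *: x n + partial_sum (x \o bump n) (a \o bump n) m.
Proof.
move=> nm; rewrite /partial_sum.
by rewrite (bigD1_ord (Ordinal (nm : (n < m.+1)%N)))//=.
Qed.

Hypothesis spx : spreading x.

(** If x_n were a limit of combinations of the other x_i, then it would have an
    expansion along them, because x without x_n is a basic sequence too. *)
Lemma dist_to_others n : exists2 d : R, 0 < d &
  forall a m, d <= nrm (x n - partial_sum (x \o bump n) a m).
Proof.
apply: contrapT => h.
have cb i : carrier ((x \o bump n) i) by exact: cx.
have xn : closed_span (x \o bump n) (x n).
  split => // e e0; apply: contrapT => h'; apply: h; exists e => // a m.
  by rewrite leNgt; apply/negP => h2; apply: h'; exists m, a.
have [|b hb] := equivalent_expansion sX sX cx cb (spx _) bx xn.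
  by move=> i j ij; rewrite ltnNge leq_bump2 -ltnNge.
pose b' i := if i == n then 0 else b (unbump n i).
have hb' : expansion x (x n) b'.
  apply/(expansionP sX cx _ (cx n)) => e e0.
  have [N hN] := (expansionP sX cb b (cx n)).1 hb e e0.
  exists (maxn N n).+1 => -[//|m]; rewrite ltnS geq_max => /andP[Nm nm].
  rewrite (partial_sum_bump _ nm) /b' eqxx scale0r add0r.
  rewrite [X in _ - X](_ : _ = partial_sum (x \o bump n) b m); first exact: hN.
  by apply: eq_bigr => i _ /=; rewrite eq_sym (negbTE (neq_bump _ _)) bumpK.
have := coef_unique (cx n) hb'; rewrite coef_basis => /(congr1 (@^~ n)).
by rewrite /b' eqxx => /eqP; rewrite oner_eq0.
Qed.

(** The distance from x_n to the other x_i bounds the n-th coordinate. *)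
Lemma coef_bounded n : exists2 c : R, 0 <= c &
  forall v, E v -> modulus (coef x v n) <= c * nrm v.
Proof.
have [d d0 hd] := dist_to_others n.
have cb i : carrier ((x \o bump n) i) by exact: cx.
exists d^-1 => [|v Ev]; first by rewrite invr_ge0 ltW.
rewrite mulrC ler_pdivlMr//; set a := coef x v.
have cv : carrier v by case: Ev.
apply/ler_addgt0Pr => e e0.
have [N hN] := (expansionP sX cx a cv).1 (coef_expansion Ev) e e0.
have hm : (N <= (maxn N n).+1)%N by rewrite ltnW// ltnS leq_maxl.
have cp m : carrier (partial_sum x a m) by exact: carrier_partial_sum.
apply: (@le_trans _ _ (nrm (partial_sum x a (maxn N n).+1))); last first.
  apply: le_trans (ler_nrm_dist sX (cp _) cv) _.
  by rewrite lerD2l (nrm_subC sX) ?ltW ?hN.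
have [->|an0] := eqVneq (a n) 0.
  by rewrite modulus0 mul0r (nrm_ge0 sX).
rewrite (partial_sum_bump _ (leq_maxr N n)).
set z := partial_sum _ _ _; have cz : carrier z by exact: carrier_partial_sum.
have -> : a n *: x n + z =
    a n *: (x n - partial_sum (x \o bump n) (fun i => - (a n)^-1 * a (bump n i)) (maxn N n)).
  rewrite scalerBr; congr (_ + _).
  rewrite /z /partial_sum scaler_sumr -sumrN; apply: eq_bigr => i _ /=.
  by rewrite scalerA mulrA mulrN divff// mulN1r scaleNr opprK.
rewrite (nrmZ sX); last by apply: (carrierB sX) => //; exact: carrier_partial_sum.
by rewrite ler_wpM2l ?modulus_ge0.
Qed.

Hypothesis ux : unconditional x.

Definition span_proj (A : seq nat) v := \sum_(i <- A) coef x v i *: x i.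

(** Otherwise finite sets A_n beyond n would carry a fixed part of v; a
    rearrangement that lists each A_n consecutively would not expand v. *)
Lemma unconditional_cauchy v (e : R) : E v -> 0 < e -> exists N, forall A,
  uniq A -> all (leq N) A -> nrm (span_proj A v) < e.
Proof.
move=> Ev e0; apply: contrapT => /forallNP h.
have /choice[A hA] N : exists A, [/\ uniq A, all (leq N) A &
    e <= nrm (span_proj A v)].
  have /existsNP[A h1] := h N; exists A.
  move: h1 => /not_implyP[uA /not_implyP[lA /negP]].
  by rewrite -leNgt.
have [|n|s [bs hs]] := @block_rearrangement A; first by move=> n; case: (hA n).
  by case: (hA n).
have bxs := ux bs.
have [t st ts] := bs.
have cxs i : carrier ((x \o s) i) by exact: cx.
have Esv : closed_span (x \o s) v.
  apply: (closed_span_closed sX cxs); first by case: Ev.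
  move=> d d0; have [cv hv] := Ev; have [n [a ha]] := hv d d0.
  exists (partial_sum x a n) => //.
  apply: (closed_span_sum sX cxs) => i; apply: (closed_spanZ sX cxs).
  by rewrite -(ts i); exact: (closed_span_mem sX cxs).
have [b [hb _]] := bxs.2 _ Esv.
have cv : carrier v by case: Ev.
have hb2 := (expansionP sX cxs b cv).1 hb.
have bE i : b i = coef x v (s i).
  have [c c0 hc] := coef_bounded (s i).
  apply/eqP; rewrite eq_sym -subr_eq0; apply/eqP/modulus_eq0/eqP.
  rewrite eq_le modulus_ge0 andbT; apply/ler_addgt0Pr => d d0; rewrite add0r.
  have [|N hN] := hb2 (d / (c + 1)); first by rewrite divr_gt0// ltr_wpDl.
  pose n := maxn N i.+1.
  have Ep : E (partial_sum (x \o s) b n).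
    apply: (closed_span_sum sX cx) => j; apply: (closed_spanZ sX cx).
    exact: (closed_span_mem sX cx).
  have := hc _ (closed_spanB sX cx Ev Ep).
  have := coefL (-1) Ep Ev; rewrite scaleN1r addrC => ->; rewrite mulN1r addrC.
  have -> : coef x (partial_sum (x \o s) b n) (s i) = b i.
    have -> : partial_sum (x \o s) b n = partial_sum x
       (fun j => if (t j < n)%N then b (t j) else 0) (\max_(i < n) s i).+1.
      transitivity (\sum_(j <- map s (iota 0 n)) b (t j) *: x j).
        by rewrite big_map partial_sum_iota; apply: eq_bigr => j _; rewrite st.
      rewrite partial_sum_iota.
      rewrite [RHS](eq_bigr (fun j => if (t j < n)%N then b (t j) *: x j else 0)); last first.
        by move=> j _; case: ifP; rewrite ?scale0r.
      rewrite -big_mkcond -[RHS]big_filter; apply: perm_big; apply: uniq_perm.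
      - by rewrite map_inj_uniq ?iota_uniq//; exact: can_inj st.
      - by rewrite filter_uniq// iota_uniq.
      move=> j; rewrite mem_filter mem_iota/= add0n.
      apply/mapP/andP => [[l]|[tj _]].
        rewrite mem_iota/= => ln ->; rewrite st ln ltnS; split => //.
        exact: (@leq_bigmax_cond _ _ (fun i : 'I_n => s i) (Ordinal ln)).
      by exists (t j); rewrite ?ts// mem_iota.
    rewrite coef_partial_sum st /n leq_max ltnSn orbT ltnS.
    by rewrite (@leq_bigmax_cond _ _ (fun i : 'I_n => s i) (Ordinal (_ : (i < n)%N)))// leq_max ltnSn orbT.
  move=> /le_trans; apply.
  apply: (@le_trans _ _ (c * (d / (c + 1)))).
    by rewrite ler_wpM2l// ltW// hN// leq_maxl.
  by rewrite mulrCA ler_piMr ?(ltW d0)// ler_pdivrMr ?mul1r ?lerDl// ltr_wpDl.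
have [|N hN] := hb2 (e / 2); first by rewrite divr_gt0.
have [p [n [Np _ hp]]] := hs N.
have [_ _] := hA n; rewrite leNgt => /negP; apply.
have -> : span_proj (A n) v = partial_sum (x \o s) b (p + size (A n)) -
                              partial_sum (x \o s) b p.
  rewrite !partial_sum_iota iotaD big_cat/= [RHS]addrC addKr add0n.
  by rewrite /span_proj -{1}hp big_map; apply: eq_bigr => i _; rewrite bE.
have cp m : carrier (partial_sum (x \o s) b m) by exact: carrier_partial_sum.
apply: le_lt_trans (nrm_triangle sX (cp _) cv (cp _)) _.
by rewrite (splitr e) (nrm_subC sX)// ltrD// hN// (leq_trans Np)// leq_addr.
Qed.

Lemma span_proj_closed_span A v : E (span_proj A v).
Proof.
apply: (closed_span_sum sX cx) => i; apply: (closed_spanZ sX cx).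
exact: closed_span_mem.
Qed.

Theorem span_proj_bounded : exists2 C : R, 0 < C &
  forall A v, uniq A -> E v -> nrm (span_proj A v) <= C * nrm v.
Proof.
have [||||C C0 hC] := @uniform_boundedness R k X sX kX x {A : seq nat | uniq A}
   (fun A => span_proj (sval A)) cx.
- by move=> A u _; case: (span_proj_closed_span (sval A) u).
- move=> A c u v Eu Ev; rewrite /span_proj scaler_sumr -big_split/=.
  by apply: eq_bigr => i _; rewrite coefL// scalerDl scalerA.
- move=> [A uA] /=; elim: A uA => [_|i A IH /= /andP[_ uA]].
    by exists 0 => // u Eu; rewrite /span_proj big_nil (nrm0 sX) mul0r.
  have [c c0 hc] := IH uA; have [d d0 hd] := coef_bounded i.
  have n0 := nrm_ge0 sX (cx i).
  exists (d * nrm (x i) + c) => [|u Eu]; first by rewrite addr_ge0// mulr_ge0.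
  rewrite /span_proj big_cons.
  have c1 : carrier (span_proj A u) by case: (span_proj_closed_span A u).
  apply: le_trans (ler_nrmD sX (carrierZ sX _ (cx i)) c1) _.
  rewrite mulrDl lerD ?hc// (nrmZ sX)// mulrAC ler_wpM2r//; exact: hd.
- move=> u Eu; have [N hN] := unconditional_cauchy Eu ltr01.
  exists (\sum_(i < N) nrm (coef x u i *: x i) + 1) => -[A uA] /=.
  have cs i : carrier (coef x u i *: x i) by exact: carrierZ.
  have -> : span_proj A u = span_proj [seq i <- A | (i < N)%N] u +
                            span_proj [seq i <- A | (N <= i)%N] u.
    rewrite /span_proj (bigID (fun i => (i < N)%N))/= !big_filter; congr (_ + _).
    by apply: eq_bigl => i; rewrite /= -leqNgt.
  have c1 B : carrier (span_proj B u) by case: (span_proj_closed_span B u).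
  apply: le_trans (ler_nrmD sX (c1 _) (c1 _)) _; rewrite lerD//; last first.
    rewrite ltW// hN ?filter_uniq//; apply/allP => i.
    by rewrite mem_filter => /andP[].
  apply: le_trans (ler_nrm_sum sX _ cs) _.
  rewrite (perm_big [seq i <- iota 0 N | i \in A]); last first.
    apply: uniq_perm; rewrite ?filter_uniq ?iota_uniq// => i.
    by rewrite !mem_filter mem_iota/= add0n andbC.
  rewrite big_filter big_mkcond/=.
  rewrite -[leRHS](big_mkord xpredT (fun i => nrm (coef x u i *: x i))).
  rewrite /index_iota subn0.
  by apply: ler_sum => i _; case: ifP => // _; exact: nrm_ge0.
by exists C => // A v uA Ev; exact: (hC (exist _ A uA)).
Qed.

End basis.

Lemma increasing_choice (P : nat -> nat -> Prop) :
  (forall n m, exists p, (m < p)%N /\ P n p) ->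
  exists s : nat -> nat, {homo s : m n / (m < n)%N} /\ forall n, P n (s n).
Proof.
move=> h; have /choice[f hf] : forall nm : nat * nat,
    exists p, (nm.2 < p)%N /\ P nm.1 p by move=> [n m]; exact: h.
pose s := fix s n := if n is m.+1 then f (n, s m) else f (0%N, 0%N).
exists s; split; last by case=> [|n]; apply: (hf (_, _)).2.
by apply: homo_ltn => [? ? ?|n]; [exact: ltn_trans|exact: (hf (_, _)).1].
Qed.

(** * Biorthogonal systems and sequence spaces *)
Section unconditional_system.
Set Implicit Arguments.
Unset Strict Implicit.
Context {R : realType} {k : scalar_kind}.
Local Notation K := (Defs.scalar R k).
Context {X : nspace R K}.
Hypotheses (sX : seminormed X) (kX : complete X).

(** What survives of a complemented unconditional basic sequence when only the
    operators f |-> sum_(i in A) psi_i(f) y_i matter. *)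
Record usystem (y : nat -> X) (psi : nat -> X -> K) (C : R) : Prop := Usystem {
  usys_carrier : forall i, carrier (y i);
  usys_gt0 : 0 < C;
  usysL : forall i c u v, carrier u -> carrier v ->
    psi i (c *: u + v) = c * psi i u + psi i v;
  usys_biorth : forall i j, psi i (y j) = (j == i)%:R;
  usys_bound : forall A f, uniq A -> carrier f ->
    nrm (\sum_(i <- A) psi i f *: y i) <= C * nrm f }.

Lemma usystem_comp y psi C (s : nat -> nat) : injective s ->
  usystem y psi C -> usystem (y \o s) (psi \o s) C.
Proof.
move=> sI [cy C0 L B U]; split => //=.
- by move=> i; exact: L.
- by move=> i j; rewrite B inj_eq.
move=> A f uA cf; rewrite -(big_map s xpredT (fun i => psi i f *: y i)).
by apply: U => //; rewrite map_inj_uniq.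
Qed.

Variable x : nat -> X.
Hypotheses (bx : basic_sequence x) (spx : spreading x) (ux : unconditional x).

Let cx : forall i, carrier (x i). Proof. by case: bx. Qed.

(** The functionals are the coordinates after the projection. *)
Lemma complemented_usystem : complemented x ->
  exists psi C, usystem x psi C.
Proof.
move=> [P [bP PP PE]].
have [C C0 hC] := span_proj_bounded sX kX bx spx ux.
have [M M0 hM] := bounded_linear_bound bP (fun u hu => nrm_ge0 sX hu).
have [cP Plin _] := bP.
have EP f : carrier f -> closed_span x (P f).
  move=> cf; apply/PE; split; first exact: cP.
  by exists f => //; rewrite /same subrr (nrm0 sX).
exists (fun i f => coef x (P f) i), (C * M); split => //.
- exact: mulr_gt0.
- move=> i c u v cu cv.
  have c1 : carrier (P (c *: u + v)) by apply: cP; exact: (carrierL sX).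
  have E2 : closed_span x (c *: P u + P v).
    by apply: (closed_spanL sX cx); exact: EP.
  have s1 := Plin c u v cu cv.
  rewrite (coef_same sX bx c1 E2).
    by rewrite (coefL sX bx)//; exact: EP.
  by rewrite /same (nrm_subC sX)//; case: E2.
- move=> i j; have cPx := cP _ (cx j).
  have Ex := closed_span_mem sX cx j.
  rewrite (coef_same sX bx cPx Ex) ?(coef_basis sX bx) 1?eq_sym//.
  have /PE[_ [u cu su]] := Ex.
  rewrite /same (nrm_subC sX)//.
  apply/eqP; rewrite eq_le (nrm_ge0 sX) ?andbT; last exact: (carrierB sX).
  have cPu := cP _ cu; have cPPu := cP _ cPu.
  apply: le_trans (nrm_triangle sX cPx cPPu (cx j)) _.
  have c1 : carrier (x j - P u) by exact: (carrierB sX).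
  have h1 : nrm (P (P u) - x j) <= 0.
    apply: le_trans (nrm_triangle sX cPPu cPu (cx j)) _.
    by rewrite [nrm (P (P u) - _)]PP// [nrm (P u - _)]su addr0.
  have h2 : nrm (P (x j - P u)) <= 0.
    by apply: le_trans (hM _ c1) _; rewrite (nrm_subC sX)// [nrm _]su mulr0.
  have := Plin (-1) _ _ cPu (cx j); rewrite !scaleN1r ![- _ + _]addrC => h3.
  have h4 : nrm (P (x j) - P (P u)) <= 0.
    rewrite -(same_nrm sX (cP _ c1) _ h3)//; exact: (carrierB sX).
  by rewrite -(addr0 0) lerD.
- move=> A f uA cf; apply: le_trans (hC A _ uA (EP _ cf)) _.
  by rewrite -mulrA ler_wpM2l ?hM// ltW.
Qed.

Lemma nrm_basis_gt0 i : 0 < nrm (x i).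
Proof.
rewrite lt_neqAle (nrm_ge0 sX (cx i)) andbT; apply/eqP => h.
have [c c0 /(_ (x i) (closed_span_mem sX cx i))] := coef_bounded sX bx spx i.
by rewrite -h mulr0 (coef_basis sX bx) eqxx modulus1 ler10.
Qed.

(** Otherwise some subsequence would grow, or tend to 0, so fast that no constant
    compares the norms of x with it. *)
Lemma spreading_bounds : exists b B : R, 0 < b /\
  forall i, b <= nrm (x i) <= B.
Proof.
pose e n (i : nat) : K := (i == n)%:R.
have pe y n : partial_sum y (e n) n.+1 = y n :> X.
  rewrite partial_sumS /e eqxx scale1r /partial_sum big1 ?add0r// => i _.
  by rewrite ltn_eqF// scale0r.
have [B hB] : exists B, forall i, nrm (x i) <= B.
  apply: contrapT => /forallNP h.
  have [|s [hs1 hs2]] := @increasing_choice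
      (fun n p => n%:R * nrm (x n) < nrm (x p)).
    move=> n m; pose S := n%:R * nrm (x n) + \sum_(i < m.+1) nrm (x i).
    have /existsNP[p /negP] := h S; rewrite -ltNge => hp; exists p.
    have S0 : 0 <= n%:R * nrm (x n) by rewrite mulr_ge0// ltW// nrm_basis_gt0.
    split; last by rewrite (le_lt_trans _ hp)// lerDl sumr_ge0// => i _; rewrite ltW// nrm_basis_gt0.
    rewrite ltnNge; apply/negP => pm; move: hp; apply/negP; rewrite -leNgt /S.
    rewrite (bigD1 (Ordinal (pm : (p < m.+1)%N)))//= addrCA lerDl addr_ge0//.
    by rewrite sumr_ge0// => i _; rewrite ltW// nrm_basis_gt0.
  have [M M0 hM] := equivalent_partial_sum sX sX cx (fun i => cx (s i)) (spx hs1).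
  have [n hn] : exists n : nat, M < n%:R.
    by exists (Num.bound M); rewrite archi_boundP// ltW.
  have := hM (e n) n.+1; rewrite !pe /=; apply/negP; rewrite -ltNge.
  apply: le_lt_trans (hs2 n); rewrite ler_wpM2r ?ltW// nrm_basis_gt0//.
have [b b0 hb] : exists2 b, 0 < b & forall i, b <= nrm (x i).
  apply: contrapT => h.
  have [|s [hs1 hs2]] := @increasing_choice
      (fun n p => n%:R * nrm (x p) < nrm (x n)).
    move=> n m.
    pose d := \big[Num.min/nrm (x n) / n.+1%:R]_(i < m.+1) nrm (x i).
    have d0 : 0 < d.
      rewrite /d; elim/big_ind: _ => [|u v u0 v0|i _].
      - by rewrite divr_gt0// nrm_basis_gt0.
      - by rewrite lt_min u0.
      - exact: nrm_basis_gt0.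
    apply: contrapT => h2; apply: h; exists d => // p; rewrite leNgt; apply/negP => hp.
    apply: h2; exists p; split.
      rewrite ltnNge; apply/negP => pm; move: hp; apply/negP; rewrite -leNgt /d.
      by rewrite (bigD1 (Ordinal (pm : (p < m.+1)%N)))//= ge_min lexx.
    have : nrm (x p) < nrm (x n) / n.+1%:R.
      apply: lt_le_trans hp _; rewrite /d.
      elim/big_rec: _ => // i y _ hy; by rewrite ge_min hy orbT.
    rewrite ltr_pdivlMr// mulrC => /le_lt_trans; apply.
    by rewrite ler_wpM2r// ?ler_nat// ltW// nrm_basis_gt0.
  have [T [S [bT bS ST TS Txy]]] := spx hs1.
  have cxs i : carrier ((x \o s) i) by exact: cx.
  have [M M0 hM] := bounded_linear_bound bS (fun u hu => nrm_ge0 sX hu.1).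
  have [n hn] : exists n : nat, M < n%:R.
    by exists (Num.bound M); rewrite archi_boundP// ltW.
  have Ex := closed_span_mem sX cx n.
  have Es := closed_span_mem sX cxs n.
  have [TE Tlin _] := bT; have [SE Slin _] := bS.
  have h1 : nrm (x n) <= M * nrm (x (s n)).
    have cST := (SE _ (TE _ Ex)).1.
    have sST := ST _ Ex.
    rewrite -(same_nrm sX cST (cx n) sST).
    rewrite (le_trans (hM _ (TE _ Ex)))// ler_wpM2l ?(ltW M0)//.
    by rewrite (same_nrm sX (TE _ Ex).1 (cxs n) (Txy n)).
  have := hs2 n; apply/negP; rewrite -leNgt (le_trans h1)// ler_wpM2r ?ltW//.
  exact: nrm_basis_gt0.
by exists b, B; split => // i; rewrite hb hB.
Qed.

End unconditional_system.

Section sequence_spaces.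
Set Implicit Arguments.
Unset Strict Implicit.
Context {R : realType} {k : scalar_kind}.
Local Notation K := (Defs.scalar R k).
Context {X : nspace R K}.
Hypotheses (sX : seminormed X) (kX : complete X).

Lemma complete_cauchy (u : nat -> X) : (forall n, carrier (u n)) ->
  (forall e, 0 < e -> exists N, forall m n, (N <= m)%N -> (N <= n)%N ->
     nrm (u m - u n) < e) ->
  exists2 v : X, carrier v & forall e, 0 < e -> exists N, forall n,
    (N <= n)%N -> nrm (v - u n) < e.
Proof.
move=> cu hu.
have q0 j : 0 < (2^-1 : R) ^+ j by rewrite exprn_gt0// invr_gt0.
have /choice[N hN] j := hu (2^-1 ^+ j) (q0 j).
pose p := fix p j := if j is i.+1 then maxn (p i) (N j) else N 0%N.
have Np j : (N j <= p j)%N by case: j => [|j] //=; exact: leq_maxr.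
have pS j : (p j <= p j.+1)%N by exact: leq_maxl.
pose f j := if j is i.+1 then u (p j) - u (p i) else 0.
have [v [cv hv]] := kX (f := fun j => u (p j.+1) - u (p j))
  (fun j => carrierB sX (cu _) (cu _))
  (fun j => ltW (hN j _ _ (leq_trans (Np j) (pS j)) (Np j))).
exists (v + u (p 0%N)) => [|e e0]; first exact: (carrierD sX).
have e40 : 0 < e / 3 by rewrite divr_gt0.
have [j hj] := expr_half_small e40; exists (p j) => n pn.
have cv' : carrier (v + u (p 0%N)) by exact: (carrierD sX).
apply: le_lt_trans (nrm_triangle sX cv' (cu (p j)) (cu n)) _.
have h1 : nrm (u (p j) - u n) < 2^-1 ^+ j.
  by apply: hN => //; rewrite (leq_trans (Np j)).
have := hv j.
rewrite -(big_mkord xpredT (fun i => u (p i.+1) - u (p i))).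
rewrite (@telescope_sumr _ 0 j (fun i => u (p i)))// opprB addrA addrAC.
lra.
Qed.

Definition truncate (a : nat -> K) n : nat -> K :=
  fun i => if (i < n)%N then a i else 0.

Lemma partial_sum_unit_vector (car : set (nat -> K^o)) nY a n :
  partial_sum (X := @NSpace R K (nat -> K^o) car nY) (unit_vector R k) a n =
  truncate a n.
Proof.
apply/funext => m; rewrite /partial_sum fct_sumE /truncate.
rewrite (eq_bigr (fun i : 'I_n => if i == m :> nat then a i else 0)); last first.
  move=> i _; rewrite -[LHS]/(a i * (m == i)%:R) eq_sym.
  by case: eqP => _; rewrite ?mulr1 ?mulr0.
rewrite -big_mkcond/=; case: ifPn => [mn|mn].
  by rewrite (big_pred1 (Ordinal mn)).
by rewrite big_pred0// => i; apply/negbTE; apply: contra mn => /eqP <-.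
Qed.

Variable x : nat -> X.
Hypotheses (bx : basic_sequence x) (spx : spreading x) (ux : unconditional x).
Variables (car : set (nat -> K^o)) (nY : (nat -> K^o) -> R).
Let Y := @NSpace R K (nat -> K^o) car nY.
Hypothesis nY_ge0 : forall a, car a -> 0 <= nY a.
Hypothesis nY_mono : forall a b, car b ->
  (forall i, modulus (a i : K) <= modulus (b i : K)) -> car a /\ nY a <= nY b.
Hypothesis nY_fatou : forall a c, 0 <= c ->
  (forall n, car (truncate a n) /\ nY (truncate a n) <= c) ->
  car a /\ nY a <= c.
Hypothesis nY_trunc : forall a b n, car b -> car (b - truncate a n).
Hypothesis nY_car0 : car 0.
Variable c : R.
Hypothesis c_gt0 : 0 < c.
Hypothesis nY_le : forall a n, nY (truncate a n) <= c * nrm (partial_sum x a n).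
Hypothesis le_nY : forall a n, nrm (partial_sum x a n) <= c * nY (truncate a n).

Let cx : forall i, carrier (x i). Proof. by case: bx. Qed.

Let carT a n : car (truncate a n).
Proof.
have -> : truncate a n = 0 - truncate (fun i => - a i) n.
  apply/funext => i; rewrite sub0r /truncate !fctE/=.
  by case: ifP => _; rewrite ?opprK ?oppr0.
exact: nY_trunc.
Qed.

Let nY0 : nY 0 = 0.
Proof.
apply/eqP; rewrite eq_le nY_ge0// andbT.
have [//|n|//] := @nY_fatou 0 0.
have -> : truncate 0 n = truncate 0 0 by apply/funext => i; rewrite /truncate if_same.
split; first exact: carT.
by rewrite (le_trans (nY_le 0 0))// /partial_sum big_ord0 (nrm0 sX) mulr0.
Qed.

Let tail a n : nat -> K^o := a - truncate a n.

Let coef_in u : closed_span x u -> forall e, 0 < e ->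
  exists n, car (tail (coef x u) n) /\ nY (tail (coef x u) n) <= e.
Proof.
move=> Eu e e0; have cu : carrier u by case: Eu.
have [|N hN] := (expansionP sX cx _ cu).1 (coef_expansion bx Eu) (e / c / 2).
  by rewrite !divr_gt0.
exists N; apply: nY_fatou; first exact: ltW.
move=> m; split; first exact: carT.
apply: le_trans (nY_le _ _) _; rewrite mulrC -ler_pdivlMr//.
set a := coef x u in hN *.
have cp i : carrier (partial_sum x a i) by exact: carrier_partial_sum.
have -> : partial_sum x (tail a N) m =
    if (N <= m)%N then partial_sum x a m - partial_sum x a N else 0.
  have -> : partial_sum x (tail a N) m = -1 *: partial_sum x (truncate a N) m + partial_sum x a m.
    rewrite -partial_sumL; apply: eq_bigr => i _; congr (_ *: _).
    by rewrite /tail /truncate !fctE/= mulN1r addrC.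
  case: ifPn => Nm; first by rewrite partial_sum_trunc// scaleN1r addrC.
  rewrite [X in -1 *: X](_ : _ = partial_sum x a m) ?scaleN1r ?addNr//.
  apply: eq_bigr => i _; rewrite /truncate ifT// (ltn_trans (ltn_ord i))//.
  by rewrite ltnNge.
case: ifPn => Nm; last by rewrite (nrm0 sX) divr_ge0 ?ltW.
apply: le_trans (nrm_triangle sX (cp _) cu (cp _)) _.
rewrite (splitr (e / c)) lerD ?(nrm_subC sX (cp m) cu)// ltW// hN//.
Qed.

Let coef_bound : exists2 M, 0 < M & forall u, closed_span x u ->
  car (coef x u) /\ nY (coef x u) <= M * nrm u.
Proof.
have [C C0 hC] := span_proj_bounded sX kX bx spx ux.
exists (c * C); first exact: mulr_gt0.
move=> u Eu; have n0 : 0 <= nrm u by apply: (nrm_ge0 sX); case: Eu.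
apply: nY_fatou => [|n]; first by rewrite !mulr_ge0// ltW.
split; first exact: carT.
rewrite (le_trans (nY_le _ _))// -mulrA ler_wpM2l ?(ltW c_gt0)//.
by rewrite partial_sum_iota; apply: hC => //; exact: iota_uniq.
Qed.

Let span_tail (b : Y) : closed_span (unit_vector R k : nat -> Y) b ->
  forall e, 0 < e -> exists N, forall n, (N <= n)%N -> nY (tail b n) < e.
Proof.
move=> [cb hb] e e0; have [p [a]] := hb e e0.
rewrite partial_sum_unit_vector => ha; exists p => n pn.
apply: le_lt_trans ha; apply: (nY_mono _ _).2; first exact: nY_trunc.
move=> i; rewrite /tail /truncate !fctE/=.
case: ltnP => ni; first by rewrite subrr modulus0 modulus_ge0.
by rewrite ifF// ltnNge (leq_trans pn).
Qed.

Let span_sum (b : Y) : closed_span (unit_vector R k : nat -> Y) b ->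
  exists v, carrier v /\ expansion x v b.
Proof.
move=> Yb; have cp i : carrier (partial_sum x b i) by exact: carrier_partial_sum.
have cb : car b by case: Yb.
have [|v cv hv] := complete_cauchy cp; last first.
  by exists v; split => //; apply/(expansionP sX cx b cv).
have key e N m n : nY (tail b N) < e -> (N <= n)%N -> (n <= m)%N ->
    nrm (partial_sum x b m - partial_sum x b n) <= c * e.
  move=> hN Nn nm.
  have -> : partial_sum x b m - partial_sum x b n = partial_sum x (tail b n) m.
    rewrite -(partial_sum_trunc x b nm) addrC -scaleN1r -partial_sumL.
    apply: eq_bigr => i _; congr (_ *: _).
    by rewrite /tail /truncate !fctE/= mulN1r addrC.
  apply: le_trans (le_nY _ _) _; rewrite ler_wpM2l ?(ltW c_gt0)//.
  apply: le_trans (ltW hN); apply: (nY_mono _ _).2; first exact: nY_trunc.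
  move=> i; rewrite /tail /truncate !fctE/=.
  case: ltnP => _; last by rewrite modulus0 modulus_ge0.
  case: ltnP => ni; first by rewrite subrr modulus0 modulus_ge0.
  by rewrite ifF// ltnNge (leq_trans Nn).
move=> e e0; have [|N hN] := span_tail Yb (e := e / (2 * c)).
  by rewrite divr_gt0// mulr_gt0.
have ce : c * (e / (2 * c)) < e.
  have -> : c * (e / (2 * c)) = e / 2 by field; rewrite gt_eqF.
  by rewrite ltr_pdivrMr// ltr_pMr// ltr1n.
exists N => m n Nm Nn; apply: le_lt_trans ce.
have [nm|mn] := leqP n m; first exact: (key _ N _ _ (hN _ (leqnn N))).
by rewrite (nrm_subC sX)//; apply: (key _ N _ _ (hN _ (leqnn N))) => //; exact: ltnW.
Qed.

Let expansion_unique_vec u v b : carrier u -> carrier v ->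
  expansion x u b -> expansion x v b -> same u v.
Proof.
move=> cu cv /(expansionP sX cx b cu) hu /(expansionP sX cx b cv) hv.
apply/eqP; rewrite eq_le (nrm_ge0 sX) ?andbT; last exact: (carrierB sX).
apply/ler_addgt0Pr => e e0; rewrite add0r.
have e20 : 0 < e / 2 by rewrite divr_gt0.
have [N hN] := hu _ e20; have [M hM] := hv _ e20.
have cp : carrier (partial_sum x b (maxn N M)) by exact: carrier_partial_sum.
apply: le_trans (nrm_triangle sX cu cp cv) _.
rewrite (splitr e) lerD//; first by rewrite ltW// hN// leq_maxl.
by rewrite (nrm_subC sX)// ltW// hM// leq_maxr.
Qed.

(** Comparing norms of finite combinations is enough, provided that the sequence
    space is solid and has the Fatou property: coordinates of vectors of the span
    lie in it by the Fatou property, and sequences in the span of the unit vectors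
    are summed by completeness. *)
Lemma equivalent_unit_vector : equivalent x (unit_vector R k : nat -> Y).
Proof.
pose S (b : Y) : X := xget 0 [set v | carrier v /\ expansion x v b].
have SP b : closed_span (unit_vector R k : nat -> Y) b ->
    carrier (S b) /\ expansion x (S b) b.
  by move=> /span_sum[v hv]; rewrite /S; case: xgetP => // /(_ v).
have SE b : closed_span (unit_vector R k : nat -> Y) b -> closed_span x (S b).
  by move=> /SP[cS]; exact: (expansion_closed_span sX cx cS).
have sameY (a b : Y) : a = b -> same a b.
  by move=> ->; rewrite /same subrr; exact: nY0.
have TE u : closed_span x u -> closed_span (unit_vector R k : nat -> Y) (coef x u : Y).
  move=> Eu; have [M M0 hM] := coef_bound; split; first by case: (hM _ Eu).
  move=> e e0; have [|n [_ hn]] := coef_in Eu (e := e / 2); first by rewrite divr_gt0.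
  exists n, (coef x u); rewrite partial_sum_unit_vector; apply: le_lt_trans hn _.
  by rewrite ltr_pdivrMr// ltr_pMr// ltr1n.
exists (fun u => coef x u : Y), S; split.
- split => //.
  + move=> d u v Eu Ev; apply: sameY; rewrite (coefL sX bx d Eu Ev).
    by apply/funext => i; rewrite !fctE.
  + by have [M M0 hM] := coef_bound; exists M => u Eu; case: (hM _ Eu).
- split => //.
  + move=> d a b Ya Yb; have [cSa ea] := SP _ Ya; have [cSb eb] := SP _ Yb.
    have eab := expansionL sX cx d cSa cSb ea eb.
    have [v cv hv] : exists2 v, carrier v & expansion x v (d *: a + b : Y).
      by exists (d *: S a + S b) => //; exact: (carrierL sX).
    have [c1 e1] : carrier (S (d *: a + b)) /\ expansion x (S (d *: a + b)) (d *: a + b : Y).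
      by rewrite /S; case: xgetP => // /(_ v) h; exfalso; apply: h; split.
    apply: (expansion_unique_vec c1 _ e1); first exact: (carrierL sX).
    exact: eab.
  + exists c => b Yb; have [cS /(expansionP sX cx b cS) eS] := SP _ Yb.
    apply/ler_addgt0Pr => e e0; have [N hN] := eS e e0.
    have cp : carrier (partial_sum x b N) by exact: carrier_partial_sum.
    apply: le_trans (ler_nrm_dist sX cS cp) _; rewrite lerD//; last first.
      by rewrite ltW// hN.
    apply: le_trans (le_nY _ _) _; rewrite ler_wpM2l ?(ltW c_gt0)//.
    apply: (nY_mono _ _).2; first by case: Yb.
    by move=> i; rewrite /truncate; case: ifP => _//; rewrite modulus0 modulus_ge0.
- move=> u Eu; have [cS eS] := SP _ (TE _ Eu).
  apply: (expansion_unique_vec cS _ eS); first by case: Eu.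
  exact: coef_expansion.
- by move=> b Yb; have [cS eS] := SP _ Yb; apply: sameY; exact: (coef_unique sX bx).
- by move=> n; apply: sameY; rewrite (coef_basis sX bx); apply/funext => m; rewrite /unit_vector eq_sym.
Qed.

End sequence_spaces.

(** * Random signs *)
Section signs.
Set Implicit Arguments.
Unset Strict Implicit.

Definition set_sign (e : nat -> bool) n b : nat -> bool :=
  fun i => if i == n then b else e i.

Fixpoint signs N : seq (nat -> bool) :=
  if N is n.+1 then [seq set_sign e n false | e <- signs n] ++
                    [seq set_sign e n true | e <- signs n]
  else [:: fun=> false].

Lemma size_signs N : size (signs N) = (2 ^ N)%N.
Proof.
by elim: N => //= N IH; rewrite size_cat !size_map IH expnS mul2n addnn.
Qed.

Lemma sum_signsS (V : nmodType) (f : (nat -> bool) -> V) N :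
  \sum_(e <- signs N.+1) f e =
  \sum_(e <- signs N) (f (set_sign e N false) + f (set_sign e N true)).
Proof. by rewrite /= big_cat/= !big_map big_split. Qed.

Lemma sum_signs_const (A : pzRingType) (v : A) N :
  \sum_(e <- signs N) v = 2 ^+ N * v.
Proof.
by rewrite big_const_seq count_predT size_signs iter_addr_0 -natrX mulr_natl.
Qed.

(** Random signs are orthogonal. *)
Lemma sum_signs_orth (A : pzRingType) N i j : (i < N)%N -> (j < N)%N ->
  \sum_(e <- signs N) ((-1) ^+ e i * (-1) ^+ e j : A) =
  if i == j then 2 ^+ N else 0.
Proof.
have [<- _ _|ij] := eqVneq i j.
  rewrite -[RHS]mulr1 -sum_signs_const; apply: eq_bigr => e _.
  by rewrite -expr2 sqrr_sign.
elim: N => // N IH; rewrite !ltnS sum_signsS => iN jN.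
rewrite /set_sign; case: (ltngtP i N) iN => // iN _.
  case: (ltngtP j N) jN => // jN _.
    by rewrite big_split/= IH// addr0.
  by rewrite big1// => e _; rewrite expr0 expr1 mulr1 mulrN1 subrr.
case: (ltngtP j N) jN => // jN _.
  by rewrite big1// => e _; rewrite expr0 expr1 mul1r mulN1r subrr.
by move: ij; rewrite iN jN eqxx.
Qed.

Context {R : realType}.
Implicit Types (c : nat -> R) (e : nat -> bool).

Definition signed_sum c N e : R := \sum_(i < N) (-1) ^+ e i * c i.

Lemma signed_sumS c N e b : signed_sum c N.+1 (set_sign e N b) =
  signed_sum c N e + (-1) ^+ b * c N.
Proof.
rewrite /signed_sum big_ord_recr /= /set_sign eqxx; congr (_ + _).
by apply: eq_bigr => i _; rewrite ltn_eqF.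
Qed.

Lemma sum_signed_sqr c N : \sum_(e <- signs N) signed_sum c N e ^+ 2 =
  2 ^+ N * \sum_(i < N) c i ^+ 2.
Proof.
elim: N => [|N IH].
  by rewrite /= big_seq1 /signed_sum !big_ord0 expr0n mulr0.
rewrite sum_signsS big_ord_recr/= exprS -mulrA mulrDr -IH.
rewrite -(sum_signs_const (c N ^+ 2)) -big_split/= mulr_sumr.
by apply: eq_bigr => e _; rewrite !signed_sumS expr0 expr1; ring.
Qed.

Lemma sum_signed_pow4 c N : \sum_(e <- signs N) signed_sum c N e ^+ 4 <=
  2 ^+ N * (3 * (\sum_(i < N) c i ^+ 2) ^+ 2).
Proof.
elim: N => [|N IH].
  by rewrite /= big_seq1 /signed_sum !big_ord0 !expr0n !mulr0.
rewrite sum_signsS big_ord_recr/= exprS.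
set Q := \sum_(i < N) c i ^+ 2 in IH *.
have -> : \sum_(e <- signs N) (signed_sum c N.+1 (set_sign e N false) ^+ 4 +
             signed_sum c N.+1 (set_sign e N true) ^+ 4) =
  2 * (\sum_(e <- signs N) signed_sum c N e ^+ 4) +
  (12 * c N ^+ 2) * (\sum_(e <- signs N) signed_sum c N e ^+ 2) +
  \sum_(e <- signs N) (2 * c N ^+ 4).
  rewrite !mulr_sumr -!big_split/=; apply: eq_bigr => e _.
  by rewrite !signed_sumS expr0 expr1; ring.
rewrite sum_signed_sqr sum_signs_const -/Q.
move: IH; set X := \sum_(_ <- _) _; have : (0 : R) <= 2 ^+ N by [].
set P := 2 ^+ N; set a := c N => P0 IH.
have Q0 : 0 <= P * (a ^+ 2) ^+ 2 by rewrite mulr_ge0// sqr_ge0.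
rewrite -subr_ge0.
have -> : 2 * P * (3 * (Q + a ^+ 2) ^+ 2) -
    (2 * X + 12 * a ^+ 2 * (P * Q) + P * (2 * a ^+ 4)) =
    2 * (P * (3 * Q ^+ 2) - X) + 4 * (P * (a ^+ 2) ^+ 2) by ring.
by rewrite addr_ge0// mulr_ge0// subr_ge0.
Qed.

(** A fourth moment bound controls the first moment from below, because
    u >= u^2 - 4/27 u^4 for u >= 0. *)
Lemma khinchin_lower c N :
  2 ^+ N * (5 / 9 * Num.sqrt (\sum_(i < N) c i ^+ 2)) <=
  \sum_(e <- signs N) `|signed_sum c N e|.
Proof.
set Q2 := \sum_(i < N) c i ^+ 2; set Q := Num.sqrt Q2.
have Q20 : 0 <= Q2 by apply: sumr_ge0 => i _; exact: sqr_ge0.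
have QE : Q ^+ 2 = Q2 by rewrite sqr_sqrtr.
have := sqrtr_ge0 Q2; rewrite -/Q le_eqVlt => /orP[/eqP <-|Q0].
  by rewrite !mulr0; apply: sumr_ge0.
have pt u : 0 <= u -> u ^+ 2 / Q - 4 / 27 * (u ^+ 4 / Q ^+ 3) <= u.
  move=> u0; have -> : u ^+ 2 / Q - 4 / 27 * (u ^+ 4 / Q ^+ 3) =
     u - u * (3 * Q - 2 * u) ^+ 2 * (3 * Q + u) / (27 * Q ^+ 3) - 0.
    by field; rewrite gt_eqF.
  rewrite subr0 gerBl divr_ge0//; last by rewrite mulr_ge0// exprn_ge0// ltW.
  by apply: mulr_ge0; [apply: mulr_ge0 => //; exact: sqr_ge0|lra].
have h : \sum_(e <- signs N) (signed_sum c N e ^+ 2 / Q -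
      4 / 27 * (signed_sum c N e ^+ 4 / Q ^+ 3)) <=
    \sum_(e <- signs N) `|signed_sum c N e|.
  apply: ler_sum => e _.
  have := pt _ (normr_ge0 (signed_sum c N e)).
  by rewrite -!normrX !(ger0_norm (sqr_ge0 _))// (@ger0_norm _ (_ ^+ 4))// exprn_even_ge0.
apply: le_trans h.
rewrite sumrB -mulr_sumr -!mulr_suml sum_signed_sqr -/Q2 -QE.
have := sum_signed_pow4 c N; rewrite -/Q2 -QE.
set X := \sum_(_ <- _) _; set P := 2 ^+ N => hX.
have Q3 : 0 < Q ^+ 3 by rewrite exprn_gt0.
have : X / Q ^+ 3 <= 3 * Q * P.
  rewrite ler_pdivrMr//; apply: le_trans hX _.
  by rewrite le_eqVlt; apply/orP; left; apply/eqP; ring.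
have -> : P * Q ^+ 2 / Q = Q * P by field; rewrite gt_eqF.
lra.
Qed.

Lemma expR_le_quadratic (c : R) : `|c| <= 2^-1 -> expR c <= 1 + c + 2 * c ^+ 2.
Proof.
rewrite ler_norml => /andP[c1 c2].
have h := expR_ge1Dx (- c).
have : expR c <= (1 - c)^-1.
  by rewrite -(opprK c) expRN lef_pV2 ?posrE ?expR_gt0 ?opprK//; lra.
move=> /le_trans; apply.
rewrite -[leLHS]mul1r ler_pdivrMr; last lra.
have : 0 <= c ^+ 2 * (1 - 2 * c) by rewrite mulr_ge0 ?sqr_ge0//; lra.
nra.
Qed.

(** The subgaussian bound: averaging over the i-th sign replaces exp (+-c_i) by
    at most 1 + 2 c_i^2 <= exp (2 c_i^2). *)
Lemma sum_signed_expR c N : (forall i, `|c i| <= 2^-1) ->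
  \sum_(e <- signs N) expR (signed_sum c N e) <=
  2 ^+ N * expR (2 * \sum_(i < N) c i ^+ 2).
Proof.
move=> hc; elim: N => [|N IH].
  by rewrite /= big_seq1 /signed_sum !big_ord0 mulr0 expr0 mul1r.
rewrite sum_signsS big_ord_recr/= exprS.
have -> : \sum_(e <- signs N) (expR (signed_sum c N.+1 (set_sign e N false)) +
     expR (signed_sum c N.+1 (set_sign e N true))) =
   (expR (c N) + expR (- c N)) * \sum_(e <- signs N) expR (signed_sum c N e).
  rewrite mulr_sumr; apply: eq_bigr => e _.
  by rewrite !signed_sumS expr0 expr1 mul1r mulN1r !expRD; ring.
have h1 := expR_le_quadratic (hc N).
have h2 : expR (- c N) <= 1 + - c N + 2 * (- c N) ^+ 2.
  by apply: expR_le_quadratic; rewrite normrN.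
have h3 := expR_ge1Dx (2 * c N ^+ 2).
have h4 : expR (c N) + expR (- c N) <= 2 * expR (2 * c N ^+ 2).
  by rewrite sqrrN in h2; lra.
apply: le_trans (ler_pM _ _ h4 IH) _.
- by rewrite addr_ge0// expR_ge0.
- by rewrite sumr_ge0// => e _; exact: expR_ge0.
by rewrite mulrDr expRD le_eqVlt; apply/orP; left; apply/eqP; ring.
Qed.

Lemma sum_signed_expR_norm c N : (forall i, `|c i| <= 2^-1) ->
  \sum_(e <- signs N) expR `|signed_sum c N e| <=
  2 ^+ N * (2 * expR (2 * \sum_(i < N) c i ^+ 2)).
Proof.
move=> hc; have h1 := sum_signed_expR N hc.
have /(sum_signed_expR N) : forall i, `|- c i| <= 2^-1 by move=> i; rewrite normrN.
rewrite (eq_bigr (fun e => expR (- signed_sum c N e))); last first.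
  by move=> e _; congr expR; rewrite /signed_sum -sumrN; apply: eq_bigr => i _; rewrite mulrN.
rewrite (eq_bigr (fun i : 'I_N => c i ^+ 2)); last by move=> i _; rewrite sqrrN.
move=> h2; apply: (@le_trans _ _ (\sum_(e <- signs N)
   (expR (signed_sum c N e) + expR (- signed_sum c N e)))).
  apply: ler_sum => e _; case: (ger0P (signed_sum c N e)) => _.
    by rewrite lerDl expR_ge0.
  by rewrite lerDr expR_ge0.
rewrite big_split/=; move: h1 h2; lra.
Qed.

End signs.

Section scalar_signs.
Set Implicit Arguments.
Unset Strict Implicit.
Context {R : realType} {k : scalar_kind}.
Local Notation K := (Defs.scalar R k).
Implicit Types (a : nat -> K) (e : nat -> bool).

Lemma modulus2X n : modulus (2 ^+ n : K) = 2 ^+ n.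
Proof.
elim: n => [|n IH]; first by rewrite !expr0 modulus1.
rewrite !exprS modulusM IH; congr (_ * _).
rewrite modulusE -[2]/(1 + 1) scalar_reD scalar_imD.
have -> : scalar_re (1 : K) = 1 by rewrite /scalar_re; case: (k).
have -> : scalar_im (1 : K) = 0 by rewrite /scalar_im; case: (k).
by rewrite addr0 expr0n addr0 sqrtr_sqr ger0_norm// addr_ge0.
Qed.

Definition signed_sumK a N e : K := \sum_(i < N) (-1) ^+ e i * a i.

Lemma modulus_sign e i (z : K) : modulus ((-1) ^+ e i * z) = modulus z.
Proof. by case: (e i); rewrite ?expr0 ?expr1 ?mul1r ?mulN1r ?modulusN. Qed.

Lemma scalar_re_signed_sum a N e :
  scalar_re (signed_sumK a N e) = signed_sum (fun i => scalar_re (a i)) N e.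
Proof.
rewrite /signed_sumK /signed_sum (big_morph _ scalar_reD (_ : scalar_re 0 = 0)).
  apply: eq_bigr => i _.
  by case: (e i); rewrite ?expr0 ?expr1 ?mul1r ?mulN1r ?scalar_reN.
by rewrite /scalar_re; case: (k).
Qed.

Lemma scalar_im_signed_sum a N e :
  scalar_im (signed_sumK a N e) = signed_sum (fun i => scalar_im (a i)) N e.
Proof.
rewrite /signed_sumK /signed_sum (big_morph _ scalar_imD (_ : scalar_im 0 = 0)).
  apply: eq_bigr => i _.
  by case: (e i); rewrite ?expr0 ?expr1 ?mul1r ?mulN1r ?scalar_imN.
by rewrite /scalar_im; case: (k).
Qed.

Lemma sum_signed_sqrK a N :
  \sum_(e <- signs N) modulus (signed_sumK a N e) ^+ 2 =
  2 ^+ N * \sum_(i < N) modulus (a i) ^+ 2.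
Proof.
rewrite (eq_bigr (fun e => signed_sum (fun i => scalar_re (a i)) N e ^+ 2 +
  signed_sum (fun i => scalar_im (a i)) N e ^+ 2)); last first.
  by move=> e _; rewrite modulus_sqr scalar_re_signed_sum scalar_im_signed_sum.
rewrite big_split/= !sum_signed_sqr -mulrDr -big_split/=.
by congr (_ * _); apply: eq_bigr => i _; rewrite modulus_sqr.
Qed.

(** The real and the imaginary part are treated separately, which costs a factor
    2 in the constant. *)
Lemma khinchin_lowerK a N :
  2 ^+ N * (5 / 18 * Num.sqrt (\sum_(i < N) modulus (a i) ^+ 2)) <=
  \sum_(e <- signs N) modulus (signed_sumK a N e).
Proof.
pose re i := scalar_re (a i); pose im i := scalar_im (a i).
set q1 := \sum_(i < N) re i ^+ 2; set q2 := \sum_(i < N) im i ^+ 2.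
have -> : \sum_(i < N) modulus (a i) ^+ 2 = q1 + q2.
  by rewrite /q1 /q2 -big_split/=; apply: eq_bigr => i _; rewrite modulus_sqr.
have q10 : 0 <= q1 by apply: sumr_ge0 => i _; exact: sqr_ge0.
have q20 : 0 <= q2 by apply: sumr_ge0 => i _; exact: sqr_ge0.
have h : Num.sqrt (q1 + q2) <= Num.sqrt q1 + Num.sqrt q2.
  rewrite -(@ler_pXn2r _ 2)// ?nnegrE ?addr_ge0 ?sqrtr_ge0//.
  rewrite sqrrD !sqr_sqrtr ?addr_ge0// -addrA lerD2l addrC lerDl.
  by rewrite mulrn_wge0// mulr_ge0 ?sqrtr_ge0.
have h1 := khinchin_lower re N; have h2 := khinchin_lower im N.
have h3 : \sum_(e <- signs N) `|signed_sum re N e| <=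
    \sum_(e <- signs N) modulus (signed_sumK a N e).
  by apply: ler_sum => e _; rewrite -scalar_re_signed_sum; exact: scalar_re_le.
have h4 : \sum_(e <- signs N) `|signed_sum im N e| <=
    \sum_(e <- signs N) modulus (signed_sumK a N e).
  by apply: ler_sum => e _; rewrite -scalar_im_signed_sum; exact: scalar_im_le.
move: h1 h2 h3 h4; rewrite -/q1 -/q2.
have : (0 : R) <= 2 ^+ N by []; set P := 2 ^+ N => P0 h1 h2 h3 h4.
have : P * Num.sqrt (q1 + q2) <= P * (Num.sqrt q1 + Num.sqrt q2).
  by rewrite ler_wpM2l.
lra.
Qed.

End scalar_signs.

Section usystem_signs.
Set Implicit Arguments.
Unset Strict Implicit.
Context {R : realType} {k : scalar_kind}.
Local Notation K := (Defs.scalar R k).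
Context {X : nspace R K}.
Hypothesis sX : seminormed X.
Variables (y : nat -> X) (psi : nat -> X -> K) (C : R).
Hypothesis uy : usystem y psi C.

Let cy := usys_carrier uy.
Let C0 := usys_gt0 uy.

Lemma usysD i u v : carrier u -> carrier v -> psi i (u + v) = psi i u + psi i v.
Proof. by move=> cu cv; have := usysL uy i 1 cu cv; rewrite scale1r mul1r. Qed.

Lemma usys0 i : psi i 0 = 0.
Proof.
have c0 := carrier0 sX.
by have /(congr1 (fun z => z - psi i 0)) := usysD i c0 c0; rewrite addr0 subrr addrK.
Qed.

Lemma usysZ i c u : carrier u -> psi i (c *: u) = c * psi i u.
Proof.
by move=> cu; have := usysL uy i c cu (carrier0 sX); rewrite !addr0 usys0 addr0.
Qed.

Lemma usys_sum i I (r : seq I) (f : I -> X) : (forall j, carrier (f j)) ->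
  psi i (\sum_(j <- r) f j) = \sum_(j <- r) psi i (f j).
Proof.
move=> cf; elim: r => [|j r IH]; first by rewrite !big_nil usys0.
by rewrite !big_cons usysD ?IH//; exact: carrier_sum.
Qed.

Lemma usys_functional i f : carrier f -> modulus (psi i f) * nrm (y i) <= C * nrm f.
Proof.
move=> cf; have := usys_bound uy (isT : uniq [:: i]) cf.
by rewrite big_seq1 (nrmZ sX).
Qed.

(** A signed sum is the difference of the sums over the two sets of indices. *)
Lemma usys_signed (e : nat -> bool) N f : carrier f ->
  nrm (\sum_(i < N) ((-1) ^+ e i * psi i f) *: y i) <= 2 * C * nrm f.
Proof.
move=> cf.
have cz i c : carrier (c *: y i) by exact: carrierZ.
rewrite (bigID (fun i : 'I_N => e i))/=.
have sE (P : pred nat) (s : K) :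
    (forall i, P i -> (-1) ^+ e i = s) ->
    \sum_(i < N | P i) ((-1) ^+ e i * psi i f) *: y i =
    s *: \sum_(i <- [seq i <- iota 0 N | P i]) psi i f *: y i.
  move=> Ps; rewrite big_filter scaler_sumr.
  rewrite -(big_mkord P (fun i => ((-1) ^+ e i * psi i f) *: y i)) /index_iota subn0.
  by apply: eq_bigr => i Pi; rewrite Ps// scalerA.
rewrite (sE (fun i => e i) (-1)) ?(sE (fun i => ~~ e i) 1); last first.
- by move=> i ->; rewrite expr1.
- by move=> i /negbTE ->; rewrite expr0.
have cs A : carrier (\sum_(i <- A) psi i f *: y i) by exact: carrier_sum.
apply: le_trans (ler_nrmD sX (carrierZ sX _ (cs _)) (carrierZ sX _ (cs _))) _.
rewrite !(nrmZ sX)// modulusN modulus1 !mul1r -mulrA mulr2n mulrDl !mul1r.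
by rewrite lerD// (usys_bound uy)// filter_uniq// iota_uniq.
Qed.

Lemma usys_unconditional (e : nat -> bool) N (a : nat -> K) :
  nrm (\sum_(i < N) ((-1) ^+ e i * a i) *: y i) <=
  2 * C * nrm (\sum_(i < N) a i *: y i).
Proof.
have cs : carrier (\sum_(i < N) a i *: y i).
  by apply: carrier_sum => // i; exact: carrierZ.
have := usys_signed e N cs; rewrite (eq_bigr (fun i : 'I_N => ((-1) ^+ e i * a i) *: y i))//.
move=> i _; congr (_ * _ *: _); rewrite usys_sum; last by move=> j; exact: carrierZ.
rewrite (bigD1 i)//= usysZ// (usys_biorth uy) eqxx mulr1 big1 ?addr0//.
by move=> j ji; rewrite usysZ// (usys_biorth uy) (inj_eq val_inj) (negbTE ji) mulr0.
Qed.

(** Averaging e_m psi_m (sum_n e_n a_n g_n) over all signs e kills the terms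
    with n <> m, so only the diagonal of the matrix psi_m (g_n) survives. *)
Lemma tong_diagonal (g : nat -> X) (a : nat -> K) N (t : R) :
  (forall i, carrier (g i)) ->
  \sum_(e <- signs N) nrm (\sum_(i < N) ((-1) ^+ e i * a i) *: g i) <= 2 ^+ N * t ->
  nrm (\sum_(i < N) (a i * psi i (g i)) *: y i) <= 2 * C * t.
Proof.
move=> cg ht.
pose V (e : nat -> bool) := \sum_(i < N) ((-1) ^+ e i * a i) *: g i.
have cV e : carrier (V e) by apply: carrier_sum => // i; exact: carrierZ.
have p0 : (0 : R) < 2 ^+ N by rewrite exprn_gt0.
have cW (e : nat -> bool) : carrier (\sum_(i < N) ((-1) ^+ e i * psi i (V e)) *: y i).
  by apply: carrier_sum => // i; exact: carrierZ.
have key : \sum_(e <- signs N) \sum_(i < N) ((-1) ^+ e i * psi i (V e)) *: y i =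
    (2 ^+ N) *: \sum_(i < N) (a i * psi i (g i)) *: y i.
  rewrite exchange_big scaler_sumr /=; apply: eq_bigr => i _.
  rewrite -scaler_suml scalerA; congr (_ *: _).
  transitivity (\sum_(e <- signs N) \sum_(j < N)
      ((-1) ^+ e i * (-1) ^+ e j) * (a j * psi i (g j))).
    apply: eq_bigr => e _; rewrite usys_sum; last by move=> j; exact: carrierZ.
    by rewrite mulr_sumr; apply: eq_bigr => j _; rewrite usysZ// !mulrA.
  rewrite exchange_big/= (bigD1 i)//= -mulr_suml sum_signs_orth// eqxx.
  rewrite big1 ?addr0// => j ji; rewrite -mulr_suml sum_signs_orth//.
  by rewrite eq_sym (inj_eq val_inj) (negbTE ji) mul0r.
have cz : carrier (\sum_(i < N) (a i * psi i (g i)) *: y i).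
  by apply: carrier_sum => // i; exact: carrierZ.
rewrite -(ler_pM2l p0) -{1}(modulus2X (k := k)) -(nrmZ sX)// -key.
apply: le_trans (ler_nrm_sum sX _ cW) _.
apply: (@le_trans _ _ (\sum_(e <- signs N) 2 * C * nrm (V e))).
  by apply: ler_sum => e _; exact: usys_signed.
by rewrite -mulr_sumr mulrCA ler_wpM2l// mulr_ge0// ltW.
Qed.

End usystem_signs.

(** * Finite Orlicz functions as real functions *)
Section young_functions.
Set Implicit Arguments.
Unset Strict Implicit.
Context {R : realType}.

(** Finite Orlicz functions are handled as real functions on the whole line
    that vanish on the negative half-line, which keeps them convex. *)
Record young (Phi : R -> R) : Prop := Young {
  young0 : forall t, t <= 0 -> Phi t = 0;
  le_young : {homo Phi : s t / s <= t};
  young_convex : forall l s t, 0 <= l <= 1 ->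
    Phi (l * s + (1 - l) * t) <= l * Phi s + (1 - l) * Phi t;
  young_neq0 : exists2 t, 0 < t & 0 < Phi t }.

Variable Phi : R -> R.
Hypothesis yP : young Phi.

Lemma young_ge0 t : 0 <= Phi t.
Proof.
have [t0|t0] := leP t 0; first by rewrite (young0 yP).
by rewrite -(young0 yP (lexx 0)); apply: le_young => //; exact: ltW.
Qed.

Lemma young_scale l t : 0 <= l <= 1 -> Phi (l * t) <= l * Phi t.
Proof.
move=> l01; have := young_convex yP t 0 l01.
by rewrite mulr0 addr0 (young0 yP (lexx 0)) mulr0 addr0.
Qed.

Lemma young_div s t : 1 <= s -> Phi (t / s) <= Phi t / s.
Proof.
move=> s1; have s0 : 0 < s by exact: lt_le_trans s1.
by rewrite ![_ / s]mulrC young_scale// invr_ge0 (ltW s0) invf_le1.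
Qed.

Lemma young_lipschitz T s t : 0 < T -> s <= t -> t <= T ->
  Phi t - Phi s <= (t - s) / T * Phi (2 * T).
Proof.
move=> T0 st tT; have P0 := young_ge0.
have P2 : 0 <= Phi (2 * T) / T by rewrite divr_ge0// ltW.
wlog s0 : s st / 0 <= s.
  move=> h; have [|s0] := leP 0 s; first exact: h.
  rewrite (young0 yP (ltW s0)).
  have [t0|t0] := leP 0 t; last first.
    by rewrite (young0 yP (ltW t0)) subr0 mulrAC -mulrA mulr_ge0// subr_ge0.
  have := h 0 t0 (lexx 0); rewrite (young0 yP (lexx 0)) => /le_trans; apply.
  by rewrite mulrAC -mulrA [leRHS]mulrAC -[leRHS]mulrA ler_wpM2r//; lra.
pose l := (t - s) / (2 * T - s).
have d0 : 0 < 2 * T - s by lra.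
have l0 : 0 <= l by apply: divr_ge0; lra.
have l1 : l <= 1 by rewrite ler_pdivrMr// mul1r; lra.
have e : t = l * (2 * T) + (1 - l) * s.
  by rewrite /l; field; rewrite gt_eqF.
have l01 : 0 <= l <= 1 by rewrite l0.
have := young_convex yP (2 * T) s l01; rewrite -e.
have lT : l * Phi (2 * T) <= (t - s) / T * Phi (2 * T).
  rewrite ler_wpM2r// /l ler_wpM2l ?subr_ge0// lef_pV2 ?posrE//; lra.
have : 0 <= l * Phi s by rewrite mulr_ge0.
lra.
Qed.

Lemma young_continuous : continuous Phi.
Proof.
move=> x; apply/cvgrPdist_lt => e e0.
pose T := `|x| + 1; have T0 : 0 < T by rewrite ltr_wpDl.
pose d := Num.min 1 (e * T / (Phi (2 * T) + 1)).
have P0 : 0 < Phi (2 * T) + 1 by rewrite ltr_wpDl// young_ge0.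
have d0 : 0 < d by rewrite lt_min ltr01 divr_gt0// mulr_gt0.
have key s t : s <= t -> t <= T -> t - s < d -> Phi t - Phi s < e.
  move=> st tT ts; apply: le_lt_trans (young_lipschitz T0 st tT) _.
  rewrite mulrAC ltr_pdivrMr//.
  have [ts0|ts0] := leP (t - s) 0.
    by rewrite (@le_lt_trans _ _ 0) ?mulr_gt0// mulr_le0_ge0// young_ge0.
  apply: (@lt_le_trans _ _ ((t - s) * (Phi (2 * T) + 1))).
    by rewrite ltr_pM2l// ltrDl.
  by rewrite -ler_pdivlMr// ltW// (lt_le_trans ts)// ge_min lexx orbT.
near=> y.
have yd : `|x - y| < d by near: y; exact: (@cvgr_dist_lt _ _ _ (nbhs x) _ id x).
have xT : x <= T by rewrite (le_trans (ler_norm _))// lerDl.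
have yT : y <= T.
  have : `|x - y| < 1 by rewrite (lt_le_trans yd)// ge_min lexx.
  have := ler_norm x; rewrite ltr_norml /T => ? /andP[]; lra.
have [xy|/ltW yx] := leP x y.
  rewrite distrC ger0_norm ?subr_ge0 ?le_young//; apply: key => //.
  by rewrite distrC ger0_norm ?subr_ge0// in yd.
rewrite ger0_norm ?subr_ge0 ?le_young//; apply: key => //.
by rewrite ger0_norm ?subr_ge0// in yd.
Unshelve. all: by end_near. Qed.

(** A nonzero convex function vanishing at 0 grows at least linearly. *)
Lemma young_linear_bound : exists2 c : R, 0 < c &
  forall t, t <= c * (1 + Phi t).
Proof.
have [t0 t00 Pt0] := young_neq0 yP.
pose c := Num.max t0 (t0 / Phi t0).
have ct : t0 <= c by rewrite le_max lexx.
have cP : t0 / Phi t0 <= c by rewrite le_max lexx orbT.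
exists c; first exact: lt_le_trans ct.
move=> t; have c0 : 0 < c by exact: lt_le_trans ct.
have cPt : 0 <= c * Phi t by rewrite mulr_ge0 ?young_ge0// ltW.
rewrite mulrDr mulr1; have [tt0|t0t] := leP t t0; first lra.
have : Phi t0 <= t0 / t * Phi t.
  have := @young_scale (t0 / t) t; rewrite divfK; last by rewrite gt_eqF// (lt_trans t00).
  apply; rewrite divr_ge0 ?(ltW t00)//=; last by rewrite (le_trans (ltW t00))// ltW.
  by rewrite ler_pdivrMr ?mul1r ?ltW// (lt_trans t00).
have tp : 0 < t by exact: lt_trans t0t.
rewrite mulrAC ler_pdivlMr// => h.
have : t <= t0 / Phi t0 * Phi t by rewrite mulrAC ler_pdivlMr// mulrC.
have : t0 / Phi t0 * Phi t <= c * Phi t by rewrite ler_wpM2r// young_ge0.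
lra.
Qed.

End young_functions.

Section real_form.
Set Implicit Arguments.
Unset Strict Implicit.
Context {R : realType}.

Definition real_form (F : R -> \bar R) (t : R) : R := fine (F (Num.max 0 t)).

Lemma real_formE F t : finite_orlicz F -> 0 <= t -> F t = (real_form F t)%:E.
Proof.
move=> [[F0 mF _ _ _] fF] t0; rewrite /real_form max_r// fineK//.
by rewrite ge0_fin_numE ?fF//; have := mF 0 t (lexx 0) t0; rewrite F0.
Qed.

Lemma fine_orlicz F t : 0 <= t -> fine (F t) = real_form F t.
Proof. by move=> t0; rewrite /real_form max_r. Qed.

Lemma young_real_form F : finite_orlicz F -> young (real_form F).
Proof.
move=> oF; have [[F0 mF cF [t t0 Ft] _] fF] := oF.
have E s : 0 <= s -> F s = (real_form F s)%:E by exact: real_formE.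
have hm : {homo (real_form F) : s t / s <= t}.
  move=> u v uv; have u0 : 0 <= Num.max 0 u by rewrite le_max lexx.
  have v0 : 0 <= Num.max 0 v by rewrite le_max lexx.
  have uv' : Num.max 0 u <= Num.max 0 v by rewrite ge_max v0 le_max uv orbT.
  by have := mF _ _ u0 uv'; rewrite !E// lee_fin /real_form !(max_r u0) !(max_r v0).
split => //.
- by move=> s s0; rewrite /real_form max_l// F0.
- move=> l u v /andP[l0 l1].
  have u0 : 0 <= Num.max 0 u by rewrite le_max lexx.
  have v0 : 0 <= Num.max 0 v by rewrite le_max lexx.
  have l1' : 0 <= 1 - l by rewrite subr_ge0.
  have := cF l _ _ _ u0 v0; rewrite l0 l1 => /(_ isT).
  have w0 : 0 <= l * Num.max 0 u + (1 - l) * Num.max 0 v by rewrite addr_ge0// mulr_ge0.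
  rewrite (E _ u0) (E _ v0) (E _ w0) -!EFinM -EFinD lee_fin.
  have -> : real_form F (Num.max 0 u) = real_form F u by rewrite /real_form (max_r u0).
  have -> : real_form F (Num.max 0 v) = real_form F v by rewrite /real_form (max_r v0).
  apply: le_trans; apply: hm.
  by rewrite lerD// ler_wpM2l// le_max lexx orbT.
- exists t.
    rewrite lt_neqAle t0 andbT; apply/eqP => t00; apply: Ft; by rewrite -t00.
  rewrite lt_neqAle; apply/andP; split.
    by apply/eqP => h; apply: Ft; rewrite E// -h.
  by rewrite -lee_fin -E//; have := mF 0 t (lexx 0) t0; rewrite F0.
Qed.

End real_form.

(** * The Orlicz space as a complete seminormed space *)
Section modular.
Set Implicit Arguments.
Unset Strict Implicit.
Context {R : realType}.
Local Notation D := (`[0, 1[%classic : set R).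
Local Notation mu := (@lebesgue_measure R).

Lemma measurable_unit_itv : measurable D.
Proof. exact: measurable_itv. Qed.

Lemma mu_unit_itv : mu D = 1%E.
Proof. by rewrite lebesgue_measure_itv/= lte_fin ltr01 oppr0 adde0. Qed.

Variable Phi : R -> R.
Hypothesis yP : young Phi.
Implicit Types g h : R -> R.

Definition modular (g : R -> R) : \bar R := (\int[mu]_(x in D) (Phi (g x))%:E)%E.

Lemma measurable_young g : measurable_fun D g -> measurable_fun D (fun x => Phi (g x)).
Proof.
apply: measurableT_comp; apply: nondecreasing_measurable => //.
exact: (le_young yP).
Qed.

Lemma measurable_youngE g : measurable_fun D g ->
  measurable_fun D (fun x => (Phi (g x))%:E).
Proof. by move=> mg; apply/measurable_EFinP; exact: measurable_young. Qed.

Lemma modular_ge0 g : (0 <= modular g)%E.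
Proof. by apply: integral_ge0 => x _; rewrite lee_fin (young_ge0 yP). Qed.

Lemma le_modular g h : measurable_fun D g -> measurable_fun D h ->
  (forall x, D x -> g x <= h x) -> (modular g <= modular h)%E.
Proof.
move=> mg mh gh; apply: ge0_le_integral.
- exact: measurable_unit_itv.
- by move=> x _; rewrite lee_fin (young_ge0 yP).
- exact: measurable_youngE.
- exact: measurable_youngE.
- by move=> x Dx; rewrite lee_fin (le_young yP)// gh.
Qed.

Lemma modular_div s g : measurable_fun D g -> 1 <= s ->
  (modular (fun x => (g x / s)%R) <= (s^-1)%:E * modular g)%E.
Proof.
move=> mg s1; have s0 : 0 <= s^-1 by rewrite invr_ge0 (le_trans _ s1).
rewrite /modular -ge0_integralZl_EFin//.
- apply: ge0_le_integral.
  + exact: measurable_unit_itv.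
  + by move=> x _; rewrite lee_fin (young_ge0 yP).
  + apply: measurable_youngE; apply: measurable_funM => //; exact: measurable_cst.
  + by apply: measurable_funeM; exact: measurable_youngE.
  + by move=> x Dx; rewrite -EFinM lee_fin [leRHS]mulrC young_div.
- by move=> x _; rewrite lee_fin (young_ge0 yP).
- exact: measurable_youngE.
Qed.

Lemma modular_le1 s g : measurable_fun D g -> 1 <= s ->
  (modular g <= s%:E)%E -> (modular (fun x => (g x / s)%R) <= 1)%E.
Proof.
move=> mg s1 h; have s0 : 0 < s by rewrite (lt_le_trans _ s1).
apply: le_trans (modular_div mg s1) _.
apply: (@le_trans _ _ (s^-1%:E * s%:E)%E); last by rewrite -EFinM mulVf ?gt_eqF.
by rewrite lee_wpmul2l// lee_fin invr_ge0 ltW.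
Qed.

End modular.

Section scalar_measurability.
Set Implicit Arguments.
Unset Strict Implicit.
Context {R : realType} {k : scalar_kind}.
Local Notation K := (Defs.scalar R k).
Local Notation D := (`[0, 1[%classic : set R).
Implicit Types f g : R -> K^o.

Lemma measurable_modulus f : measurable_scalar D f ->
  measurable_fun D (fun x => modulus (f x : K)).
Proof.
move=> /measurable_scalarP[mr mi].
have -> : (fun x => modulus (f x : K)) = (fun x =>
    Num.sqrt (scalar_re (f x : K) ^+ 2 + scalar_im (f x : K) ^+ 2)).
  by apply/funext => x; rewrite modulusE.
apply: (@measurableT_comp _ _ _ _ _ _ (@Num.sqrt R)).
  by apply: nondecreasing_measurable => // s t; exact: ler_wsqrtr.
by apply: measurable_funD; exact: measurable_funX.
Qed.

Lemma measurable_scalarL c f g : measurable_scalar D f -> measurable_scalar D g ->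
  measurable_scalar D (c *: f + g).
Proof.
move=> /measurable_scalarP[fr fi] /measurable_scalarP[gr gi].
apply/measurable_scalarP; split.
- have -> : scalar_re \o (c *: f + g : R -> K) = (fun x =>
     scalar_re c * scalar_re (f x : K) - scalar_im c * scalar_im (f x : K) +
     scalar_re (g x : K)).
    by apply/funext => x; rewrite /= scalar_reD scalar_reM.
  apply: measurable_funD => //; apply: measurable_funB;
    apply: measurable_funM => //; exact: measurable_cst.
- have -> : scalar_im \o (c *: f + g : R -> K) = (fun x =>
     scalar_re c * scalar_im (f x : K) + scalar_im c * scalar_re (f x : K) +
     scalar_im (g x : K)).
    by apply/funext => x; rewrite /= scalar_imD scalar_imM.
  apply: measurable_funD => //; apply: measurable_funD;
    apply: measurable_funM => //; exact: measurable_cst.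
Qed.

Definition cutoff (A : set R) f : R -> K^o := fun x => if x \in A then f x else 0.

Lemma measurable_cutoff A f : measurable A -> measurable_scalar D f ->
  measurable_scalar D (cutoff A f).
Proof.
move=> mA /measurable_scalarP[fr fi]; apply/measurable_scalarP.
have h (s : K -> R) : s 0 = 0 -> s \o (cutoff A f : R -> K) = (fun x => \1_A x * (s \o f) x).
  move=> s0; apply/funext => x; rewrite /cutoff /= indicE.
  by case: (x \in A); rewrite ?mul1r// mul0r.
have r0 : scalar_re (0 : K) = 0 by rewrite /scalar_re; case: (k).
have i0 : scalar_im (0 : K) = 0 by rewrite /scalar_im; case: (k).
split; rewrite h//; apply: measurable_funM => //; exact: measurable_indic.
Qed.

Lemma measurable_scalar0 : measurable_scalar D (0 : R -> K^o).
Proof.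
apply/measurable_scalarP; split.
- rewrite (_ : _ \o _ = cst (scalar_re (0 : K)))//; exact: measurable_cst.
- rewrite (_ : _ \o _ = cst (scalar_im (0 : K)))//; exact: measurable_cst.
Qed.

End scalar_measurability.

Section orlicz_space.
Set Implicit Arguments.
Unset Strict Implicit.
Context {R : realType} {k : scalar_kind}.
Local Notation K := (Defs.scalar R k).
Local Notation D := (`[0, 1[%classic : set R).
Local Notation mu := (@lebesgue_measure R).
Variable F : R -> \bar R.
Hypothesis oF : finite_orlicz F.
Local Notation Phi := (real_form F).
Local Notation L := (L_ k F).
Implicit Types f g : R -> K^o.

Let yP : young Phi := young_real_form oF.

Lemma luxemburgE f : luxemburg F f = ereal_inf [set t%:E | t in
  [set t : R | 0 < t /\ (modular Phi (fun x => (modulus (f x : K) / t)%R) <= 1)%E]].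
Proof.
have h t : 0 < t ->
    (\int[mu]_(x in `[0%R, 1%R[) F (modulus (f x : K) / t)%R)%E =
    modular Phi (fun x => (modulus (f x : K) / t)%R).
  move=> t0; apply: eq_integral => x _; rewrite real_formE//.
  by rewrite divr_ge0 ?modulus_ge0// ltW.
congr ereal_inf; congr image; apply/funext => t; apply/propext.
by split => -[t0]; [rewrite h|rewrite -h].
Qed.

Let lux_ge0 f : (0 <= luxemburg F f)%E.
Proof.
by rewrite luxemburgE; apply: le_ereal_inf_tmp => _ [t [t0 _] <-]; rewrite lee_fin ltW.
Qed.

Lemma measurable_modulus_div f t : measurable_scalar D f ->
  measurable_fun D (fun x => (modulus (f x : K) / t)%R).
Proof.
move=> mf; apply: measurable_funM; first exact: measurable_modulus.
exact: measurable_cst.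
Qed.

Lemma modular_nrm_le f t : measurable_scalar D f -> 0 < t ->
  (modular Phi (fun x => (modulus (f x : K) / t)%R) <= 1)%E ->
  carrier (f : L) /\ nrm (f : L) <= t.
Proof.
move=> mf t0 h; have lt : (luxemburg F f <= t%:E)%E.
  by rewrite luxemburgE; apply: ereal_inf_lbound; exists t.
have lty : (luxemburg F f < +oo)%E by rewrite (le_lt_trans lt)// ltry.
split; first by split.
by rewrite /nrm/= -lee_fin fineK// ge0_fin_numE.
Qed.

Lemma carrier_measurable (f : L) : carrier f -> measurable_scalar D f.
Proof. by case. Qed.

Lemma L_nrm_ge0 (f : L) : 0 <= nrm f.
Proof. by rewrite /nrm/= fine_ge0. Qed.

Lemma nrm_lt_modular (f : L) t : carrier f -> nrm f < t ->
  (modular Phi (fun x => (modulus (f x : K) / t)%R) <= 1)%E.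
Proof.
move=> [mf lf] ft; have t0 : 0 < t by exact: le_lt_trans (L_nrm_ge0 f) ft.
have : (luxemburg F f < t%:E)%E.
  by rewrite -(fineK (_ : luxemburg F f \is a fin_num)) ?lte_fin// ge0_fin_numE.
rewrite luxemburgE => /ereal_inf_lt[_ [s [s0 hs] <-]]; rewrite lte_fin => st.
apply: le_trans hs; apply: (le_modular yP); try exact: measurable_modulus_div.
by move=> x _; rewrite ler_wpM2l ?modulus_ge0// lef_pV2 ?posrE// ltW.
Qed.

Lemma nrm_dominated (f g : L) c : measurable_scalar D f -> carrier g -> 0 <= c ->
  (forall x, D x -> modulus (f x : K) <= c * modulus (g x : K)) ->
  carrier f /\ nrm f <= c * nrm g.
Proof.
move=> mf cg c0 fg.
have key t : nrm g < t -> 0 < c -> carrier f /\ nrm f <= c * t.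
  move=> gt cp; have t0 : 0 < t by exact: le_lt_trans (L_nrm_ge0 g) gt.
  apply: modular_nrm_le => //; first exact: mulr_gt0.
  apply: le_trans (nrm_lt_modular cg gt).
  apply: (le_modular yP); try exact: measurable_modulus_div => //.
    by apply: measurable_modulus_div; case: cg.
  move=> x Dx; rewrite invfM mulrA ler_wpM2r ?invr_ge0 ?(ltW t0)//.
  by rewrite ler_pdivrMr// mulrC fg.
have [cp|] := ltP 0 c; last first.
  move=> c0'; have cE : c = 0 by apply/eqP; rewrite eq_le c0 c0'.
  rewrite cE mul0r.
  have f0 t : 0 < t -> carrier f /\ nrm f <= t.
    move=> t0; apply: modular_nrm_le => //.
    rewrite /modular (eq_integral (cst 0%E)); first by rewrite integral0 lee01.
    move=> x; rewrite inE => Dx; congr EFin; apply: (young0 yP).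
    have := fg _ Dx; rewrite cE mul0r => h.
    by rewrite -(mul0r t^-1) ler_wpM2r// invr_ge0 ltW.
  split; first by case: (f0 1).
  by apply/ler_addgt0Pr => e e0; rewrite add0r; case: (f0 e).
have n0 := L_nrm_ge0 g.
split; first by case: (key (nrm g + 1)); rewrite // ltrDl.
apply/ler_addgt0Pr => e e0; have [||_] := key (nrm g + e / c) => //.
  by rewrite ltrDl divr_gt0.
by rewrite mulrDr mulrCA divff ?gt_eqF// mulr1.
Qed.

Lemma modulusZ_le (c : K) (f : R -> K^o) x :
  modulus ((c *: f) x : K) <= modulus c * modulus (f x : K).
Proof. by rewrite -modulusM. Qed.

(** With |f| and |g| normalized by s and t, convexity of F is applied to
    (|f| + |g|) / (s + t), a convex combination of |f| / s and |g| / t. *)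
Lemma L_carrierD (f g : L) : carrier f -> carrier g ->
  carrier (f + g) /\ nrm (f + g) <= nrm f + nrm g.
Proof.
move=> cf cg.
have key s t : nrm f < s -> nrm g < t -> carrier (f + g) /\ nrm (f + g) <= s + t.
  move=> fs gt.
  have s0 : 0 < s by exact: le_lt_trans (L_nrm_ge0 f) fs.
  have t0 : 0 < t by exact: le_lt_trans (L_nrm_ge0 g) gt.
  have st0 : 0 < s + t by exact: addr_gt0.
  have mf := carrier_measurable cf; have mg := carrier_measurable cg.
  apply: modular_nrm_le => //.
    by rewrite -(scale1r (f : R -> K^o)); exact: measurable_scalarL.
  pose l := s / (s + t).
  have l0 : 0 <= l by rewrite divr_ge0 ?ltW.
  have l1 : l <= 1 by rewrite ler_pdivrMr// mul1r lerDl ltW.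
  have l1' : 0 <= 1 - l by rewrite subr_ge0.
  have hf := nrm_lt_modular cf fs; have hg := nrm_lt_modular cg gt.
  apply: (@le_trans _ _ (l%:E * modular Phi (fun x => (modulus (f x : K) / s)%R)
     + (1 - l)%:E * modular Phi (fun x => (modulus (g x : K) / t)%R))%E); last first.
    apply: (@le_trans _ _ (l%:E * 1 + (1 - l)%:E * 1)%E).
      by apply: leeD; apply: lee_wpmul2l.
    by rewrite !mule1 -EFinD addrC subrK.
  have pf := measurable_youngE yP (measurable_modulus_div s mf).
  have pg := measurable_youngE yP (measurable_modulus_div t mg).
  rewrite /modular -!ge0_integralZl_EFin//; last 2 first.
  - by move=> x _; rewrite lee_fin (young_ge0 yP).
  - by move=> x _; rewrite lee_fin (young_ge0 yP).
  rewrite -ge0_integralD//; last 4 first.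
  - by move=> x _; rewrite -EFinM lee_fin mulr_ge0// (young_ge0 yP).
  - exact: measurable_funeM.
  - by move=> x _; rewrite -EFinM lee_fin mulr_ge0// (young_ge0 yP).
  - exact: measurable_funeM.
  apply: ge0_le_integral.
  - exact: measurable_unit_itv.
  - by move=> x _; rewrite lee_fin (young_ge0 yP).
  - apply: (measurable_youngE yP); apply: measurable_modulus_div.
    by rewrite -(scale1r (f : R -> K^o)); exact: measurable_scalarL.
  - by apply: emeasurable_funD; exact: measurable_funeM.
  move=> x _; rewrite -!EFinM -EFinD lee_fin.
  apply: le_trans (young_convex yP _ _ _); last by rewrite l0.
  apply: (le_young yP); apply: (@le_trans _ _ ((modulus (f x : K) + modulus (g x : K)) / (s + t))).
    by rewrite ler_wpM2r ?invr_ge0 ?(ltW st0)//; exact: ler_modulusD.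
  rewrite /l le_eqVlt; apply/orP; left; apply/eqP; field.
  by rewrite !gt_eqF.
split; first by have [] := key (nrm f + 1) (nrm g + 1); rewrite ?ltrDl.
apply/ler_addgt0Pr => e e0.
have e2 : 0 < e / 2 by rewrite divr_gt0.
have [||_] := key (nrm f + e / 2) (nrm g + e / 2); rewrite ?ltrDl//.
by move=> /le_trans; apply; lra.
Qed.

Lemma L_seminormed : seminormed L.
Proof.
have c0 : carrier (0 : L) /\ nrm (0 : L) <= 0.
  have [|c1 n1] := @modular_nrm_le (0 : L) 1 measurable_scalar0 ltr01.
    rewrite /modular (eq_integral (cst 0%E)); first by rewrite integral0 lee01.
    by move=> x _; congr EFin; apply: (young0 yP); rewrite modulus0 mul0r.
  have := @nrm_dominated (0 : L) (0 : L) 0 measurable_scalar0 c1 (lexx 0).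
  by rewrite mul0r; apply => x _; rewrite mul0r modulus0.
have hZ c (u : L) : carrier u -> carrier (c *: u) /\ nrm (c *: u) <= modulus c * nrm u.
  move=> cu; apply: nrm_dominated => //; [|exact: modulus_ge0|].
    rewrite -[_ *: _]addr0; apply: measurable_scalarL; first exact: carrier_measurable.
    exact: measurable_scalar0.
  by move=> x _; exact: modulusZ_le.
split.
- by case: c0.
- by move=> c u v cu cv; apply: (L_carrierD _ cv).1; case: (hZ c u cu).
- by move=> u _; exact: L_nrm_ge0.
- move=> c u cu; apply/eqP; rewrite eq_le (hZ c u cu).2/=.
  have [->|cn0] := eqVneq c 0.
    by rewrite modulus0 mul0r L_nrm_ge0.
  have [cz _] := hZ c u cu; have [_] := hZ c^-1 _ cz.
  rewrite scalerA mulVf// scale1r modulusV => h.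
  by rewrite -ler_pdivlMl ?modulus_gt0.
- by move=> u v cu cv; case: (L_carrierD cu cv).
Qed.

End orlicz_space.

Lemma nneseries_bounded {R : realType} (u : nat -> \bar R) (M : \bar R) :
  (forall n, (0 <= u n)%E) -> (forall n, (\sum_(0 <= i < n) u i <= M)%E) ->
  (\sum_(0 <= i <oo) u i <= M)%E.
Proof.
move=> u0 uM; apply: lime_le; first exact: is_cvg_nneseries.
by apply: nearW => n; exact: uM.
Qed.

Lemma sum_half {R : realType} n m : (n <= m)%N ->
  \sum_(n <= i < m) (2^-1 : R) ^+ i = 2 * 2^-1 ^+ n - 2 * 2^-1 ^+ m.
Proof.
move=> nm; rewrite (eq_big_nat _ _ (F2 := fun i => (- (2 * 2^-1 ^+ i.+1)) - (- (2 * 2^-1 ^+ i)))).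
  by rewrite telescope_sumr// opprK addrC.
by move=> i _; rewrite exprS; field.
Qed.

Lemma limn_einf_le {R : realType} (u : nat -> \bar R) (M : \bar R) :
  (forall n, (u n <= M)%E) -> (limn_einf u <= M)%E.
Proof.
move=> uM; rewrite limn_einf_lim; apply: lime_le; first exact: is_cvg_einfs.
apply: nearW => n; apply: le_trans (uM n).
by apply: ereal_inf_lbound; exists n => /=.
Qed.

Section completeness.
Set Implicit Arguments.
Unset Strict Implicit.
Context {R : realType} {k : scalar_kind}.
Local Notation K := (Defs.scalar R k).
Local Notation D := (`[0, 1[%classic : set R).
Local Notation mu := (@lebesgue_measure R).
Variable F : R -> \bar R.
Hypothesis oF : finite_orlicz F.
Local Notation Phi := (real_form F).
Local Notation L := (L_ k F).
Implicit Types f g : R -> K^o.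

Let yP : young Phi := young_real_form oF.
Let sL : seminormed L := L_seminormed oF.

(** F grows at least linearly, so L_F is contained in L_1. *)
Lemma L1_bound : exists2 c : R, 0 < c & forall f : L, carrier f ->
  (\int[mu]_(x in D) (modulus (f x : K))%:E <= (c * nrm f)%:E)%E.
Proof.
have [c c0 hc] := young_linear_bound yP; exists (2 * c); first exact: mulr_gt0.
move=> f cf; have n0 := nrm_ge0 sL cf; have mf := carrier_measurable cf.
apply/lee_addgt0Pr => e e0.
pose t := nrm f + e / (2 * c).
have d0 : 0 < e / (2 * c) by rewrite divr_gt0// mulr_gt0.
have t0 : 0 < t by rewrite ltr_wpDl.
have ft : nrm f < t by rewrite ltrDl.
rewrite -EFinD; have -> : 2 * c * nrm f + e = t * c * 2.
  by rewrite /t; field; rewrite gt_eqF.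
have hm := nrm_lt_modular oF cf ft.
have mp := measurable_youngE yP (measurable_modulus_div t mf).
apply: (@le_trans _ _ (\int[mu]_(x in D) ((t * c)%:E * (1 + (Phi (modulus (f x : K) / t))%:E)))%E).
  apply: ge0_le_integral.
  - exact: measurable_unit_itv.
  - by move=> x _; rewrite lee_fin modulus_ge0.
  - by apply/measurable_EFinP; exact: measurable_modulus.
  - by apply: measurable_funeM; apply: emeasurable_funD => //; exact: measurable_cst.
  - by move=> x _; rewrite -EFinD -EFinM lee_fin -mulrA mulrC -ler_pdivrMr.
have tc0 : 0 <= t * c by rewrite mulr_ge0// ltW.
have P0 x : (0 <= (Phi (modulus (f x : K) / t))%:E)%E by rewrite lee_fin (young_ge0 yP).
rewrite ge0_integralZl_EFin//; last 2 first.
- by move=> x _; rewrite adde_ge0.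
- by apply: emeasurable_funD => //; exact: measurable_cst.
rewrite ge0_integralD//.
rewrite (integral_cst _ _ 1%E)//= mul1e mu_unit_itv [leRHS]EFinM lee_wpmul2l//.
by rewrite -[2]/(1 + 1) EFinD leeD2l.
Qed.

Lemma scalar_lim (a : nat -> K) (M : R) :
  (forall n, \sum_(i < n) modulus (a i) <= M) ->
  exists z : K, ((fun n => scalar_re (\sum_(i < n) a i)) @ \oo --> scalar_re z) /\
    ((fun n => scalar_im (\sum_(i < n) a i)) @ \oo --> scalar_im z).
Proof.
move=> hM.
have key (s : K -> R) : s 0 = 0 -> {morph s : x y / x + y} ->
    (forall z, `|s z| <= modulus z) -> cvgn (fun n => s (\sum_(i < n) a i)).
  move=> s0 sD sle.
  have -> : (fun n => s (\sum_(i < n) a i)) = series (fun i => s (a i)).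
    apply/funext => n; rewrite (big_morph s sD s0) /series/=.
    by rewrite -(big_mkord xpredT (fun i => s (a i))).
  apply: normed_cvg; apply: (@series_le_cvg _ _ (fun i => modulus (a i))).
  - by move=> n /=; exact: normr_ge0.
  - by move=> n /=; exact: modulus_ge0.
  - by move=> n /=; exact: sle.
  apply: nondecreasing_is_cvgn.
    by apply/nondecreasing_series => n _ _; exact: modulus_ge0.
  by exists M => _ [n _ <-]; rewrite /series/= big_mkord.
have re0 : scalar_re (0 : K) = 0 by rewrite /scalar_re; case: (k).
have im0 : scalar_im (0 : K) = 0 by rewrite /scalar_im; case: (k).
have /cvg_ex[r hr] := key scalar_re re0 (@scalar_reD R k) (@scalar_re_le R k).
have /cvg_ex[i hi] := key scalar_im im0 (@scalar_imD R k) (@scalar_im_le R k).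
exists (scalar_of k r i); rewrite scalar_re_of scalar_im_of//.
move: hi; clear.
rewrite /scalar_im; move: a; case: (k) => // a /= hi _.
have := @cvg_unique _ (@Rhausdorff R) _ _ _ _ hi; apply.
exact: cvg_cst.
Qed.

(** By the bound in L_1 the series converges absolutely almost everywhere; norms
    of its tails are controlled by the Fatou lemma. *)
Lemma L_complete : complete L.
Proof.
move=> f cf nf; have mf n := carrier_measurable (cf n).
have [c c0 hc] := L1_bound.
pose s n : L := \sum_(i < n) f i.
have cs n : carrier (s n) by apply: (carrier_sum sL).
have ms n := carrier_measurable (cs n).
have sE n x : s n x = \sum_(i < n) (f i x : K) by rewrite /s fct_sumE.
pose S x := (\sum_(0 <= n <oo) (modulus (f n x : K))%:E)%E.
have mS : measurable_fun D S.
  apply: ge0_emeasurable_sum.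
  - by move=> i x _; rewrite lee_fin modulus_ge0.
  - by move=> i _; apply/measurable_EFinP; exact: measurable_modulus.
have S0 x : (0 <= S x)%E.
  by apply: nneseries_ge0 => n _ _; rewrite lee_fin modulus_ge0.
have intS : (\int[mu]_(x in D) S x < +oo)%E.
  rewrite integral_nneseries//; last 2 first.
  - by move=> i; apply/measurable_EFinP; exact: measurable_modulus.
  - by move=> i x _; rewrite lee_fin modulus_ge0.
  apply: (@le_lt_trans _ _ (c * 2)%:E); last by rewrite ltry.
  apply: nneseries_bounded => n.
    by apply: integral_ge0 => x _; rewrite lee_fin modulus_ge0.
  apply: (@le_trans _ _ (\sum_(0 <= i < n) (c * 2^-1 ^+ i)%:E)%E).
    apply: lee_sum => i _; apply: le_trans (hc _ (cf i)) _.
    by rewrite lee_fin ler_wpM2l// ltW.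
  rewrite sumEFin lee_fin -mulr_sumr ler_wpM2l ?(ltW c0)// sum_half// expr0.
  by rewrite mulr1 gerBl mulr_ge0// exprn_ge0// invr_ge0.
have aeS : {ae mu, forall x, D x -> S x \is a fin_num}.
  apply: integrable_ae; first exact: measurable_unit_itv.
  apply/integrableP; split => //.
  by under eq_integral do rewrite gee0_abs//.
pose G := D `&` [set x | S x \is a fin_num].
have mG : measurable G by apply: emeasurable_fin_num => //; exact: measurable_unit_itv.
pose w n := cutoff G (s n).
have mw n : measurable_scalar D (w n) by exact: measurable_cutoff.
have re0 : scalar_re (0 : K) = 0 by rewrite /scalar_re; case: (k).
have im0 : scalar_im (0 : K) = 0 by rewrite /scalar_im; case: (k).
have /choice[v hv] : forall x, exists z : K,
    ((fun n => scalar_re (w n x : K)) @ \oo --> scalar_re z) /\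
    ((fun n => scalar_im (w n x : K)) @ \oo --> scalar_im z).
  move=> x; have [xG|xG] := pselect (G x); last first.
    exists 0; rewrite /w /cutoff; have -> : (x \in G) = false by apply/negbTE; rewrite notin_setE.
    by split; exact: cvg_cst.
  have -> : (fun n => scalar_re (w n x : K)) = (fun n => scalar_re (\sum_(i < n) (f i x : K))).
    by apply/funext => n; rewrite /w /cutoff mem_set// sE.
  have -> : (fun n => scalar_im (w n x : K)) = (fun n => scalar_im (\sum_(i < n) (f i x : K))).
    by apply/funext => n; rewrite /w /cutoff mem_set// sE.
  apply: (@scalar_lim (fun i => f i x) (fine (S x))) => n.
  have [_ /= fS] := xG; rewrite -lee_fin fineK// -sumEFin.
  rewrite -(big_mkord xpredT (fun i => (modulus (f i x : K))%:E)).
  by apply: nneseries_lim_ge => i _ _; rewrite lee_fin modulus_ge0.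
have mv : measurable_scalar D (v : R -> K^o).
  apply/measurable_scalarP; split.
    apply: (@measurable_fun_cvg _ _ _ _ (fun n => scalar_re \o (w n : R -> K))).
      by move=> n; have /measurable_scalarP[] := mw n.
    by move=> x _; have [] := hv x.
  apply: (@measurable_fun_cvg _ _ _ _ (fun n => scalar_im \o (w n : R -> K))).
    by move=> n; have /measurable_scalarP[] := mw n.
  by move=> x _; have [] := hv x.
have mB (g h : R -> K^o) : measurable_scalar D g -> measurable_scalar D h ->
    measurable_scalar D (g - h).
  by move=> mg mh; rewrite addrC -scaleN1r; exact: measurable_scalarL.
have key n : carrier ((v : L) - s n) /\ nrm ((v : L) - s n) <= 2 * 2^-1 ^+ n.
  have t0 : 0 < 2 * 2^-1 ^+ n :> R by rewrite mulr_gt0// exprn_gt0// invr_gt0.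
  set t := 2 * _ in t0 *.
  apply: modular_nrm_le => //; first exact: mB.
  have -> : modular Phi (fun x => (modulus (((v : L) - s n) x : K) / t)%R) =
            modular Phi (fun x => (modulus (((v : L) - w n) x : K) / t)%R).
    apply: ge0_ae_eq_integral => //.
    - by apply: (measurable_youngE yP); apply: measurable_modulus_div; exact: mB.
    - by apply: (measurable_youngE yP); apply: measurable_modulus_div; exact: mB.
    - by move=> x _; rewrite lee_fin (young_ge0 yP).
    - by move=> x _; rewrite lee_fin (young_ge0 yP).
    have [N [mN N0 sN]] := aeS; exists N; split => // x /= hx; apply: sN => /= h.
    apply: hx => Dx; rewrite /w /cutoff !fctE.
    by rewrite mem_set//; split => //; exact: h.
  pose h m x := (Phi (modulus ((w (m + n.+1)%N - w n) x : K) / t))%:E.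
  have hlim x : (fun m => h m x) @ \oo --> (Phi (modulus (((v : L) - w n) x : K) / t))%:E.
    have h1 : (fun m => modulus ((w m - w n) x : K)) @ \oo -->
              modulus (((v : L) - w n) x : K).
      apply/cvgrPdist_lt => e e0; have e20 : 0 < e / 2 by rewrite divr_gt0.
      have [/cvgrPdist_lt/(_ _ e20) h1 /cvgrPdist_lt/(_ _ e20) h2] := hv x.
      near=> m; have m1 : `|scalar_re (v x) - scalar_re (w m x : K)| < e / 2 by near: m.
      have m2 : `|scalar_im (v x) - scalar_im (w m x : K)| < e / 2 by near: m.
      rewrite (le_lt_trans (modulusB _ _))//.
      have -> : ((v : L) - w n) x - (w m - w n) x = v x - (w m x : K) :> K.
        by rewrite !fctE; ring.
      rewrite (le_lt_trans (modulus_le_re_im _))//.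
      by rewrite scalar_reD scalar_imD scalar_reN scalar_imN (splitr e) ltrD.
    apply: cvg_EFin; first exact: nearW.
    apply: (@cvg_comp _ _ _ (fun m => modulus ((w (m + n.+1)%N - w n) x : K) / t) Phi _
      (nbhs (modulus (((v : L) - w n) x : K) / t))); last exact: young_continuous.
    have h2 : (fun m => modulus ((w (m + n.+1)%N - w n) x : K)) @ \oo -->
        modulus (((v : L) - w n) x : K).
      exact: (cvg_comp _ _ (cvg_addnr n.+1) h1).
    have h3 : (fun m => modulus ((w (m + n.+1)%N - w n) x : K) / t) @ \oo -->
        modulus (((v : L) - w n) x : K) / t.
      by apply: cvgM => //; exact: cvg_cst.
    exact: h3.
  have -> : modular Phi (fun x => (modulus (((v : L) - w n) x : K) / t)%R) =
     (\int[mu]_(x in D) limn_einf (fun m => h m x))%E.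
    by apply: eq_integral => x _; rewrite (cvg_limn_einf_sup (hlim x)).1.
  apply: le_trans (fatou _ _ _ _) _.
  - exact: measurable_unit_itv.
  - by move=> m; apply: (measurable_youngE yP); apply: measurable_modulus_div; exact: mB.
  - by move=> m x _; rewrite lee_fin (young_ge0 yP).
  apply: limn_einf_le => m; set p := (m + n.+1)%N.
  have np : (n < p)%N by rewrite /p addnS ltnS leq_addl.
  have sp : s p - s n = \sum_(n <= i < p) f i.
    rewrite /s -!(big_mkord xpredT (fun i => f i)) (@big_cat_nat _ _ _ n)/= ?(ltnW np)//.
    by rewrite addrAC subrr add0r.
  have h1 : nrm (s p - s n) < t.
    rewrite sp; apply: le_lt_trans (ler_nrm_sum sL _ cf) _.
    apply: (@le_lt_trans _ _ (\sum_(n <= i < p) 2^-1 ^+ i)).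
      by apply: ler_sum => i _; exact: nf.
    by rewrite sum_half ?(ltnW np)// /t gtrBl mulr_gt0// exprn_gt0// invr_gt0.
  have cd : carrier (s p - s n) by exact: (carrierB sL).
  apply: le_trans (nrm_lt_modular oF cd h1).
  apply: (le_modular yP).
  - by apply: measurable_modulus_div; exact: mB.
  - by apply: measurable_modulus_div; exact: mB.
  move=> x _; rewrite ler_wpM2r ?invr_ge0 ?(ltW t0)// /w /cutoff !fctE.
  by case: (x \in G) => //; rewrite subrr modulus0 modulus_ge0.
exists v; split=> [|n]; last by case: (key n).
by have [] := key 0%N; rewrite /s big_ord0 subr0.
Unshelve. all: by end_near. Qed.

End completeness.

(** * Comparison with the square function *)
Section square_comparison.
Set Implicit Arguments.
Unset Strict Implicit.
Context {R : realType}.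
Variable Phi : R -> R.
Hypothesis yP : young Phi.

(** F (t) / t^2 is essentially decreasing, with denominators cleared. *)
Definition two_concave C := forall s t : R, 1 <= s -> s <= t ->
  Phi t * s ^+ 2 <= C * Phi s * t ^+ 2.

(** F (t) / t^2 is essentially increasing, with denominators cleared. *)
Definition two_convex C := forall s t : R, 1 <= s -> s <= t ->
  Phi s * t ^+ 2 <= C * Phi t * s ^+ 2.

Definition doubling C := forall t : R, 1 <= t -> Phi (2 * t) <= C * Phi t.

Let P0 := young_ge0 yP.

Lemma two_concave_ge0 C : two_concave C -> 0 < Phi 1 -> 1 <= C.
Proof.
move=> hC P1; have := hC 1 1 (lexx _) (lexx _).
by rewrite expr1n !mulr1 -[leLHS]mul1r ler_pM2r.
Qed.

Lemma two_concave_doubling C : two_concave C -> doubling (4 * C).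
Proof.
move=> hC t t1; have t0 : 0 < t by exact: lt_le_trans t1.
have := hC t (2 * t) t1; rewrite exprMn (_ : 2 ^+ 2 = 4); last by rewrite expr2; ring.
have -> : C * Phi t * (4 * t ^+ 2) = 4 * C * Phi t * t ^+ 2 by ring.
by rewrite ler_pM2r ?exprn_gt0//; apply; lra.
Qed.

Lemma young_jensen N (f : (nat -> bool) -> R) :
  2 ^+ N * Phi ((2 ^+ N)^-1 * \sum_(e <- signs N) f e) <=
  \sum_(e <- signs N) Phi (f e).
Proof.
elim: N f => [|N IH] f; first by rewrite /= !big_seq1 expr0 invr1 !mul1r.
rewrite !sum_signsS !big_split/= exprS.
apply: le_trans (lerD (IH _) (IH _)); set a := \sum_(_ <- _) _; set b := \sum_(_ <- _) _.
have h01 : 0 <= (2^-1 : R) <= 1 by rewrite invr_ge0 ler0n invf_le1// ler1n.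
have := young_convex yP ((2 ^+ N)^-1 * a) ((2 ^+ N)^-1 * b) h01.
have p0 : (0 : R) < 2 ^+ N by rewrite exprn_gt0.
have -> : 1 - 2^-1 = 2^-1 :> R by field.
have -> : 2^-1 * ((2 ^+ N)^-1 * a) + 2^-1 * ((2 ^+ N)^-1 * b) =
  (2 * 2 ^+ N)^-1 * (a + b) by field; rewrite gt_eqF.
set Z := Phi _; set X := Phi _; set Y := Phi _ => h.
have -> : 2 ^+ N * X + 2 ^+ N * Y = 2 * 2 ^+ N * (2^-1 * X + 2^-1 * Y) by field.
by rewrite ler_wpM2l// mulr_ge0// ltW.
Qed.

(** F (sqrt u) is concave up to constants: compare each u_i with the quadratic
    mean, or with 1 when that mean is small. *)
Lemma two_concave_mean C N (l u : nat -> R) :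
  two_concave C -> 0 <= C -> (forall i, 0 <= l i) -> (forall i, 0 <= u i) ->
  \sum_(i < N) l i = 1 ->
  \sum_(i < N) l i * Phi (u i) <=
  (1 + C) * (Phi 1 + Phi (Num.sqrt (\sum_(i < N) l i * u i ^+ 2))).
Proof.
move=> hC C0 l0 u0 l1; set q2 := \sum_(i < N) l i * u i ^+ 2.
have q20 : 0 <= q2 by apply: sumr_ge0 => i _; rewrite mulr_ge0// sqr_ge0.
set q := Num.sqrt q2; pose Q := Num.max q 1.
have Q1 : 1 <= Q by rewrite le_max lexx orbT.
have qQ : q <= Q by rewrite le_max lexx.
have Q0 : 0 < Q by exact: lt_le_trans Q1.
have Q20 : 0 < Q ^+ 2 by rewrite exprn_gt0.
have q2Q : q2 <= Q ^+ 2 by rewrite -(sqr_sqrtr q20) -/q lerXn2r// nnegrE ?sqrtr_ge0// ltW.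
have hi i : Phi (u i) <= Phi Q + C * Phi Q * u i ^+ 2 / Q ^+ 2.
  have c0 : 0 <= C * Phi Q * u i ^+ 2 / Q ^+ 2.
    by rewrite divr_ge0 ?(ltW Q20)// mulr_ge0 ?sqr_ge0// mulr_ge0.
  have [uQ|Qu] := leP (u i) Q.
    have := le_young yP uQ; lra.
  have := hC Q (u i) Q1 (ltW Qu); rewrite -ler_pdivlMr// => h.
  have := P0 Q; lra.
apply: (@le_trans _ _ (\sum_(i < N) (l i * Phi Q + C * Phi Q / Q ^+ 2 * (l i * u i ^+ 2)))).
  apply: ler_sum => i _; apply: le_trans (ler_wpM2l (l0 i) (hi i)) _.
  by rewrite le_eqVlt; apply/orP; left; apply/eqP; field; rewrite gt_eqF.
rewrite big_split/= -mulr_suml l1 mul1r -mulr_sumr -/q2.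
have h : C * Phi Q / Q ^+ 2 * q2 <= C * Phi Q.
  rewrite -mulrA ler_piMr ?mulr_ge0// mulrC ler_pdivrMr// mul1r//.
apply: (@le_trans _ _ ((1 + C) * Phi Q)); first lra.
rewrite ler_wpM2l ?addr_ge0// /Q; have := P0 1; have := P0 q.
by case: (leP q 1) => _; lra.
Qed.

(** F (sqrt u) is convex up to constants: the u_i below half of the quadratic mean
    make up at most a quarter of its square, so that the others determine it. *)
Lemma two_convex_mean C Cd N (l u : nat -> R) :
  two_convex C -> 0 <= C -> doubling Cd -> 0 <= Cd ->
  (forall i, 0 <= l i) -> (forall i, 0 <= u i) ->
  \sum_(i < N) l i <= 1 ->
  Phi (Num.max 1 (Num.sqrt (\sum_(i < N) l i * u i ^+ 2))) <=
  Phi 2 + Cd * C * \sum_(i < N) l i * Phi (u i).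
Proof.
move=> hC C0 hD Cd0 l0 u0 l1; set q2 := \sum_(i < N) l i * u i ^+ 2.
have q20 : 0 <= q2 by apply: sumr_ge0 => i _; rewrite mulr_ge0// sqr_ge0.
set q := Num.sqrt q2; set S := \sum_(i < N) _.
have S0 : 0 <= S by apply: sumr_ge0 => i _; rewrite mulr_ge0.
have CS0 : 0 <= Cd * C * S by rewrite !mulr_ge0.
have [q2'|q2'] := leP q 2.
  have : Phi (Num.max 1 q) <= Phi 2.
    by apply: (le_young yP); rewrite ge_max q2' ler1n.
  lra.
rewrite max_r; last lra.
pose h := q / 2; have h1 : 1 <= h by rewrite /h; lra.
have hh : q = 2 * h by rewrite /h; field.
have qE : q ^+ 2 = q2 by rewrite sqr_sqrtr.
have h20 : 0 < h ^+ 2 by rewrite exprn_gt0// (lt_le_trans _ h1).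
have hi i : u i ^+ 2 * Phi h <= h ^+ 2 * (C * Phi (u i)) + h ^+ 2 * Phi h.
  have c0 : 0 <= h ^+ 2 * (C * Phi (u i)) by rewrite mulr_ge0 ?(ltW h20)// mulr_ge0.
  have c1 : 0 <= h ^+ 2 * Phi h by rewrite mulr_ge0 ?(ltW h20).
  have [uh|hu] := leP (u i) h.
    have : u i ^+ 2 * Phi h <= h ^+ 2 * Phi h.
      by rewrite ler_wpM2r// lerXn2r// nnegrE// (le_trans _ h1).
    lra.
  have := hC h (u i) h1 (ltW hu); lra.
have : q2 * Phi h <= h ^+ 2 * (C * S) + h ^+ 2 * Phi h.
  rewrite /q2 /S mulr_suml.
  apply: (@le_trans _ _ (\sum_(i < N) (h ^+ 2 * C * (l i * Phi (u i)) + h ^+ 2 * Phi h * l i))).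
    apply: ler_sum => i _; rewrite -mulrA; apply: le_trans (ler_wpM2l (l0 i) (hi i)) _.
    by rewrite le_eqVlt; apply/orP; left; apply/eqP; ring.
  have hl : h ^+ 2 * Phi h * (\sum_(i < N) l i) <= h ^+ 2 * Phi h.
    by rewrite ler_piMr// mulr_ge0// ltW.
  rewrite big_split/= -!mulr_sumr; lra.
rewrite -qE hh exprMn => h3.
have {h3} : 3 * Phi h <= C * S.
  rewrite -(ler_pM2l h20); move: h3; rewrite (_ : 2 ^+ 2 = 4 :> R); last by rewrite expr2; ring.
  lra.
have := hD h h1; have := P0 2; have := P0 h => p1 p2 p3 p4.
have : Cd * Phi h <= Cd * (C * S) by rewrite ler_wpM2l//; lra.
lra.
Qed.

(** Iterating doubling gives growth at most like a power. *)
Lemma doubling_power C : doubling C -> exists2 p : nat, (0 < p)%N &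
  forall Q u, 1 <= Q -> Q <= u -> Phi u <= (2 * (u / Q)) ^+ p * Phi Q.
Proof.
move=> hC; have [p p0 Cp] : exists2 p : nat, (0 < p)%N & C <= 2 ^+ p.
  exists (Num.bound `|C|).+1 => //; apply: le_trans (ler_norm _) _.
  apply/ltW; apply: lt_le_trans (archi_boundP (normr_ge0 C)) _.
  by rewrite -natrX ler_nat ltnW// ltnW// ltn_expl.
exists p => // Q u Q1 Qu; have Q0 : 0 < Q by exact: lt_le_trans Q1.
have [m hm] : exists m, u <= 2 ^+ m * Q.
  exists (Num.bound u); apply: le_trans (ltW (archi_boundP _)) _; first exact: le_trans (ltW Q0) Qu.
  apply: (@le_trans _ _ (2 ^+ Num.bound u)); first by rewrite -natrX ler_nat ltnW// ltn_expl.
  by rewrite ler_peMr// exprn_ge0.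
elim: m u Qu hm => [|m IH] u Qu um.
  have -> : u = Q by apply/eqP; rewrite eq_le Qu andbT; rewrite expr0 mul1r in um.
  by rewrite divff ?gt_eqF// mulr1 ler_peMl// exprn_ege1// ler1n.
have u0 : 0 < u by exact: lt_le_trans Qu.
have [h|h] := leP (2 * Q) u; last first.
  apply: (@le_trans _ _ (2 ^+ p * Phi Q)).
    apply: (@le_trans _ _ (Phi (2 * Q))); first by apply: (le_young yP); exact: ltW.
    by apply: le_trans (hC _ Q1) _; rewrite ler_wpM2r.
  have h4 : 1 <= u / Q by rewrite ler_pdivlMr// mul1r.
  have h5 : 2 <= 2 * (u / Q) by lra.
  by rewrite ler_wpM2r// lerXn2r// nnegrE; lra.
have h2 : Q <= u / 2 by rewrite ler_pdivlMr// mulrC.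
have h3 : u / 2 <= 2 ^+ m * Q by rewrite ler_pdivrMr// -mulrA (mulrC Q) mulrA -exprSr.
have := hC (u / 2) (le_trans Q1 h2); have -> : 2 * (u / 2) = u by field.
move=> /le_trans; apply.
apply: (@le_trans _ _ (2 ^+ p * Phi (u / 2))); first by rewrite ler_wpM2r.
have -> : (2 * (u / Q)) ^+ p * Phi Q = 2 ^+ p * ((2 * (u / 2 / Q)) ^+ p * Phi Q).
  by rewrite [RHS]mulrA -exprMn; congr (_ ^+ _ * _); field; rewrite gt_eqF.
by rewrite ler_wpM2l ?exprn_ge0// IH.
Qed.

(** A power is dominated by an exponential. *)
Lemma doubling_expR C : doubling C -> exists2 A : R, 0 <= A &
  forall Q u, 1 <= Q -> Phi u <= A * expR (u / (2 * Q)) * Phi Q.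
Proof.
move=> /doubling_power[p p0 hp]; pose A : R := Num.max 1 ((4 * p%:R) ^+ p).
have A1 : 1 <= A by rewrite le_max lexx.
have pp : (0 : R) < p%:R by rewrite ltr0n.
exists A => [|Q u Q1]; first exact: le_trans A1.
have Q0 : 0 < Q by exact: lt_le_trans Q1.
have [u0|u0] := leP u 0.
  by rewrite (young0 yP)// !mulr_ge0 ?expR_ge0// (le_trans _ A1).
have e1 : 1 <= expR (u / (2 * Q)).
  by rewrite (le_trans _ (expR_ge1Dx _))// lerDl divr_ge0 ?(ltW u0)// mulr_ge0// ltW.
have [uQ|/ltW Qu] := leP u Q.
  apply: le_trans (le_young yP uQ) _; rewrite ler_peMl// -[leLHS]mul1r ler_pM//.
apply: le_trans (hp Q u Q1 Qu) _; rewrite ler_wpM2r//.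
have v0 : 0 <= u / (2 * Q) by rewrite divr_ge0 ?(ltW u0)// mulr_ge0// ltW.
apply: (@le_trans _ _ ((4 * p%:R) ^+ p * expR (u / (2 * Q)))); last first.
  by rewrite ler_wpM2r ?expR_ge0// le_max lexx orbT.
have -> : expR (u / (2 * Q)) = expR (u / (2 * Q) / p%:R) ^+ p.
  by rewrite -expRM_natl; congr expR; field; rewrite !gt_eqF.
rewrite -exprMn; set v := u / (2 * Q) in v0 *.
have -> : 2 * (u / Q) = 4 * p%:R * (v / p%:R) by rewrite /v; field; rewrite !gt_eqF.
have p40 : 0 <= 4 * p%:R :> R by rewrite mulr_ge0.
have h6 : 4 * p%:R * (v / p%:R) <= 4 * p%:R * expR (v / p%:R).
  by rewrite ler_wpM2l// (le_trans _ (expR_ge1Dx _))// lerDr.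
have e0 : 0 <= 4 * p%:R * (v / p%:R) by rewrite mulr_ge0// divr_ge0.
by apply: lerXn2r h6; rewrite nnegrE// (le_trans e0).
Qed.

(** Sums with random signs are subgaussian at the scale of the quadratic mean,
    and a doubling function grows at most like a power. *)
Lemma khinchin_upper C : doubling C -> exists2 A : R, 0 <= A &
  forall Q (c : nat -> R) N, 1 <= Q ->
  (\sum_(i < N) c i ^+ 2 <= Q ^+ 2) ->
  \sum_(e <- signs N) Phi `|signed_sum c N e| <= 2 ^+ N * (A * Phi Q).
Proof.
move=> /doubling_expR[A A0 hA]; exists (A * (2 * expR 2^-1)).
  by rewrite !mulr_ge0 ?expR_ge0.
move=> Q c N Q1 hc; have Q0 : 0 < Q by exact: lt_le_trans Q1.
pose d i := if (i < N)%N then c i / (2 * Q) else 0.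
have dE e : signed_sum d N e = signed_sum c N e / (2 * Q).
  by rewrite /signed_sum mulr_suml; apply: eq_bigr => i _; rewrite /d ltn_ord mulrA.
have d2 : \sum_(i < N) d i ^+ 2 <= 4^-1.
  have -> : \sum_(i < N) d i ^+ 2 = (\sum_(i < N) c i ^+ 2) / (2 * Q) ^+ 2.
    by rewrite mulr_suml; apply: eq_bigr => i _; rewrite /d ltn_ord expr_div_n.
  rewrite ler_pdivrMr ?exprn_gt0 ?mulr_gt0//; apply: le_trans hc _.
  by rewrite le_eqVlt; apply/orP; left; apply/eqP; rewrite exprMn; field.
have dh i : `|d i| <= 2^-1.
  have [iN|iN] := ltnP i N; last by rewrite /d ltnNge iN/= normr0.
  rewrite -(@ler_pXn2r _ 2)// ?nnegrE// real_normK ?num_real//.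
  rewrite (le_trans _ (le_trans d2 _))//; last first.
    by rewrite le_eqVlt; apply/orP; left; apply/eqP; field.
  rewrite (bigD1 (Ordinal iN))//= lerDl; apply: sumr_ge0 => j _; exact: sqr_ge0.
have hS := sum_signed_expR_norm N dh.
apply: (@le_trans _ _ (\sum_(e <- signs N) A * expR `|signed_sum d N e| * Phi Q)).
  apply: ler_sum => e _; apply: le_trans (hA Q _ Q1) _.
  by rewrite dE normrM normfV (@ger0_norm _ (2 * Q)) ?mulr_ge0// ltW.
rewrite -mulr_suml -mulr_sumr mulrA ler_wpM2r// mulrCA ler_wpM2l//.
apply: le_trans hS _; rewrite ler_wpM2l ?exprn_ge0// ler_wpM2l// ler_expR.
lra.
Qed.

End square_comparison.

(** * Integrated estimates *)
Section modular_sums.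
Set Implicit Arguments.
Unset Strict Implicit.
Context {R : realType} {k : scalar_kind}.
Local Notation K := (Defs.scalar R k).
Local Notation D := (`[0, 1[%classic : set R).
Local Notation mu := (@lebesgue_measure R).
Variable F : R -> \bar R.
Hypothesis oF : finite_orlicz F.
Local Notation Phi := (real_form F).
Local Notation L := (L_ k F).

Let yP : young Phi := young_real_form oF.
Let sL : seminormed L := L_seminormed oF.

Lemma le_integral_unit (f g : R -> R) : (forall x, D x -> 0 <= f x) ->
  measurable_fun D f -> measurable_fun D g -> (forall x, D x -> f x <= g x) ->
  (\int[mu]_(x in D) (f x)%:E <= \int[mu]_(x in D) (g x)%:E)%E.
Proof.
move=> f0 mf mg fg; apply: ge0_le_integral.
- exact: measurable_unit_itv.
- by move=> x Dx; rewrite lee_fin f0.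
- exact/measurable_EFinP.
- exact/measurable_EFinP.
- by move=> x Dx; rewrite lee_fin fg.
Qed.

Lemma integral_sum_unit I (r : seq I) (f : I -> R -> R) (l : I -> R) :
  (forall i, 0 <= l i) -> (forall i x, 0 <= f i x) ->
  (forall i, measurable_fun D (f i)) ->
  (\int[mu]_(x in D) (\sum_(i <- r) l i * f i x)%:E =
   \sum_(i <- r) (l i)%:E * \int[mu]_(x in D) (f i x)%:E)%E.
Proof.
move=> l0 f0 mf.
under eq_integral do rewrite -sumEFin.
rewrite ge0_integral_sum//; last 2 first.
- move=> i; apply/measurable_EFinP.
  by apply: measurable_funM; [exact: measurable_cst|exact: mf].
- by move=> i x _; rewrite lee_fin mulr_ge0.
apply: eq_bigr => i _; under eq_integral do rewrite EFinM.
rewrite ge0_integralZl_EFin//.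
- by move=> x _; rewrite lee_fin; exact: f0.
- by apply/measurable_EFinP; exact: mf.
Qed.

Lemma integral_affine_unit (f : R -> R) (c d : R) : 0 <= c -> 0 <= d ->
  (forall x, 0 <= f x) -> measurable_fun D f ->
  (\int[mu]_(x in D) (c + d * f x)%:E = c%:E + d%:E * \int[mu]_(x in D) (f x)%:E)%E.
Proof.
move=> c0 d0 f0 mf.
under eq_integral do rewrite EFinD EFinM.
rewrite ge0_integralD//; last 2 first.
- by move=> x _; rewrite -EFinM lee_fin mulr_ge0//; exact: f0.
- by apply: measurable_funeM; apply/measurable_EFinP; exact: mf.
rewrite (integral_cst _ _ c%:E)//= mu_unit_itv mule1 ge0_integralZl_EFin//.
- by move=> x _; rewrite lee_fin; exact: f0.
- by apply/measurable_EFinP; exact: mf.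
Qed.

Lemma nrm_le_modular (f : L) : carrier f ->
  ((nrm f)%:E <= 1 + modular Phi (fun x => modulus (f x : K)))%E.
Proof.
move=> cf; have mf := carrier_measurable cf.
set M := modular _ _; have M0 : (0 <= M)%E by exact: modular_ge0.
have [fM|] := boolP (M \is a fin_num); last first.
  by rewrite ge0_fin_numE// -leNgt leye_eq => /eqP ->; rewrite leey.
rewrite -(fineK fM) -EFinD lee_fin.
have s1 : 1 <= 1 + fine M by rewrite lerDl fine_ge0.
have s0 : 0 < 1 + fine M by exact: lt_le_trans s1.
apply: (modular_nrm_le oF mf s0 _).2.
apply: (modular_le1 yP) => //; first exact: measurable_modulus.
by rewrite -/M EFinD fineK// leeDr.
Qed.

(** The norm is at most 1 plus the modular, so that an average of norms over
    signs is bounded by integrating an average of values of F. *)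
Lemma sum_signs_nrm N (V : (nat -> bool) -> L) (H : R -> R) (A : R) :
  (forall e, carrier (V e)) -> measurable_fun D H ->
  (forall x, D x -> \sum_(e <- signs N) Phi (modulus (V e x : K)) <= 2 ^+ N * H x) ->
  (\int[mu]_(x in D) (H x)%:E <= A%:E)%E ->
  \sum_(e <- signs N) nrm (V e) <= 2 ^+ N * (1 + A).
Proof.
move=> cV mH hH hA; rewrite -lee_fin -sumEFin.
have mV e := measurable_modulus (carrier_measurable (cV e)).
have mPV e := measurable_young yP (mV e).
have p0 : 0 < 2 ^+ N :> R by rewrite exprn_gt0.
have H0 x : D x -> 0 <= H x.
  move=> Dx; rewrite -(pmulr_rge0 _ p0); apply: le_trans (hH x Dx).
  by apply: sumr_ge0 => e _; exact: (young_ge0 yP).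
apply: (@le_trans _ _ (\sum_(e <- signs N) (1 + modular Phi (fun x => modulus (V e x : K))))%E).
  by apply: lee_sum => e _; exact: nrm_le_modular.
rewrite big_split/= mulrDr EFinD; apply: leeD.
  by rewrite (eq_bigr (fun=> (1:R)%:E))// sumEFin sum_signs_const.
have -> : (\sum_(e <- signs N) modular Phi (fun x => modulus (V e x : K)) =
    \int[mu]_(x in D) (\sum_(e <- signs N) 1 * Phi (modulus (V e x : K)))%:E)%E.
  rewrite integral_sum_unit//; first by apply: eq_bigr => e _; rewrite mul1e.
  by move=> e x; exact: (young_ge0 yP).
apply: (@le_trans _ _ (\int[mu]_(x in D) (2 ^+ N * H x)%:E)%E).
  apply: le_integral_unit.
  - by move=> x _; apply: sumr_ge0 => e _; rewrite mul1r (young_ge0 yP).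
  - apply: measurable_sum => e; apply: measurable_funM => //; exact: measurable_cst.
  - by apply: measurable_funM => //; exact: measurable_cst.
  - by move=> x Dx; under eq_bigr do rewrite mul1r; exact: hH.
under eq_integral do rewrite EFinM.
rewrite ge0_integralZl_EFin ?(ltW p0)//.
- by rewrite EFinM lee_wpmul2l// lee_fin ltW.
- exact/measurable_EFinP.
Qed.

Lemma L_sumE N (c : nat -> K) (y : nat -> L) x :
  (\sum_(i < N) c i *: y i) x = \sum_(i < N) c i * (y i x : K) :> K.
Proof. by rewrite fct_sumE. Qed.

Lemma L_signed_sumE N (e : nat -> bool) (a : nat -> K) (y : nat -> L) x :
  (\sum_(i < N) ((-1) ^+ e i * a i) *: y i) x =
  signed_sumK (fun i => a i * (y i x : K)) N e :> K.
Proof.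
rewrite (L_sumE _ (fun i => (-1) ^+ e i * a i)).
by apply: eq_bigr => i _; rewrite mulrA.
Qed.

Definition bounded_part (M : R) (f : R -> K^o) : set R :=
  D `&` [set x | modulus (f x : K) <= M].

Lemma measurable_bounded_part M f : measurable_scalar D f ->
  measurable (bounded_part M f).
Proof.
move=> mf; have := measurable_modulus mf.
move=> /(_ (measurable_unit_itv) `]-oo, M]%classic (measurable_itv _)).
by congr measurable; apply/seteqP; split => x /=; rewrite in_itv.
Qed.

Lemma carrier_cutoff (A : set R) (f : L) : measurable A -> carrier f ->
  carrier (cutoff A f : L) /\ nrm (cutoff A f : L) <= nrm f.
Proof.
move=> mA cf; have mf := carrier_measurable cf.
have := @nrm_dominated _ _ _ oF (cutoff A f) f 1 (measurable_cutoff mA mf) cf ler01.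
rewrite mul1r; apply => x _; rewrite mul1r /cutoff.
by case: (x \in A) => //; rewrite modulus0 modulus_ge0.
Qed.

End modular_sums.

Section quadratic_homogeneity.
Set Implicit Arguments.
Unset Strict Implicit.
Context {R : realType} {k : scalar_kind}.
Local Notation K := (Defs.scalar R k).
Context {X : nspace R K}.
Hypothesis sX : seminormed X.
Variable y : nat -> X.
Hypothesis cy : forall i, carrier (y i).

Let l2 (a : nat -> K) N := \sum_(i < N) modulus (a i) ^+ 2.

Lemma modulus_scalar_of (r : R) : modulus (scalar_of k r 0) = `|r|.
Proof.
by rewrite modulusE scalar_re_of scalar_im_of// expr0n addr0 sqrtr_sqr.
Qed.

Let l2_ge0 a N : 0 <= l2 a N.
Proof. by apply: sumr_ge0 => i _; exact: sqr_ge0. Qed.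

Let rescale a N : 0 < l2 a N -> exists b : nat -> K,
  [/\ l2 b N = 1 & nrm (partial_sum y a N) =
    Num.sqrt (l2 a N) * nrm (partial_sum y b N)].
Proof.
move=> q0; set q := Num.sqrt (l2 a N).
have qp : 0 < q by rewrite sqrtr_gt0.
pose c : K := scalar_of k q^-1 0.
have mc : modulus c = q^-1 by rewrite modulus_scalar_of ger0_norm// invr_ge0 ltW.
exists (fun i => c * a i); split.
  rewrite /l2 (eq_bigr (fun i : 'I_N => q^-1 ^+ 2 * modulus (a i) ^+ 2)); last first.
    by move=> i _; rewrite modulusM mc exprMn.
  by rewrite -mulr_sumr exprVn sqr_sqrtr// mulVf// gt_eqF.
have -> : partial_sum y (fun i => c * a i) N = c *: partial_sum y a N.
  by rewrite /partial_sum scaler_sumr; apply: eq_bigr => i _; rewrite scalerA.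
rewrite (nrmZ sX) ?mc ?mulrA ?divff ?mul1r ?gt_eqF//.
exact: carrier_partial_sum.
Qed.

(** By homogeneity, comparison with the Hilbert norm may be checked on
    coefficients of quadratic sum 1. *)
Lemma quadratic_upper (M : R) :
  (forall a N, l2 a N <= 1 -> nrm (partial_sum y a N) <= M) ->
  forall a N, nrm (partial_sum y a N) <= M * Num.sqrt (l2 a N).
Proof.
move=> h a N; have := l2_ge0 a N; rewrite le_eqVlt => /orP[/eqP q0|q0].
  have a0 (i : 'I_N) : a i = 0.
    apply: modulus_eq0; apply/eqP; rewrite -sqrf_eq0 eq_le sqr_ge0 andbT.
    rewrite q0 /l2 (bigD1 i)//= lerDl; apply: sumr_ge0 => j _; exact: sqr_ge0.
  rewrite -q0 sqrtr0 mulr0 /partial_sum big1 ?(nrm0 sX)// => i _.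
  by rewrite a0 scale0r.
have [b [b1 ->]] := rescale q0.
by rewrite mulrC ler_wpM2r ?sqrtr_ge0// h// b1.
Qed.

Lemma quadratic_lower (r : R) : 0 < r ->
  (forall a N, l2 a N = 1 -> r <= nrm (partial_sum y a N)) ->
  forall a N, Num.sqrt (l2 a N) <= r^-1 * nrm (partial_sum y a N).
Proof.
move=> r0 h a N; have n0 : 0 <= nrm (partial_sum y a N).
  by apply: (nrm_ge0 sX); exact: carrier_partial_sum.
have := l2_ge0 a N; rewrite le_eqVlt => /orP[/eqP q0|q0].
  by rewrite -q0 sqrtr0 mulr_ge0// invr_ge0 ltW.
have [b [b1 ->]] := rescale q0.
by rewrite mulrCA ler_peMr ?sqrtr_ge0// mulrC ler_pdivlMr// mul1r h.
Qed.

End quadratic_homogeneity.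

(** * Sequences carried by bounded parts are Hilbertian *)
Section hilbertian.
Set Implicit Arguments.
Unset Strict Implicit.
Context {R : realType} {k : scalar_kind}.
Local Notation K := (Defs.scalar R k).
Local Notation D := (`[0, 1[%classic : set R).
Local Notation mu := (@lebesgue_measure R).
Variable F : R -> \bar R.
Hypothesis oF : finite_orlicz F.
Local Notation Phi := (real_form F).
Local Notation L := (L_ k F).

Let yP : young Phi := young_real_form oF.
Let sL : seminormed L := L_seminormed oF.
Let P0 := young_ge0 yP.

Variables (y : nat -> L) (psi : nat -> L -> K) (C b B M : R).
Hypothesis uy : usystem y psi C.
Hypothesis b0 : 0 < b.
Hypothesis yb : forall i, b <= nrm (y i) <= B.
Let g i : L := cutoff (bounded_part M (y i)) (y i).
Hypothesis hM : forall i, 2^-1 <= modulus (psi i (g i)).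
Hypothesis P1 : 0 < Phi 1.

Let cy := usys_carrier uy.
Let C0 := usys_gt0 uy.
Let my i : measurable_scalar D (y i) := carrier_measurable (cy i).
Let mmy i := measurable_modulus (my i).

Let l2 (a : nat -> K) N := \sum_(i < N) modulus (a i) ^+ 2.
Let V (a : nat -> K) N (e : nat -> bool) : L := \sum_(i < N) ((-1) ^+ e i * a i) *: y i.

Let cg i : carrier (g i).
Proof. by case: (carrier_cutoff oF (measurable_bounded_part M (my i)) (cy i)). Qed.

Let cV a N e : carrier (V a N e).
Proof. by apply: (carrier_sum sL) => i; exact: (carrierZ sL). Qed.

Let M0 : 0 <= M.
Proof.
rewrite leNgt; apply/negP => Mlt; have := hM 0.
have -> : g 0%N = 0.
  apply/funext => x; rewrite /g /cutoff; case: ifPn => // /set_mem[_ /= h].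
  by have := le_lt_trans h Mlt; rewrite ltNge modulus_ge0.
by rewrite (usys0 sL uy) modulus0 leNgt invr_gt0 ltr0n.
Qed.

Let g_le i x : modulus (g i x : K) <= M.
Proof.
rewrite /g /cutoff; case: ifPn => [/set_mem[_]//|_].
by rewrite modulus0.
Qed.

Let V_nrm a N e t : 2 * C * nrm (partial_sum y a N) < t ->
  (modular Phi (fun x => (modulus (V a N e x : K) / t)%R) <= 1)%E.
Proof.
move=> h; apply: (nrm_lt_modular oF (cV a N e)); apply: le_lt_trans h.
exact: (usys_unconditional sL uy).
Qed.

Let sum_average N (f : (nat -> bool) -> \bar R) :
  (forall e, (f e <= 1)%E) -> (\sum_(e <- signs N) f e <= (2 ^+ N)%:E)%E.
Proof.
move=> f1; apply: (@le_trans _ _ (\sum_(e <- signs N) (1 : R)%:E)%E).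
  exact: lee_sum.
by rewrite sumEFin sum_signs_const mulr1.
Qed.

Let average_le N (l : nat -> R) (m : nat -> \bar R) (W W' : R) :
  (forall i, 0 <= l i) -> \sum_(i < N) l i = 1 ->
  (\sum_(i < N) (l i)%:E * m i <= W%:E)%E -> (forall i, (W'%:E <= m i)%E) ->
  W' <= W.
Proof.
move=> l0 l1 hW hm; rewrite -lee_fin; apply: le_trans hW.
apply: (@le_trans _ _ (\sum_(i < N) (l i)%:E * W'%:E)%E).
  by under eq_bigr do rewrite -EFinM; rewrite sumEFin -mulr_suml l1 mul1r.
by apply: lee_sum => i _; rewrite lee_wpmul2l// lee_fin.
Qed.

Section concave.
Variable C2 : R.
Hypothesis hC2 : two_concave Phi C2.

Let C2_ge1 : 1 <= C2. Proof. exact: (two_concave_ge0 hC2). Qed.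

(** The bounded parts g_i retain half of the coordinates of y_i, so by the
    diagonal inequality it suffices to bound random sums of the a_i g_i; their
    mean square is bounded pointwise and F grows at most quadratically. *)
Let concave_upper : exists2 c : R, 0 < c & forall a N,
  nrm (partial_sum y a N) <= c * Num.sqrt (l2 a N).
Proof.
pose A := Phi 1 * C2 * (1 + 4 * M ^+ 2).
have A0 : 0 <= A by rewrite !mulr_ge0 ?addr_ge0 ?mulr_ge0 ?sqr_ge0 ?(ltW P1)// (le_trans _ C2_ge1).
have hP (t : R) : 0 <= t -> Phi t <= Phi 1 * C2 * (1 + t ^+ 2).
  move=> t0; have PC : Phi 1 <= Phi 1 * C2 by rewrite ler_peMr// ltW.
  have PC0 : 0 <= Phi 1 * C2 * t ^+ 2 by rewrite mulr_ge0 ?sqr_ge0// (le_trans _ PC)// ltW.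
  have q0 : 0 <= Phi 1 * C2 by rewrite (le_trans _ PC)// ltW.
  rewrite mulrDr mulr1.
  have [t1|/ltW t1] := leP t 1.
    by apply: le_trans (le_young yP t1) _; apply: le_trans PC _; rewrite lerDl.
  have := hC2 (lexx 1) t1; rewrite expr1n mulr1 (mulrC C2) => /le_trans; apply.
  by rewrite lerDr.
exists (2 * C * (1 + A)); first by rewrite !mulr_gt0// ltr_wpDr.
apply: (quadratic_upper sL cy) => a N a1.
pose d i := psi i (g i).
have d0 i : d i != 0.
  by apply: contraTneq (hM i) => di; rewrite -/(d i) di modulus0 -ltNge invr_gt0 ltr0n.
pose g' i : L := (d i)^-1 *: g i.
have cg' i : carrier (g' i) by exact: (carrierZ sL).
have pg' i : psi i (g' i) = 1.
  by rewrite /g' (usysZ sL uy)// -/(d i) mulVf.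
have g'_le i x : modulus (g' i x : K) <= 2 * M.
  rewrite -[g' i x]/((d i)^-1 * (g i x : K)) modulusM modulusV.
  rewrite ler_pM ?invr_ge0 ?modulus_ge0//.
  by rewrite -[leRHS]invrK lef_pV2 ?posrE ?invr_gt0 ?ltr0n ?modulus_gt0//; exact: hM.
have -> : partial_sum y a N = \sum_(i < N) (a i * psi i (g' i)) *: y i.
  by apply: eq_bigr => i _; rewrite pg' mulr1.
apply: (tong_diagonal sL uy cg').
apply: (@sum_signs_nrm _ _ _ oF N _ (fun=> A)).
- by move=> e; apply: (carrier_sum sL) => i; exact: (carrierZ sL).
- exact: measurable_cst.
- move=> x Dx; apply: (@le_trans _ _ (\sum_(e <- signs N) Phi 1 * C2 *
      (1 + modulus (signed_sumK (fun i => a i * (g' i x : K)) N e) ^+ 2))).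
    by apply: ler_sum => e _; rewrite L_signed_sumE; apply: hP; exact: modulus_ge0.
  rewrite -mulr_sumr big_split/= sum_signs_const sum_signed_sqrK -mulrDr mulrCA.
  rewrite ler_wpM2l ?exprn_ge0// /A ler_wpM2l//; first by rewrite mulr_ge0 ?ltW// (lt_le_trans _ C2_ge1).
  rewrite lerD2l; apply: (@le_trans _ _ (\sum_(i < N) 4 * M ^+ 2 * modulus (a i) ^+ 2)).
    apply: ler_sum => i _; rewrite modulusM exprMn mulrC ler_wpM2r ?sqr_ge0//.
    have -> : 4 * M ^+ 2 = (2 * M) ^+ 2 by rewrite exprMn; ring.
    by rewrite lerXn2r ?nnegrE ?modulus_ge0// mulr_ge0.
  rewrite -mulr_sumr ler_piMr// mulr_ge0 ?sqr_ge0//.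
- by rewrite (integral_cst _ _ A%:E)//= mu_unit_itv mule1.
Qed.

(** Pointwise, the average of F over random signs is at least F of the quadratic
    mean of the |y_i| with weights |a_i|^2, which dominates the weighted average of
    the F (|y_i|) up to constants; that average cannot be small in the mean because
    the y_i have norm at least b. *)
Let concave_lower : exists2 c : R, 0 < c & forall a N,
  Num.sqrt (l2 a N) <= c * nrm (partial_sum y a N).
Proof.
pose W := (1 + C2) * (Phi 1 + 1) + 1.
have W1 : 1 <= W by rewrite lerDr mulr_ge0// addr_ge0// ?(ltW P1)// (le_trans _ C2_ge1).
have W0 : 0 < W by exact: lt_le_trans W1.
pose r := b * (5 / 18) / (W * (2 * C)).
have r0 : 0 < r by rewrite !divr_gt0 ?mulr_gt0.
exists r^-1; first by rewrite invr_gt0.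
apply: (quadratic_lower sL cy r0) => a N a1.
set n := nrm _.
have n0 : 0 <= n by apply: (nrm_ge0 sL); exact: carrier_partial_sum.
suff : b * (5 / 18) <= W * (2 * C * n).
  by rewrite /r ler_pdivrMr ?mulr_gt0//; lra.
apply/ler_addgt0Pr => eps eps0.
pose t := 2 * C * n + eps / W.
have tn : 2 * C * n < t by rewrite ltrDl divr_gt0.
have t0 : 0 < t by apply: le_lt_trans tn; rewrite mulr_ge0// mulr_ge0// ltW.
have -> : W * (2 * C * n) + eps = W * t by rewrite /t; field; rewrite gt_eqF.
pose kap := 5 / 18 / t.
have k0 : 0 < kap by rewrite !divr_gt0.
rewrite -ler_pdivrMr//; have -> : b * (5 / 18) / t = b * kap by rewrite /kap; field; rewrite gt_eqF.
pose l i := modulus (a i) ^+ 2.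
have l0 i : 0 <= l i by exact: sqr_ge0.
pose u i x := kap * modulus (y i x : K).
have u0 i x : 0 <= u i x by rewrite mulr_ge0 ?modulus_ge0// ltW.
have mu_ i : measurable_fun D (u i).
  by apply: measurable_funM; [exact: measurable_cst|exact: mmy].
pose Q x := Num.sqrt (\sum_(i < N) l i * u i x ^+ 2).
have mQ : measurable_fun D Q.
  apply: (@measurableT_comp _ _ _ _ _ _ (@Num.sqrt R)).
    by apply: nondecreasing_measurable => // s s'; exact: ler_wsqrtr.
  apply: measurable_sum => i; apply: measurable_funM; first exact: measurable_cst.
  by apply: measurable_funX; exact: mu_.
have QE x : Q x = 5 / 18 * Num.sqrt (\sum_(i < N) modulus (a i * (y i x : K)) ^+ 2) / t.
  rewrite /Q (eq_bigr (fun i : 'I_N => kap ^+ 2 * modulus (a i * (y i x : K)) ^+ 2)); last first.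
    by move=> i _; rewrite /l /u modulusM !exprMn; ring.
  rewrite -mulr_sumr sqrtrM ?sqr_ge0// sqrtr_sqr ger0_norm ?ltW// /kap mulrAC//.
have hQ : (\int[mu]_(x in D) (Phi (Q x))%:E <= 1)%E.
  have p0 : 0 < 2 ^+ N :> R by rewrite exprn_gt0.
  have hV e := V_nrm e tn.
  have h1 := sum_average N hV.
  rewrite -(@lee_pmul2l _ (2 ^+ N)%:E)// ?lte_fin// mule1; apply: le_trans h1.
  rewrite -ge0_integralZl_EFin ?(ltW p0)//; last 2 first.
  - by move=> x _; rewrite lee_fin P0.
  - exact: (measurable_youngE yP).
  have -> : (\sum_(e <- signs N) modular Phi (fun x => (modulus (V a N e x : K) / t)%R) =
     \int[mu]_(x in D) (\sum_(e <- signs N) 1 * Phi (modulus (V a N e x : K) / t))%:E)%E.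
    rewrite integral_sum_unit//; first by apply: eq_bigr => e _; rewrite mul1e.
    move=> e; apply: (measurable_young yP); apply: measurable_modulus_div.
    exact: carrier_measurable.
  apply: le_integral_unit.
  - by move=> x _; rewrite mulr_ge0 ?(ltW p0)//; exact: P0.
  - apply: measurable_funM; [exact: measurable_cst|exact: (measurable_young yP)].
  - apply: measurable_sum => e; apply: measurable_funM; first exact: measurable_cst.
    apply: (measurable_young yP); apply: measurable_modulus_div.
    exact: carrier_measurable.
  - move=> x Dx; under eq_bigr do rewrite mul1r.
    apply: le_trans (young_jensen yP _ _); rewrite ler_wpM2l ?(ltW p0)//.
    apply: (le_young yP); rewrite ler_pdivlMl// -mulr_suml QE !mulrA.
    rewrite ler_wpM2r ?invr_ge0 ?(ltW t0)//.
    rewrite [in leRHS](eq_bigr (fun e => modulus (signed_sumK (fun i => a i * (y i x : K)) N e))); last first.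
      by move=> e _; rewrite /V L_signed_sumE.
    have := khinchin_lowerK (fun i => a i * (y i x : K)) N; lra.
have key : (\sum_(i < N) (l i)%:E * \int[mu]_(x in D) (Phi (u i x))%:E <= ((1 + C2) * (Phi 1 + 1))%:E)%E.
  rewrite -(@integral_sum_unit _ _ _ (fun (i : 'I_N) x => Phi (u i x)) (fun i => l i))//; last first.
    by move=> i; exact: (measurable_young yP).
  have C20 : 0 <= 1 + C2 by rewrite addr_ge0// (le_trans _ C2_ge1).
  apply: (@le_trans _ _ (\int[mu]_(x in D) ((1 + C2) * Phi 1 + (1 + C2) * Phi (Q x))%:E)%E).
    apply: le_integral_unit.
    - by move=> x _; apply: sumr_ge0 => i _; rewrite mulr_ge0.
    - apply: measurable_sum => i; apply: measurable_funM; first exact: measurable_cst.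
      exact: (measurable_young yP).
    - apply: measurable_funD; first exact: measurable_cst.
      by apply: measurable_funM; [exact: measurable_cst|exact: (measurable_young yP)].
    - move=> x _; rewrite -mulrDr; apply: (two_concave_mean yP (l := l) (u := fun i => u i x) hC2) => //.
      by rewrite (le_trans _ C2_ge1).
  rewrite integral_affine_unit//; last 2 first.
  - by rewrite mulr_ge0.
  - exact: (measurable_young yP).
  rewrite [leRHS](_ : _ = ((1 + C2) * Phi 1)%:E + (1 + C2)%:E * 1)%E; last first.
    by rewrite mule1 -EFinD mulrDr mulr1.
  apply: leeD2l.
  by apply: lee_wpmul2l => //; rewrite lee_fin.
have [i hi] : exists i, ((\int[mu]_(x in D) (Phi (u i x))%:E) <= W%:E)%E.
  apply: contrapT => /forallNP h.
  have ih i : (W%:E <= \int[mu]_(x in D) (Phi (u i x))%:E)%E.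
    by apply/ltW; rewrite ltNge; apply/negP; exact: h.
  have := average_le l0 a1 key ih.
  by rewrite /W gerDl ler10.
have /andP[bi _] := yb i.
apply: (@le_trans _ _ (nrm (y i) * kap)); first by rewrite ler_wpM2r// ltW.
rewrite -ler_pdivlMr//; apply: (modular_nrm_le oF (my i) _ _).2; first exact: divr_gt0.
have -> : (fun x => (modulus (y i x : K) / (W / kap))%R) = (fun x => (u i x / W)%R).
  by apply/funext => x; rewrite /u invf_div mulrCA mulrA.
exact: (modular_le1 yP).
Qed.

Lemma concave_hilbertian : exists2 c : R, 0 < c & forall a N,
  nrm (partial_sum y a N) <= c * Num.sqrt (l2 a N) /\
  Num.sqrt (l2 a N) <= c * nrm (partial_sum y a N).
Proof.
have [c1 c10 h1] := concave_upper; have [c2 c20 h2] := concave_lower.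
exists (c1 + c2) => [|a N]; first exact: addr_gt0.
have n0 : 0 <= nrm (partial_sum y a N) by apply: (nrm_ge0 sL); exact: carrier_partial_sum.
split; [apply: le_trans (h1 a N) _|apply: le_trans (h2 a N) _].
  by rewrite ler_wpM2r ?sqrtr_ge0// lerDl ltW.
by rewrite ler_wpM2r// lerDr ltW.
Qed.

End concave.
Section convex.
Variables C1 Cd : R.
Hypothesis hC1 : two_convex Phi C1.
Hypothesis hCd : doubling Phi Cd.

Let C1_ge1 : 1 <= C1.
Proof.
have := hC1 (lexx 1) (lexx 1).
by rewrite expr1n !mulr1 -[leLHS]mul1r ler_pM2r.
Qed.

Let C1_ge0 : 0 <= C1. Proof. exact: le_trans C1_ge1. Qed.

Let Cd_ge0 : 0 <= Cd.
Proof.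
have := hCd (lexx 1); rewrite mulr1 => h.
have h12 : (1 : R) <= 2 by rewrite ler1n.
have : Phi 1 <= Cd * Phi 1 by rewrite (le_trans (le_young yP h12)).
by rewrite -[leLHS]mul1r ler_pM2r// => /(le_trans ler01).
Qed.

(** The bounded part of y_i keeps its norm bounded below, and on bounded
    functions the Orlicz norm is controlled by the L_2 norm. *)
Let square_mass : exists2 d : R, 0 < d &
  forall i, (d%:E <= \int[mu]_(x in D) (modulus (y i x : K) ^+ 2)%:E)%E.
Proof.
pose s := b / (4 * C); have s0 : 0 < s by rewrite divr_gt0// mulr_gt0.
pose l := (2 * (1 + Phi 1))^-1.
have p1 : 0 < 1 + Phi 1 by rewrite addr_gt0.
have l0 : 0 < l by rewrite invr_gt0 mulr_gt0.
have l1 : l <= 1 by rewrite invf_le1 ?mulr_gt0//; have := P0 1; lra.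
have lP : Phi l <= 2^-1.
  have l01 : 0 <= l <= 1 by rewrite (ltW l0).
  have := young_scale yP 1 l01; rewrite mulr1 => /le_trans; apply.
  by rewrite /l invfM -mulrA ger_pMr ?invr_gt0// mulrC ler_pdivrMr// mul1r lerDr.
pose T := (1 + Phi (M / s)) / (s * l) ^+ 2.
have pM : 0 < 1 + Phi (M / s) by rewrite ltr_wpDr// P0.
have e20 : 0 < (s * l) ^+ 2 by rewrite exprn_gt0// mulr_gt0.
have T0 : 0 < T by rewrite divr_gt0.
have pt i x : Phi (modulus (g i x : K) / s) <= 2^-1 + T * modulus (y i x : K) ^+ 2.
  have gy : modulus (g i x : K) <= modulus (y i x : K).
    by rewrite /g /cutoff; case: ifP => _ //; rewrite modulus0 modulus_ge0.
  have h1 : 0 <= T * modulus (y i x : K) ^+ 2 by rewrite mulr_ge0 ?sqr_ge0// ltW.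
  have [h|h] := leP (modulus (g i x : K)) (s * l).
    apply: (@le_trans _ _ (Phi l)); last by rewrite (le_trans lP)// lerDl.
    by apply: (le_young yP); rewrite ler_pdivrMr// mulrC.
  apply: (@le_trans _ _ (Phi (M / s))).
    by apply: (le_young yP); rewrite ler_wpM2r ?invr_ge0 ?(ltW s0)// g_le.
  apply: (@le_trans _ _ (T * modulus (y i x : K) ^+ 2)); last by rewrite lerDr invr_ge0.
  rewrite /T mulrAC ler_pdivlMr//; apply: (@le_trans _ _ ((1 + Phi (M / s)) * (s * l) ^+ 2)).
    by rewrite ler_wpM2r ?(ltW e20)// lerDr.
  apply: ler_wpM2l; first exact: ltW.
  by apply: lerXn2r (ltW (lt_le_trans h gy)); rewrite nnegrE ?modulus_ge0// ltW// mulr_gt0.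
exists (2 * T)^-1; first by rewrite invr_gt0 mulr_gt0.
move=> i; rewrite leNgt; apply/negP => hI.
have hs : nrm (g i) <= s.
  apply: (modular_nrm_le oF (carrier_measurable (cg i)) s0 _).2.
  apply: (@le_trans _ _ (\int[mu]_(x in D) (2^-1 + T * modulus (y i x : K) ^+ 2)%:E)%E).
    apply: le_integral_unit => //.
    - apply: (measurable_young yP); apply: measurable_modulus_div.
      exact: carrier_measurable.
    - apply: measurable_funD; first exact: measurable_cst.
      apply: measurable_funM; first exact: measurable_cst.
      by apply: measurable_funX; exact: mmy.
  rewrite integral_affine_unit ?(ltW T0)//; last first.
  - by apply: measurable_funX; exact: mmy.
  - by move=> x; exact: sqr_ge0.
  have h2 : (T%:E * \int[mu]_(x in D) (modulus (y i x : K) ^+ 2)%:E <= T%:E * (2 * T)^-1%:E)%E.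
    by apply: lee_wpmul2l; [rewrite lee_fin ltW|exact: ltW].
  apply: (@le_trans _ _ ((2^-1)%:E + T%:E * (2 * T)^-1%:E)%E); first exact: leeD2l.
  by rewrite -EFinM -EFinD lee_fin le_eqVlt; apply/orP; left; apply/eqP; field; rewrite gt_eqF.
have := usys_functional sL uy i (cg i); have /andP[bi _] := yb i.
have h3 : 2^-1 * b <= modulus (psi i (g i)) * nrm (y i).
  by rewrite ler_pM ?hM// ltW.
have h4 : C * nrm (g i) <= C * s by rewrite ler_wpM2l// ltW.
have Cs : C * s = b / 4 by rewrite /s; field; rewrite gt_eqF.
rewrite Cs in h4.
move=> h5; have := le_trans h3 (le_trans h5 h4).
rewrite mulrC leNgt ltr_pM2l ?ltf_pV2 ?posrE// ?ltr_nat//.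
Qed.

(** F grows at least quadratically, hence the norm dominates the L_2 norm; random
    signs make the a_i y_i orthogonal on average. *)
Let convex_lower : exists2 c : R, 0 < c & forall a N,
  Num.sqrt (l2 a N) <= c * nrm (partial_sum y a N).
Proof.
have [d d0 hd] := square_mass.
pose A := 1 + C1 / Phi 1.
have A0 : 0 < A by rewrite ltr_wpDr// divr_ge0// ltW.
have hA (u : R) : 0 <= u -> u ^+ 2 <= A * (1 + Phi u).
  move=> u0; have c0 : 0 <= C1 / Phi 1 by rewrite divr_ge0// ltW.
  have Pu := P0 u; have cP : 0 <= C1 / Phi 1 * Phi u by rewrite mulr_ge0.
  rewrite /A mulrDr mulr1 mulrDl mul1r.
  have [u1|/ltW u1] := leP u 1.
    have : u ^+ 2 <= 1 by rewrite expr_le1.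
    lra.
  have := hC1 (lexx 1) u1; rewrite expr1n mulr1 => h.
  have : u ^+ 2 <= C1 / Phi 1 * Phi u.
    by rewrite mulrAC ler_pdivlMr// mulrC.
  lra.
pose r := Num.sqrt (d / (16 * A * C ^+ 2)).
have q0 : 0 < d / (16 * A * C ^+ 2) by rewrite divr_gt0// !mulr_gt0.
have r0 : 0 < r by rewrite sqrtr_gt0.
have r2 : r ^+ 2 = d / (16 * A * C ^+ 2) by rewrite sqr_sqrtr// ltW.
exists r^-1; first by rewrite invr_gt0.
apply: (quadratic_lower sL cy r0) => a N a1; rewrite leNgt; apply/negP => nr.
pose t := 2 * C * r; have t0 : 0 < t by rewrite !mulr_gt0.
have tn : 2 * C * nrm (partial_sum y a N) < t by rewrite ltr_pM2l// mulr_gt0.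
pose l i := modulus (a i) ^+ 2.
have l0 i : 0 <= l i by exact: sqr_ge0.
pose f i x := modulus (y i x : K) ^+ 2.
have mf i : measurable_fun D (f i) by apply: measurable_funX; exact: mmy.
pose c := t ^+ 2 * A; have c0 : 0 < c by rewrite mulr_gt0// exprn_gt0.
have p0 : 0 < 2 ^+ N :> R by rewrite exprn_gt0.
pose dd := c / 2 ^+ N; have dd0 : 0 <= dd by rewrite divr_ge0 ?ltW.
pose Pe e x := Phi (modulus (V a N e x : K) / t).
have mPe e : measurable_fun D (Pe e).
  apply: (measurable_young yP); apply: measurable_modulus_div.
  exact: carrier_measurable.
have hmain : (\sum_(i < N) (l i)%:E * \int[mu]_(x in D) (f i x)%:E <= (2 * c)%:E)%E.
  rewrite -(@integral_sum_unit _ _ _ (fun (i : 'I_N) x => f i x) (fun i => l i))//; last first.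
    by move=> i x; exact: sqr_ge0.
  apply: (@le_trans _ _ (\int[mu]_(x in D) (c + 1 * \sum_(e <- signs N) dd * Pe e x)%:E)%E).
    apply: le_integral_unit.
    - by move=> x _; apply: sumr_ge0 => i _; rewrite mulr_ge0 ?sqr_ge0.
    - by apply: measurable_sum => i; apply: measurable_funM => //; exact: measurable_cst.
    - apply: measurable_funD; first exact: measurable_cst.
      apply: measurable_funM; first exact: measurable_cst.
      by apply: measurable_sum => e; apply: measurable_funM => //; exact: measurable_cst.
    - move=> x _; rewrite mul1r.
      have -> : \sum_(i < N) l i * f i x = (2 ^+ N)^-1 * \sum_(e <- signs N) modulus (V a N e x : K) ^+ 2.
        rewrite (eq_bigr (fun e => modulus (signed_sumK (fun i => a i * (y i x : K)) N e) ^+ 2)); last first.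
          by move=> e _; rewrite /V L_signed_sumE.
        rewrite sum_signed_sqrK mulKf ?gt_eqF//.
        by apply: eq_bigr => i _; rewrite modulusM exprMn.
      rewrite -mulr_sumr ler_pdivrMl// mulrDr.
      have -> : 2 ^+ N * (dd * \sum_(e <- signs N) Pe e x) = c * \sum_(e <- signs N) Pe e x.
        by rewrite /dd; field; rewrite gt_eqF.
      rewrite -sum_signs_const mulr_sumr -big_split/=; apply: ler_sum => e _.
      have := hA _ (divr_ge0 (modulus_ge0 (V a N e x : K)) (ltW t0)).
      rewrite expr_div_n ler_pdivrMr ?exprn_gt0// /c /Pe; lra.
  rewrite integral_affine_unit ?(ltW c0)//; last 2 first.
  - by move=> x; apply: sumr_ge0 => e _; rewrite mulr_ge0//; exact: P0.
  - by apply: measurable_sum => e; apply: measurable_funM => //; exact: measurable_cst.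
  rewrite mul1e (_ : 2 * c = c + c); last by ring.
  rewrite EFinD; apply: leeD2l.
  rewrite integral_sum_unit//; last by move=> e x; exact: P0.
  apply: (@le_trans _ _ (\sum_(e <- signs N) dd%:E * 1)%E).
    apply: lee_sum => e _; apply: lee_wpmul2l; first by rewrite lee_fin.
    exact: V_nrm.
  under eq_bigr do rewrite mule1.
  by rewrite sumEFin sum_signs_const lee_fin /dd mulrC divfK ?gt_eqF.
have := average_le l0 a1 hmain hd.
have -> : 2 * c = d / 2.
  rewrite /c /t !exprMn r2; field; rewrite ?gt_eqF//.
lra.
Qed.

(** The average of F over random signs is at most F of the quadratic mean of the
    |y_i| with weights |a_i|^2 and hence the weighted average of the F (|y_i|), up
    to constants; the diagonal inequality with g = y passes from random signs to
    the sum itself. *)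
Let convex_upper : exists2 c : R, 0 < c & forall a N,
  nrm (partial_sum y a N) <= c * Num.sqrt (l2 a N).
Proof.
have [A A0 hA] := khinchin_upper yP hCd.
have B0 : 0 < B + 1.
  by have /andP[h1 h2] := yb 0; rewrite ltr_wpDl// (le_trans (ltW b0))// (le_trans h1).
pose kap := (B + 1)^-1; have k0 : 0 < kap by rewrite invr_gt0.
pose A' := A * (Phi 2 + Cd * C1 * 1).
have A'0 : 0 <= A' by rewrite !(mulr_ge0, addr_ge0).
pose ck : K := scalar_of k (kap / 2) 0.
have mck : modulus ck = kap / 2 by rewrite modulus_scalar_of ger0_norm// divr_ge0// ltW.
exists (2 * C * (1 + A') / (kap / 2)); first by rewrite divr_gt0 ?divr_gt0// !mulr_gt0// ltr_wpDr.
apply: (quadratic_upper sL cy) => a N a1.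
have cp : carrier (partial_sum y a N) by exact: carrier_partial_sum.
rewrite ler_pdivlMr ?divr_gt0// mulrC -mck -(nrmZ sL)//.
have -> : ck *: partial_sum y a N = \sum_(i < N) (ck * a i * psi i (y i)) *: y i.
  rewrite /partial_sum scaler_sumr; apply: eq_bigr => i _.
  by rewrite (usys_biorth uy) eqxx mulr1 scalerA.
apply: (tong_diagonal sL uy (a := fun i => ck * a i) cy).
pose l i := modulus (a i) ^+ 2.
have l0 i : 0 <= l i by exact: sqr_ge0.
pose u i x := kap * modulus (y i x : K).
have u0 i x : 0 <= u i x by rewrite mulr_ge0 ?modulus_ge0// ltW.
have mu_ i : measurable_fun D (u i).
  by apply: measurable_funM; [exact: measurable_cst|exact: mmy].
have mPu i := measurable_young yP (mu_ i).
have hu i : (\int[mu]_(x in D) (Phi (u i x))%:E <= 1)%E.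
  have /andP[_ h] := yb i.
  have h' : nrm (y i) < B + 1 by rewrite (le_lt_trans h)// ltrDl.
  have := nrm_lt_modular oF (cy i) h'.
  rewrite /modular; under eq_integral do rewrite mulrC.
  by [].
pose H x := A * Phi 2 + A * (Cd * C1) * \sum_(i < N) l i * Phi (u i x).
have mS : measurable_fun D (fun x => \sum_(i < N) l i * Phi (u i x)).
  by apply: measurable_sum => i; apply: measurable_funM => //; exact: measurable_cst.
have AC : 0 <= A * (Cd * C1) by rewrite !mulr_ge0.
have S0 x : 0 <= \sum_(i < N) l i * Phi (u i x).
  by apply: sumr_ge0 => i _; rewrite mulr_ge0.
apply: (@sum_signs_nrm _ _ _ oF N _ H).
- by move=> e; apply: (carrier_sum sL) => i; exact: (carrierZ sL).
- apply: measurable_funD; first exact: measurable_cst.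
  by apply: measurable_funM => //; exact: measurable_cst.
- move=> x Dx; pose z i := ck * a i * (y i x : K).
  pose Q := Num.max 1 (Num.sqrt (\sum_(i < N) l i * u i x ^+ 2)).
  have Q1 : 1 <= Q by rewrite le_max lexx.
  have q20 : 0 <= \sum_(i < N) l i * u i x ^+ 2.
    by apply: sumr_ge0 => i _; rewrite mulr_ge0// sqr_ge0.
  have qQ : \sum_(i < N) l i * u i x ^+ 2 <= Q ^+ 2.
    rewrite -(sqr_sqrtr q20) lerXn2r ?nnegrE ?sqrtr_ge0//; last by rewrite le_max lexx orbT.
    exact: le_trans Q1.
  have hz (s : K -> R) : (forall w, `|s w| <= modulus w) ->
      \sum_(i < N) (2 * s (z i)) ^+ 2 <= Q ^+ 2.
    move=> hs; apply: le_trans qQ; apply: ler_sum => i _.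
    have -> : l i * u i x ^+ 2 = (2 * modulus (z i)) ^+ 2.
      by rewrite /z !modulusM mck /l /u; field.
    rewrite -(real_normK (num_real (2 * s (z i)))).
    apply: lerXn2r; rewrite ?nnegrE ?mulr_ge0 ?modulus_ge0//.
    by rewrite normrM ger0_norm// ler_wpM2l.
  have h1 := hA Q (fun i => 2 * scalar_re (z i)) N Q1 (hz _ (@scalar_re_le R k)).
  have h2 := hA Q (fun i => 2 * scalar_im (z i)) N Q1 (hz _ (@scalar_im_le R k)).
  have h3 := two_convex_mean yP (l := l) (u := fun i => u i x) hC1 C1_ge0 hCd Cd_ge0 l0 (fun i => u0 i x) a1.
  have p0 : 0 <= 2 ^+ N :> R by rewrite exprn_ge0.
  rewrite (eq_bigr (fun e => Phi (modulus (signed_sumK z N e)))); last first.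
    by move=> e _; rewrite (L_signed_sumE N e (fun i => ck * a i)).
  apply: (@le_trans _ _ (2^-1 * \sum_(e <- signs N) Phi `|signed_sum (fun i => 2 * scalar_re (z i)) N e| +
     2^-1 * \sum_(e <- signs N) Phi `|signed_sum (fun i => 2 * scalar_im (z i)) N e|)).
    rewrite !mulr_sumr -big_split/=; apply: ler_sum => e _.
    have h01 : 0 <= (2^-1 : R) <= 1 by rewrite invr_ge0 ler0n invf_le1// ler1n.
    have := young_convex yP `|signed_sum (fun i => 2 * scalar_re (z i)) N e|
      `|signed_sum (fun i => 2 * scalar_im (z i)) N e| h01.
    have -> : 1 - 2^-1 = 2^-1 :> R by field.
    apply: le_trans; apply: (le_young yP).
    apply: le_trans (modulus_le_re_im _) _.
    have sE (s : K -> R) : signed_sum (fun i => 2 * s (z i)) N e = 2 * signed_sum (fun i => s (z i)) N e.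
      by rewrite /signed_sum mulr_sumr; apply: eq_bigr => i _; ring.
    rewrite scalar_re_signed_sum scalar_im_signed_sum !sE !normrM (@ger0_norm _ 2)//.
    by rewrite !mulKf// pnatr_eq0.
  apply: (@le_trans _ _ (2 ^+ N * (A * Phi Q))); first lra.
  rewrite ler_wpM2l//; apply: le_trans (ler_wpM2l A0 h3) _.
  by rewrite /H mulrDr !mulrA.
- rewrite integral_affine_unit//; last by rewrite mulr_ge0.
  rewrite (@integral_sum_unit _ _ _ (fun (i : 'I_N) x => Phi (u i x)) (fun i => l i))//.
  have -> : A' = A * Phi 2 + A * (Cd * C1) by rewrite /A'; ring.
  rewrite EFinD -[X in (_ <= _ + X)%E]mule1; apply: leeD2l.
  apply: lee_wpmul2l; first by rewrite lee_fin.
  apply: (@le_trans _ _ (\sum_(i < N) (l i)%:E * 1)%E).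
    by apply: lee_sum => i _; apply: lee_wpmul2l; [rewrite lee_fin|exact: hu].
  by under eq_bigr do rewrite mule1; rewrite sumEFin lee_fin.
Qed.

Lemma convex_hilbertian : exists2 c : R, 0 < c & forall a N,
  nrm (partial_sum y a N) <= c * Num.sqrt (l2 a N) /\
  Num.sqrt (l2 a N) <= c * nrm (partial_sum y a N).
Proof.
have [c1 c10 h1] := convex_upper; have [c2 c20 h2] := convex_lower.
exists (c1 + c2) => [|a N]; first exact: addr_gt0.
have n0 : 0 <= nrm (partial_sum y a N) by apply: (nrm_ge0 sL); exact: carrier_partial_sum.
split; [apply: le_trans (h1 a N) _|apply: le_trans (h2 a N) _].
  by rewrite ler_wpM2r ?sqrtr_ge0// lerDl ltW.
by rewrite ler_wpM2r// lerDr ltW.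
Qed.

End convex.
End hilbertian.

(** * Sequences carried by disjoint pieces *)
Section scalar_embedding.
Set Implicit Arguments.
Unset Strict Implicit.
Context {R : realType} {k : scalar_kind}.
Local Notation K := (Defs.scalar R k).
Local Notation emb r := (scalar_of k r 0 : K).

Lemma scalar_ofM (r s : R) : emb (r * s) = emb r * emb s.
Proof.
case: k => //; rewrite -[RHS]/(Complex (r * s - 0 * 0) (r * 0 + 0 * s)).
by rewrite !mulr0 mul0r subr0 addr0.
Qed.

Lemma scalar_ofD (r s : R) : emb (r + s) = emb r + emb s.
Proof. by case: k => //; rewrite -[RHS]/(Complex (r + s) (0 + 0)) addr0. Qed.

Lemma scalar_of0 : emb (0 : R) = 0.
Proof. by case: k. Qed.

Lemma scalar_of1 : emb (1 : R) = 1.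
Proof. by case: k. Qed.

Lemma scalar_of_sum I (r : seq I) (f : I -> R) :
  emb (\sum_(i <- r) f i) = \sum_(i <- r) emb (f i).
Proof. exact: (big_morph _ scalar_ofD scalar_of0). Qed.

Lemma polar (z : K) : exists2 th : K, modulus th <= 1 & th * z = emb (modulus z).
Proof.
have [->|z0] := eqVneq z 0.
  by exists 0; rewrite ?modulus0 ?ler01// mul0r scalar_of0.
exists (emb (modulus z) / z); last by rewrite divfK.
by rewrite modulusM modulusV modulus_scalar_of ger0_norm ?modulus_ge0// divff// gt_eqF// modulus_gt0.
Qed.

End scalar_embedding.

Section disjoint_pieces.
Set Implicit Arguments.
Unset Strict Implicit.
Context {R : realType} {k : scalar_kind}.
Local Notation K := (Defs.scalar R k).
Local Notation D := (`[0, 1[%classic : set R).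
Local Notation mu := (@lebesgue_measure R).
Variable F : R -> \bar R.
Hypothesis oF : finite_orlicz F.
Local Notation Phi := (real_form F).
Local Notation L := (L_ k F).

Let yP : young Phi := young_real_form oF.
Let sL : seminormed L := L_seminormed oF.
Let P0 := young_ge0 yP.

Variables (y : nat -> L) (psi : nat -> L -> K) (C : R).
Hypothesis uy : usystem y psi C.
Hypothesis ny : forall i, 0 < nrm (y i).
Variables (E : nat -> nat -> set R) (s : nat -> nat -> R) (J : nat -> nat).
Hypothesis mE : forall i j, measurable (E i j).
Hypothesis ED : forall i j, E i j `<=` D.
Hypothesis disjE : forall x i j i' j', E i j x -> E i' j' x -> i = i' /\ j = j'.
Hypothesis sE : forall i j x, E i j x ->
  s i j < modulus (y i x : K) <= 2 * s i j.

Let cy := usys_carrier uy.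
Let C0 := usys_gt0 uy.

Definition piece_measure i j : R := fine (mu (E i j)).
(** The part of the coordinate psi_i (y_i) that sits on the j-th piece. *)
Definition piece_weight i j : R := modulus (psi i (cutoff (E i j) (y i))).

Let muE i j : mu (E i j) = (piece_measure i j)%:E.
Proof.
rewrite /piece_measure fineK// ge0_fin_numE ?measure_ge0//.
apply: (@le_lt_trans _ _ (mu D)); last by rewrite mu_unit_itv ltry.
apply: le_measure; last exact: ED.
  by rewrite inE; exact: mE.
by rewrite inE; exact: measurable_unit_itv.
Qed.

Lemma piece_measure_ge0 i j : 0 <= piece_measure i j.
Proof. by rewrite /piece_measure fine_ge0// measure_ge0. Qed.

Let simple N (c : nat -> nat -> R) x : R :=
  \sum_(i < N) 1 * \sum_(j < J i) c i j * \1_(E i j) x.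

Let simple_in N c x i j : (i < N)%N -> (j < J i)%N -> E i j x ->
  simple N c x = c i j.
Proof.
move=> iN jJ Ex; rewrite /simple (bigD1 (Ordinal iN))//= mul1r [X in _ + X]big1; last first.
  move=> i' i'i; rewrite big1 ?mulr0// => j' _.
  rewrite indicE memNset ?mulr0// => Ex'; have [h _] := disjE Ex Ex'.
  by move: i'i; rewrite -val_eqE/= h eqxx.
rewrite addr0 (bigD1 (Ordinal jJ))//= indicE mem_set// mulr1 big1 ?addr0// => j' j'j.
rewrite indicE memNset ?mulr0// => Ex'; have [_ h] := disjE Ex Ex'.
by move: j'j; rewrite -val_eqE/= h eqxx.
Qed.

Let simple_out N c x : (forall i j, (i < N)%N -> (j < J i)%N -> ~ E i j x) ->
  simple N c x = 0.
Proof.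
move=> h; rewrite /simple big1// => i _; rewrite big1 ?mulr0// => j _.
by rewrite indicE memNset ?mulr0//; exact: h.
Qed.

Let simple_cases x N : (exists i j, [/\ (i < N)%N, (j < J i)%N & E i j x]) \/
  (forall i j, (i < N)%N -> (j < J i)%N -> ~ E i j x).
Proof.
have [h|h] := pselect (exists i j, [/\ (i < N)%N, (j < J i)%N & E i j x]); [by left|right].
by move=> i j iN jJ Ex; apply: h; exists i, j.
Qed.

Let measurable_simple N c : measurable_fun D (simple N c).
Proof.
apply: measurable_sum => i; apply: measurable_funM; first exact: measurable_cst.
apply: measurable_sum => j; apply: measurable_funM; first exact: measurable_cst.
exact: measurable_indic.
Qed.

Let simple_ge0 N c x : (forall i j, 0 <= c i j) -> 0 <= simple N c x.
Proof.
move=> c0; apply: sumr_ge0 => i _; rewrite mul1r; apply: sumr_ge0 => j _.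
by rewrite mulr_ge0.
Qed.

Let integral_simple N c : (forall i j, 0 <= c i j) ->
  (\int[mu]_(x in D) (simple N c x)%:E =
   (\sum_(i < N) \sum_(j < J i) c i j * piece_measure i j)%:E)%E.
Proof.
move=> c0; rewrite /simple.
rewrite (@integral_sum_unit R 'I_N _ (fun (i : 'I_N) x => \sum_(j < J i) c i j * \1_(E i j) x) (fun=> 1))//; last 2 first.
- by move=> i x; apply: sumr_ge0 => j _; rewrite mulr_ge0.
- move=> i; apply: measurable_sum => j; apply: measurable_funM; first exact: measurable_cst.
  exact: measurable_indic.
rewrite -sumEFin; apply: eq_bigr => i _; rewrite mul1e.
rewrite (@integral_sum_unit R 'I_(J i) _ (fun (j : 'I_(J i)) x => \1_(E i j) x) (fun j => c i j))//; last first.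
- by move=> j; exact: measurable_indic.
rewrite -sumEFin; apply: eq_bigr => j _; rewrite EFinM; congr (_ * _)%E.
rewrite integral_indic//; last exact: mE.
rewrite (setIidl (@ED _ _)); exact: muE.
Qed.

(** On the i-th set, a_i y_i is recovered from the sums with random signs by
    averaging them against the i-th sign. *)
Lemma pieces_lower N (a : nat -> K) t : nrm (partial_sum y a N) < t ->
  \sum_(i < N) \sum_(j < J i)
    Phi (modulus (a i) * s i j / (2 * C * t)) * piece_measure i j <= 1.
Proof.
move=> nt; have n0 : 0 <= nrm (partial_sum y a N).
  by apply: (nrm_ge0 sL); exact: carrier_partial_sum.
have t0 : 0 < t by exact: le_lt_trans nt.
set T := 2 * C * t; have T0 : 0 < T by rewrite !mulr_gt0.
pose V (e : nat -> bool) : L := \sum_(i < N) ((-1) ^+ e i * a i) *: y i.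
have cV e : carrier (V e) by apply: (carrier_sum sL) => i; exact: (carrierZ sL).
have hV e : (modular Phi (fun x => (modulus (V e x : K) / T)%R) <= 1)%E.
  apply: (nrm_lt_modular oF (cV e)); apply: le_lt_trans (usys_unconditional sL uy e N a) _.
  by rewrite ltr_pM2l// mulr_gt0.
pose Pe e x := Phi (modulus (V e x : K) / T).
have mPe e : measurable_fun D (Pe e).
  apply: (measurable_young yP); apply: measurable_modulus_div.
  exact: carrier_measurable.
pose c i j := Phi (modulus (a i) * s i j / T).
have p0 : 0 < 2 ^+ N :> R by rewrite exprn_gt0.
rewrite -lee_fin -(@integral_simple N c); last by move=> i j; exact: P0.
apply: (@le_trans _ _ (\int[mu]_(x in D) (\sum_(e <- signs N) (2 ^+ N)^-1 * Pe e x)%:E)%E); last first.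
  rewrite integral_sum_unit//; last first.
    by move=> e x; exact: P0.
  apply: (@le_trans _ _ (\sum_(e <- signs N) ((2 ^+ N)^-1)%:E * 1)%E).
    apply: lee_sum => e _; apply: lee_wpmul2l; first by rewrite lee_fin invr_ge0 ltW.
    exact: hV.
  under eq_bigr do rewrite mule1.
  by rewrite sumEFin sum_signs_const divff// gt_eqF.
apply: le_integral_unit.
- by move=> x _; apply: simple_ge0 => i j; exact: P0.
- exact: measurable_simple.
- by apply: measurable_sum => e; apply: measurable_funM => //; exact: measurable_cst.
move=> x Dx; have [[i [j [iN jJ Ex]]]|h] := simple_cases x N; last first.
  rewrite simple_out//; apply: sumr_ge0 => e _; rewrite mulr_ge0 ?invr_ge0 ?(ltW p0)//.
  exact: P0.
rewrite (simple_in _ iN jJ Ex) -mulr_sumr ler_pdivlMl//.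
apply: le_trans (young_jensen yP _ _); rewrite ler_wpM2l ?(ltW p0)//.
apply: (le_young yP); rewrite -mulr_suml mulrA ler_wpM2r ?invr_ge0 ?(ltW T0)//.
rewrite ler_pdivlMl//.
apply: (@le_trans _ _ (modulus (2 ^+ N * (a i * (y i x : K)) : K))).
  rewrite !modulusM modulus2X ler_wpM2l ?(ltW p0)// ler_wpM2l ?modulus_ge0//.
  by have /andP[/ltW] := sE Ex.
have -> : 2 ^+ N * (a i * (y i x : K)) = \sum_(e <- signs N) (-1) ^+ e i * (V e x : K).
  under eq_bigr do rewrite /V L_signed_sumE /signed_sumK mulr_sumr.
  rewrite exchange_big/= (bigD1 (Ordinal iN))//= [X in _ + X]big1 ?addr0; last first.
    move=> i' i'i; under eq_bigr do rewrite mulrA.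
    rewrite -mulr_suml sum_signs_orth// ifF ?mul0r//.
    by apply/negbTE; move: i'i; rewrite -val_eqE/= eq_sym.
  by under eq_bigr do rewrite mulrA; rewrite -mulr_suml sum_signs_orth// eqxx.
apply: le_trans (modulus_sum _ _) _.
by apply: ler_sum => e _; rewrite modulus_sign.
Qed.

(** The functions sum_j al_ij th_ij y_i 1_(E_ij), where the factor th_ij of modulus
    at most 1 makes psi_i positive on the j-th term, have disjoint supports: their
    signed sums all have the same modular, and the diagonal inequality applies. *)
Lemma pieces_upper N (a : nat -> K) (al : nat -> nat -> R) t : 0 < t ->
  (forall i j, 0 <= al i j) ->
  \sum_(i < N) \sum_(j < J i)
    Phi (modulus (a i) * (al i j * (2 * s i j)) / t) * piece_measure i j <= 1 ->
  nrm (\sum_(i < N) (a i * scalar_of k (\sum_(j < J i) al i j * piece_weight i j) 0) *: y i)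
    <= 2 * C * t.
Proof.
move=> t0 al0 hS.
have /choice[th hth] : forall ij : nat * nat, exists th : K, modulus th <= 1 /\
    th * psi ij.1 (cutoff (E ij.1 ij.2) (y ij.1)) = scalar_of k (piece_weight ij.1 ij.2) 0.
  by move=> [i j]; have [th h1 h2] := polar (psi i (cutoff (E i j) (y i))); exists th.
have cc i j : carrier (cutoff (E i j) (y i) : L).
  by case: (carrier_cutoff oF (mE i j) (cy i)).
pose z i j : K := scalar_of k (al i j) 0 * th (i, j).
pose g i : L := \sum_(j < J i) z i j *: (cutoff (E i j) (y i) : L).
have cg i : carrier (g i) by apply: (carrier_sum sL) => j; exact: (carrierZ sL).
have pg i : psi i (g i) = scalar_of k (\sum_(j < J i) al i j * piece_weight i j) 0.
  rewrite /g (usys_sum sL uy); last by move=> j; exact: (carrierZ sL).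
  rewrite scalar_of_sum; apply: eq_bigr => j _; rewrite (usysZ sL uy)//.
  by rewrite /z -mulrA (hth (i, nat_of_ord j)).2 scalar_ofM.
under eq_bigr do rewrite -pg.
apply: (tong_diagonal sL uy cg).
rewrite -sum_signs_const; apply: ler_sum => e _.
set V : L := \sum_(i < N) _.
have cV : carrier V by apply: (carrier_sum sL) => i; exact: (carrierZ sL).
apply: (modular_nrm_le oF (carrier_measurable cV) t0 _).2.
pose c i j := Phi (modulus (a i) * (al i j * (2 * s i j)) / t).
apply: (@le_trans _ _ (\int[mu]_(x in D) (simple N c x)%:E)%E); last first.
  by rewrite integral_simple ?lee_fin// => i j; exact: P0.
apply: le_integral_unit.
- by move=> x _; exact: P0.
- apply: (measurable_young yP); apply: measurable_modulus_div.
  exact: carrier_measurable.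
- exact: measurable_simple.
move=> x Dx.
have VE : V x = \sum_(i < N) (-1) ^+ e i * a i * \sum_(j < J i) z i j * (cutoff (E i j) (y i) x : K) :> K.
  rewrite /V (L_sumE N (fun i => (-1) ^+ e i * a i)); apply: eq_bigr => i _.
  by rewrite /g fct_sumE.
have [[i [j [iN jJ Ex]]]|h] := simple_cases x N; last first.
  rewrite VE big1 ?modulus0 ?mul0r ?(young0 yP)//.
    by apply: simple_ge0 => i j; exact: P0.
  move=> i _; rewrite big1 ?mulr0// => j _.
  by rewrite /cutoff memNset ?mulr0//; exact: h.
rewrite (simple_in _ iN jJ Ex) /c; apply: (le_young yP).
rewrite ler_wpM2r ?invr_ge0 ?(ltW t0)//.
have -> : (V x : K) = (-1) ^+ e i * (a i * (z i j * (y i x : K))).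
  rewrite VE (bigD1 (Ordinal iN))//= [X in _ + X]big1 ?addr0; last first.
    move=> i' i'i; rewrite big1 ?mulr0// => j' _.
    rewrite /cutoff memNset ?mulr0// => Ex'; have [h _] := disjE Ex Ex'.
    by move: i'i; rewrite -val_eqE/= h eqxx.
  rewrite (bigD1 (Ordinal jJ))//= [X in _ + X]big1 ?addr0; last first.
    move=> j' j'j; rewrite /cutoff memNset ?mulr0// => Ex'; have [_ h] := disjE Ex Ex'.
    by move: j'j; rewrite -val_eqE/= h eqxx.
  by rewrite /cutoff mem_set// !mulrA.
rewrite modulus_sign !modulusM ler_wpM2l ?modulus_ge0// -mulrA.
rewrite modulus_scalar_of ger0_norm// ler_wpM2l// -[leRHS]mul1r.
rewrite ler_pM ?modulus_ge0//; first exact: (hth (i, j)).1.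
by have /andP[] := sE Ex.
Qed.

Lemma piece_weight_null i j : piece_measure i j = 0 -> piece_weight i j = 0.
Proof.
move=> m0; have cc : carrier (cutoff (E i j) (y i) : L).
  by case: (carrier_cutoff oF (mE i j) (cy i)).
have n0 : nrm (cutoff (E i j) (y i) : L) = 0.
  apply/eqP; rewrite eq_le (nrm_ge0 sL)// andbT; apply/ler_addgt0Pr => t t0.
  rewrite add0r; apply: (modular_nrm_le oF (carrier_measurable cc) t0 _).2.
  apply: (@le_trans _ _ (\int[mu]_(x in D) (Phi (2 * s i j / t) * \1_(E i j) x)%:E)%E).
    apply: le_integral_unit.
    - by move=> x _; exact: P0.
    - apply: (measurable_young yP); apply: measurable_modulus_div.
      exact: (carrier_measurable cc).
    - by apply: measurable_funM; [exact: measurable_cst|exact: measurable_indic].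
    move=> x _; rewrite /cutoff indicE; case: ifPn => [/set_mem Ex|_].
      rewrite mulr1; apply: (le_young yP); rewrite ler_wpM2r ?invr_ge0 ?(ltW t0)//.
      by have /andP[] := sE Ex.
    by rewrite modulus0 mul0r (young0 yP)// mulr0.
  have -> : (\int[mu]_(x in D) (Phi (2 * s i j / t) * \1_(E i j) x)%:E =
      \int[mu]_(x in D) (0 + Phi (2 * s i j / t) * (\1_(E i j) x : R))%:E)%E.
    by apply: eq_integral => x _; rewrite add0r.
  rewrite integral_affine_unit//.
  rewrite add0e integral_indic//; last exact: mE.
  by rewrite (setIidl (@ED _ _)) [X in (_ * X)%E](muE i j) m0 mule0 lee01.
have := usys_functional sL uy i cc; rewrite n0 mulr0.
by move=> h; apply/eqP; rewrite eq_le modulus_ge0 andbT -(ler_pM2r (ny i)) mul0r.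
Qed.

End disjoint_pieces.

(** * Mixtures of rescaled Orlicz functions and their limits *)
Section mixtures.
Set Implicit Arguments.
Unset Strict Implicit.
Context {R : realType}.

Definition mixture (Phi : R -> R) n (m s : nat -> R) (t : R) : R :=
  \sum_(j < n) m j * Phi (s j * t).

Variable Phi : R -> R.
Hypothesis yP : young Phi.
Variables (n : nat) (m s : nat -> R).
Hypotheses (m0 : forall j, 0 <= m j) (s0 : forall j, 0 <= s j).

Lemma young_mixture : (exists2 t, 0 < t & 0 < mixture Phi n m s t) ->
  young (mixture Phi n m s).
Proof.
move=> ne0; split => //.
- move=> t t0; rewrite /mixture big1// => j _.
  by rewrite (young0 yP) ?mulr0// mulr_ge0_le0.
- move=> u v uv; apply: ler_sum => j _; rewrite ler_wpM2l//.
  by apply: (le_young yP); rewrite ler_wpM2l.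
- move=> l u v l01; rewrite /mixture !mulr_sumr -big_split/=.
  apply: ler_sum => j _; have h := young_convex yP (s j * u) (s j * v) l01.
  have -> : s j * (l * u + (1 - l) * v) = l * (s j * u) + (1 - l) * (s j * v) by ring.
  apply: le_trans (ler_wpM2l (m0 j) h) _.
  by rewrite le_eqVlt; apply/orP; left; apply/eqP; ring.
Qed.

Lemma mixture_continuous : continuous (mixture Phi n m s).
Proof.
move=> t; elim: (n) => [|p IH].
  rewrite (_ : mixture _ _ _ _ = cst 0); first exact: cvg_cst.
  by apply/funext => u; rewrite /mixture big_ord0.
rewrite (_ : mixture _ _ _ _ = (fun u => mixture Phi p m s u + m p * Phi (s p * u))); last first.
  by apply/funext => u; rewrite /mixture big_ord_recr.
apply: cvgD => //; apply: cvgM; first exact: cvg_cst.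
apply: (@cvg_comp _ _ _ (fun t => s p * t) Phi _ (nbhs (s p * t))).
  by apply: cvgM; [exact: cvg_cst|exact: cvg_id].
exact: young_continuous.
Qed.

Lemma mixture_normalize : (exists2 t, 0 < t & 1 <= mixture Phi n m s t) ->
  exists2 t, 0 < t & mixture Phi n m s t = 1.
Proof.
move=> [T T0 hT].
have f0 : mixture Phi n m s 0 = 0.
  by rewrite /mixture big1// => j _; rewrite mulr0 (young0 yP) ?mulr0.
have [||c] := @IVT R (mixture Phi n m s) 0 T 1 (ltW T0).
- exact/continuous_subspaceT/mixture_continuous.
- by rewrite f0 min_l ?max_r ?ler01 ?hT// (le_trans ler01).
rewrite in_itv/= => /andP[c0 _] fc; exists c => //.
rewrite lt_neqAle c0 andbT; apply/eqP => c0'; move: fc; rewrite -c0' f0 => /eqP.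
by rewrite eq_sym oner_eq0.
Qed.

End mixtures.

Section normalized.
Set Implicit Arguments.
Unset Strict Implicit.
Context {R : realType}.
Variable G : R -> R.
Hypotheses (yG : young G) (G1 : G 1 = 1).

Lemma normalized_le t : 0 <= t -> t <= 1 -> G t <= t.
Proof.
by move=> t0 t1; have := @young_scale _ _ yG t 1; rewrite mulr1 G1 mulr1 t0 t1; apply.
Qed.

Lemma normalized_ge t : 1 <= t -> t <= G t.
Proof.
move=> t1; have t0 : 0 < t by exact: lt_le_trans t1.
have := @young_div _ _ yG t t t1; rewrite divff ?gt_eqF// G1.
by rewrite ler_pdivlMr// mul1r.
Qed.

Lemma normalized_le1 t : 0 <= t -> G t <= 1 -> t <= 1.
Proof.
move=> t0 Gt; rewrite leNgt; apply/negP => t1.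
by have := normalized_ge (ltW t1); rewrite leNgt (le_lt_trans Gt).
Qed.

Lemma normalized_lipschitz s t : 0 <= s -> s <= t -> t <= 2^-1 ->
  G t - G s <= 2 * (t - s).
Proof.
move=> s0 st th; have h0 : (0 : R) < 2^-1 by rewrite invr_gt0.
have := young_lipschitz yG h0 st th.
by rewrite divff ?pnatr_eq0// G1 mulr1 invrK mulrC.
Qed.

Lemma normalized_lipschitz_abs s t : 0 <= s <= 2^-1 -> 0 <= t <= 2^-1 ->
  `|G t - G s| <= 2 * `|t - s|.
Proof.
move=> /andP[s0 sh] /andP[t0 th]; have [st|/ltW ts] := leP s t.
  rewrite !ger0_norm ?subr_ge0//; last exact: (le_young yG).
  exact: normalized_lipschitz.
rewrite (distrC (G t)) (distrC t) !ger0_norm ?subr_ge0//; last exact: (le_young yG).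
exact: normalized_lipschitz.
Qed.

End normalized.

Section compactness.
Set Implicit Arguments.
Unset Strict Implicit.
Context {R : realType}.

(** Limits along an ultrafilter serve for both sequences at once. *)
Lemma ultra_limit (U : set_system nat) (UU : UltraFilter U) (f : nat -> R) :
  (forall n, 0 <= f n <= 1) ->
  exists l : R, forall e, 0 < e -> U [set n | `|f n - l| < e].
Proof.
move=> f01.
have PF : ProperFilter (f @ U) by exact: fmap_proper_filter.
have FA : (f @ U) `[0, 1]%classic.
  rewrite /fmap/= (_ : _ @^-1` _ = setT); first exact: filterT.
  by apply/seteqP; split => n //= _; rewrite in_itv/= f01.
have [l [_ cl]] := @segment_compact R 0 1 _ PF FA.
exists l => e e0; have [//|hC] := in_ultra_setVsetC [set n | `|f n - l| < e] UU.
have B1 : (f @ U) [set x | ~ (`|x - l| < e)] by [].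
have B2 : nbhs l [set x | `|x - l| < e].
  by apply/nbhs_ballP; exists e => // x /=; rewrite /ball/= distrC.
by have [x [/= h1 h2]] := cl _ _ B1 B2.
Qed.

(** Two sequences of uniformly Lipschitz functions have a common subsequence
    converging fast and uniformly: pointwise limits along an ultrafilter are
    uniform limits. *)
Lemma common_limit (G H : nat -> R -> R) (eps : nat -> R) :
  (forall n, 0 < eps n) ->
  (forall n, young (G n) /\ G n 1 = 1) -> (forall n, young (H n) /\ H n 1 = 1) ->
  exists (s : nat -> nat) (g h : R -> R),
    [/\ {homo s : i j / (i < j)%N},
        forall i t, 0 <= t <= 2^-1 -> `|G (s i) t - g t| < eps i &
        forall i t, 0 <= t <= 2^-1 -> `|H (s i) t - h t| < eps i].
Proof.
move=> eps0 hG hH.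
have [U [UU sU]] := @ultraFilterLemma nat \oo _.
have lim (f : nat -> R -> R) : (forall n, young (f n) /\ f n 1 = 1) ->
    exists g : R -> R, forall e, 0 < e ->
      U [set n | forall t, 0 <= t <= 2^-1 -> `|f n t - g t| < e].
  move=> hf.
  have /choice[g hg] t : exists l, 0 <= t <= 2^-1 -> forall e, 0 < e -> U [set n | `|f n t - l| < e].
    have [th|] := boolP (0 <= t <= 2^-1); last by exists 0.
    have /andP[t0 t1] := th.
    have [n|l hl] := @ultra_limit U UU (fun n => f n t); last by exists l => _.
    have [yf f1] := hf n; rewrite (young_ge0 yf)/=.
    have t1' : t <= 1 by rewrite (le_trans t1)// invf_le1// ler1n.
    exact: le_trans (normalized_le yf f1 t0 t1') t1'.
  exists g => e e0.
  have lipg (s t : R) : 0 <= s <= 2^-1 -> 0 <= t <= 2^-1 -> `|g t - g s| <= 2 * `|t - s|.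
    move=> hs ht; apply/ler_addgt0Pr => d d0; have d2 : 0 < d / 2 by rewrite divr_gt0.
    have [n [/= h1 h2]] := @filter_ex _ U _ _ (filterI (hg t ht _ d2) (hg s hs _ d2)).
    have [yf f1] := hf n; have := normalized_lipschitz_abs yf f1 hs ht.
    have -> : g t - g s = (f n t - f n s) - (f n t - g t) + (f n s - g s) by ring.
    have := ler_normD ((f n t - f n s) - (f n t - g t)) (f n s - g s).
    have := ler_normB (f n t - f n s) (f n t - g t).
    lra.
  pose M := Num.bound (8 / e); have M0 : 0 < M%:R :> R.
    exact: le_lt_trans (ltW (divr_gt0 (ltr0Sn _ 7) e0)) (archi_boundP (ltW (divr_gt0 (ltr0Sn _ 7) e0))).
  have hM : 8 / e < M%:R by rewrite archi_boundP// divr_ge0// ltW.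
  have e40 : 0 < e / 4 by rewrite divr_gt0.
  have grid (q : nat) : (q <= M.+1)%N -> U [set n | forall p, (p < q)%N ->
      `|f n (p%:R / (2 * M%:R)) - g (p%:R / (2 * M%:R))| < e / 4].
    elim: q => [_|q IH qM].
      by apply: (filterS _ (@filterT _ U _)) => n _ p.
    have hq : 0 <= (q%:R : R) / (2 * M%:R) <= 2^-1.
      rewrite divr_ge0 ?mulr_ge0//= ler_pdivrMr ?mulr_gt0// mulKf ?pnatr_eq0//.
      by rewrite ler_nat.
    apply: filterS (filterI (IH (ltnW qM)) (hg _ hq _ e40)) => n [/= h1 h2] p.
    by rewrite ltnS leq_eqVlt => /orP[/eqP ->|/h1].
  apply: filterS (grid M.+1 (leqnn _)) => n /= hn t ht; have /andP[t0 t1] := ht.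
  have [p [pM p1 p2]] : exists p, [/\ (p < M.+1)%N, p%:R / (2 * M%:R) <= t &
      t - p%:R / (2 * M%:R) <= M%:R^-1].
    have M2 : 0 < 2 * M%:R :> R by rewrite mulr_gt0.
    have tM0 : 0 <= t * (2 * M%:R) by rewrite mulr_ge0// ltW.
    exists (Num.truncn (t * (2 * M%:R))).
    have /andP[q1 q2] := truncn_itv tM0; split.
    - rewrite ltnS -(ler_nat R); apply: le_trans q1 _.
      by rewrite -[leRHS](mulKf (_ : 2 != 0)) ?pnatr_eq0// ler_wpM2r// ltW.
    - by rewrite ler_pdivrMr.
    - rewrite lerBlDl; move: q2; rewrite -[(Num.truncn _).+1%:R]natr1 -ltr_pdivlMr// => /ltW /le_trans; apply.
      set P := (Num.truncn _)%:R.
      have -> : (P + 1) / (2 * M%:R) = P / (2 * M%:R) + (2 * M%:R)^-1.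
        by rewrite mulrDl mul1r.
      by rewrite lerD2l lef_pV2 ?posrE// ler_peMl ?ler1n// ltW.
  have hp : 0 <= (p%:R : R) / (2 * M%:R) <= 2^-1.
    by rewrite divr_ge0 ?mulr_ge0 ?(ltW M0)//= (le_trans p1).
  have [yf f1] := hf n.
  have h1 := normalized_lipschitz_abs yf f1 hp ht.
  have h2 := lipg _ _ hp ht; have h3 := hn p pM.
  have h4 : `|t - p%:R / (2 * M%:R)| < e / 8.
    rewrite ger0_norm ?subr_ge0//; apply: le_lt_trans p2 _.
    by rewrite -[ltRHS]invrK ltf_pV2 ?posrE ?invr_gt0 ?divr_gt0// invf_div.
  set q := p%:R / _ in h1 h2 h3 h4 *.
  have -> : f n t - g t = (f n t - f n q) + (f n q - g q) - (g t - g q) by ring.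
  have := ler_normB ((f n t - f n q) + (f n q - g q)) (g t - g q).
  have := ler_normD (f n t - f n q) (f n q - g q).
  lra.
have [g hg] := lim G hG; have [h hh] := lim H hH.
have [|s [hs1 hs2]] := @increasing_choice (fun i p =>
    (forall t, 0 <= t <= 2^-1 -> `|G p t - g t| < eps i) /\
    (forall t, 0 <= t <= 2^-1 -> `|H p t - h t| < eps i)).
  move=> i N.
  have UN : U [set p | (N < p)%N] by apply: sU; exists N.+1.
  have [p [/= Np [h1 h2]]] := @filter_ex _ U _ _
    (filterI UN (filterI (hg _ (eps0 i)) (hh _ (eps0 i)))).
  by exists p.
exists s, g, h; split => // i t ht; first exact: (hs2 i).1.
exact: (hs2 i).2.
Qed.

End compactness.

Section hulls.
Set Implicit Arguments.
Unset Strict Implicit.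
Context {R : realType}.

Lemma convex_hull_sum (A : set (R -> R^o)) n (l : nat -> R) (f : nat -> R -> R^o) :
  (forall j, 0 <= l j) -> \sum_(j < n) l j = 1 ->
  (forall j, (j < n)%N -> 0 < l j -> A (f j)) ->
  convex_hull A (fun t => \sum_(j < n) l j * f j t).
Proof.
move=> l0 l1 fA B [cB AB].
have gen p : (p <= n)%N -> 0 < \sum_(j < p) l j ->
    B (fun t => (\sum_(j < p) l j * f j t) / \sum_(j < p) l j).
  elim: p => [_|p IH pn]; first by rewrite big_ord0 ltxx.
  rewrite big_ord_recr/=; set S := \sum_(j < p) l j.
  have S0 : 0 <= S by apply: sumr_ge0 => j _.
  have [lp|lp] := eqVneq (l p) 0.
    rewrite lp addr0 => S1; have := IH (ltnW pn) S1.
    by congr B; apply/funext => t; rewrite big_ord_recr/= lp mul0r addr0.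
  have lp0 : 0 < l p by rewrite lt_neqAle eq_sym lp l0.
  have Bfp : B (f p) by apply: AB; exact: fA.
  have [S1|S1] := eqVneq S 0.
    rewrite S1 add0r => _; move: Bfp; congr B; apply/funext => t.
    rewrite big_ord_recr/= big1 ?add0r.
      by rewrite mulrC mulKf ?gt_eqF.
    move=> j _; have -> : l j = 0; last by rewrite mul0r.
    apply/eqP; rewrite eq_le l0 andbT -S1 /S (bigD1 j)//= lerDl.
    by apply: sumr_ge0.
  have S2 : 0 < S by rewrite lt_neqAle eq_sym S1.
  move=> SS; have BS := IH (ltnW pn) S2.
  have lam : 0 <= S / (S + l p) <= 1.
    by rewrite divr_ge0 ?(ltW SS)//= ler_pdivrMr// mul1r lerDl.
  have /andP[lam0 lam1] := lam.
  have := cB _ _ (Itv01 lam0 lam1) (mem_set BS) (mem_set Bfp).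
  rewrite inE; congr B; apply/funext => t.
  rewrite -[LHS]/(S / (S + l p) * ((\sum_(j < p) l j * f j t) / S) +
                  (1 - S / (S + l p)) * f p t) big_ord_recr/=.
  by field; rewrite !gt_eqF.
have := gen n (leqnn n); rewrite l1 => /(_ ltr01).
by congr B; apply/funext => t; rewrite divr1.
Qed.

End hulls.

(** * The complementary function *)
Section complementary_function.
Set Implicit Arguments.
Unset Strict Implicit.
Context {R : realType}.
Variable F : R -> \bar R.
Hypothesis oF : finite_orlicz F.
Local Notation Phi := (real_form F).
Let yP : young Phi := young_real_form oF.

Let cE (u t : R) : 0 < t -> ((t * u)%:E - F t)%E = (t * u - Phi t)%:E.
Proof. by move=> t0; rewrite (real_formE oF (ltW t0)) EFinB. Qed.

Lemma complementary_ge (u t : R) : 0 < t ->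
  ((t * u - Phi t)%:E <= complementary F u)%E.
Proof. by move=> t0; apply: ereal_sup_ubound; exists t => //; rewrite cE. Qed.

Lemma complementary_le (u : R) (M : \bar R) :
  (forall t, 0 < t -> ((t * u - Phi t)%:E <= M)%E) -> (complementary F u <= M)%E.
Proof.
by move=> h; apply: ge_ereal_sup => _ [t t0 <-]; rewrite cE//; exact: h.
Qed.

Lemma complementary_ge0 (u : R) : 0 <= u -> (0 <= complementary F u)%E.
Proof.
move=> u0; apply/lee_addgt0Pr => e e0.
pose t := Num.min 1 (e / (1 + Phi 1)).
have p1 : 0 < 1 + Phi 1 by rewrite ltr_wpDr// (young_ge0 yP).
have t0 : 0 < t by rewrite lt_min ltr01 divr_gt0.
have t1 : t <= 1 by rewrite ge_min lexx.
have := complementary_ge u t0 => /(leeD2r e%:E); apply: le_trans.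
rewrite -EFinD lee_fin.
have : Phi t <= t * Phi 1.
  by rewrite -[in leLHS](mulr1 t) young_scale// (ltW t0).
have : t * Phi 1 <= e.
  apply: (@le_trans _ _ (e / (1 + Phi 1) * Phi 1)).
    by rewrite ler_wpM2r ?(young_ge0 yP)// ge_min lexx orbT.
  by rewrite mulrAC ler_pdivrMr// ler_wpM2l ?(ltW e0)// lerDr.
have : 0 <= t * u by rewrite mulr_ge0// ltW.
lra.
Qed.

Lemma finite_orlicz_complementary : (forall u, 0 <= u -> (complementary F u < +oo)%E) ->
  finite_orlicz (complementary F).
Proof.
move=> fin; split=> [|u u0]; last exact: fin.
have [T T0 PT] := young_neq0 yP.
split.
- apply/eqP; rewrite eq_le complementary_ge0// andbT; apply: complementary_le => t t0.
  by rewrite mulr0 sub0r lee_fin oppr_le0 (young_ge0 yP).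
- move=> s t s0 st; apply: complementary_le => u u0.
  apply: le_trans (complementary_ge t u0); rewrite lee_fin lerD2r.
  by rewrite ler_wpM2l// ltW.
- move=> l s t /andP[l0 l1] s0 t0; apply: complementary_le => u u0.
  have l1' : 0 <= 1 - l by rewrite subr_ge0.
  apply: (@le_trans _ _ (l%:E * (u * s - Phi u)%:E + (1 - l)%:E * (u * t - Phi u)%:E)%E).
    by rewrite -!EFinM -EFinD lee_fin le_eqVlt; apply/orP; left; apply/eqP; ring.
  by apply: leeD; apply: lee_wpmul2l; rewrite ?lee_fin//; exact: complementary_ge.
- exists (Phi T / T + 1); first by rewrite addr_ge0// divr_ge0 ?ltW.
  move=> h; have := complementary_ge (Phi T / T + 1) T0.
  rewrite h lee_fin mulrDr mulrCA divff ?gt_eqF// !mulr1 leNgt.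
  by rewrite addrC addKr T0.
- by exists 1 => //; exact: fin.
Qed.

Hypothesis oFs : finite_orlicz (complementary F).
Local Notation Psi := (real_form (complementary F)).

Lemma young_inequality t v : 0 <= t -> 0 <= v -> t * v <= Phi t + Psi v.
Proof.
rewrite le_eqVlt => /orP[/eqP <-|t0] v0.
  by rewrite mul0r addr_ge0 ?(young_ge0 yP)// (young_ge0 (young_real_form oFs)).
have := complementary_ge v t0; rewrite (real_formE oFs v0) lee_fin; lra.
Qed.

Lemma young_attained v d : 0 <= v -> 0 < d ->
  exists2 t, 0 <= t & Psi v - d <= t * v - Phi t.
Proof.
move=> v0 d0.
have fv : complementary F v \is a fin_num by rewrite (real_formE oFs v0).
have [_ [t t0 <-]] := ub_ereal_sup_adherent d0 fv.
rewrite -/(complementary F v) (cE _ t0) (real_formE oFs v0) -EFinB lte_fin => h.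
by exists t; exact: ltW.
Qed.

(** A function whose complementary function is finite grows faster than any
    linear one. *)
Lemma superlinear X : exists2 S : R, 0 < S & forall t, S <= t -> X * t <= Phi t.
Proof.
have yPs := young_real_form oFs.
pose v := `|X| + 1; exists (Psi v + 1); first by rewrite ltr_wpDl// (young_ge0 yPs).
move=> t St; have P0 := young_ge0 yPs v; have t0 : 0 <= t by lra.
have v0 : 0 <= v by rewrite addr_ge0.
have := young_inequality t0 v0; have : X * t <= `|X| * t by rewrite ler_wpM2r// ler_norm.
rewrite /v mulrDr mulr1 (mulrC t); lra.
Qed.

End complementary_function.

(** * Limits of mixtures belong to the sets of limit functions *)

Section limit_functions.
Set Implicit Arguments.
Unset Strict Implicit.
Context {R : realType}.

Lemma lipschitz_within (g : R -> R) :
  (forall s t, 0 <= s <= 2^-1 -> 0 <= t <= 2^-1 -> `|g t - g s| <= 2 * `|t - s|) ->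
  {within `[0%R, 2^-1 : R]%classic, continuous g}.
Proof.
move=> hg.
pose cl (t : R) := Num.max 0 (Num.min t 2^-1).
have h0 : (0 : R) <= 2^-1 by rewrite invr_ge0.
have clP t : 0 <= cl t <= 2^-1.
  by rewrite /cl le_max lexx/= ge_max h0 ge_min lexx orbT.
have cll s t : `|cl t - cl s| <= `|t - s|.
  wlog st : s t / s <= t.
    move=> h; have [/h//|/ltW ts] := leP s t.
    by rewrite distrC (distrC t); exact: h.
  have mono : cl s <= cl t.
    by rewrite /cl ge_max le_max lexx/= le_max le_min !ge_min st lexx !orbT.
  rewrite !ger0_norm ?subr_ge0// /cl.
  have [h1|h1] := leP s (2^-1 : R); have [h2|h2] := leP t (2^-1 : R);
  have [h3|h3] := leP 0 s; have [h4|h4] := leP 0 t;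
  try have [h5|h5] := leP (0 : R) 2^-1; lra.
have ctg : continuous (g \o cl).
  move=> x; apply/cvgrPdist_lt => e e0; near=> y.
  have : `|x - y| < e / 2.
    by near: y; apply: (@cvgr_dist_lt _ _ _ (nbhs x) _ id x) => //; rewrite divr_gt0.
  move=> xy; rewrite /= (le_lt_trans (hg _ _ (clP y) (clP x)))//.
  by have := cll y x; lra.
apply: (@subspace_eq_continuous _ _ _ (g \o cl)); last exact: continuous_subspaceT.
move=> t; rewrite inE/= in_itv/= => /andP[t0 t1].
by rewrite /cl /= min_l// max_r.
Unshelve. all: by end_near. Qed.

(** Convergence of mixtures whose levels tend to infinity puts the limit in
    every closed convex hull C_{F,b}. *)
Lemma C_infty_mixture (F : R -> \bar R) (n : nat -> nat) (m s : nat -> nat -> R)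
    (g : R -> R) (eps : nat -> R) :
  finite_orlicz F ->
  (forall i j, 0 <= m i j) -> (forall i j, 0 <= s i j) ->
  (forall i, mixture (real_form F) (n i) (m i) (s i) 1 = 1) ->
  (forall b, exists i0, forall i j, (i0 <= i)%N -> (j < n i)%N ->
     0 < m i j * real_form F (s i j) -> b < s i j) ->
  (forall e, 0 < e -> exists i0, forall i, (i0 <= i)%N -> eps i < e) ->
  (forall i t, 0 <= t <= 2^-1 ->
     `|mixture (real_form F) (n i) (m i) (s i) t - g t| < eps i) ->
  C_infty F (affine_extension g).
Proof.
move=> oF m0 s0 mix1 hb heps hg; have yP := young_real_form oF.
have yM i : young (mixture (real_form F) (n i) (m i) (s i)).
  by apply: young_mixture => //; exists 1; rewrite ?mix1.
exists g => // b b0; split.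
  apply: lipschitz_within => u t hu ht; apply/ler_addgt0Pr => e e0.
  have e20 : 0 < e / 2 by rewrite divr_gt0.
  have [i hi] := heps _ e20; have ei := hi i (leqnn i).
  have h1 := hg i _ hu; have h2 := hg i _ ht.
  have h3 := normalized_lipschitz_abs (yM i) (mix1 i) hu ht.
  set f := mixture _ _ _ _ in h1 h2 h3.
  have -> : g t - g u = (f t - f u) - (f t - g t) + (f u - g u) by ring.
  have := ler_normD ((f t - f u) - (f t - g t)) (f u - g u).
  have := ler_normB (f t - f u) (f t - g t).
  lra.
move=> P; rewrite uniform_nbhs => -[E [entE EP]].
have [e /= e0 eE] := entE.
have [i1 hi1] := heps _ e0; have [i2 hi2] := hb b.
pose i := maxn i1 i2; pose S := real_form F.
have Sg u : 0 <= S u by exact: (young_ge0 yP).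
pose l j := m i j * S (s i j).
exists (fun t => \sum_(j < n i) l j * rescaled F (s i j) t); split; last first.
  apply: EP => t /=; rewrite in_itv/= => tI; apply: eE => /=.
  have /andP[t0 _] := tI.
  rewrite /ball_ distrC; apply: lt_trans (hi1 i (leq_maxl _ _)).
  have -> : \sum_(j < n i) l j * rescaled F (s i j) t =
      mixture (real_form F) (n i) (m i) (s i) t; last exact: hg.
  apply: eq_bigr => j _; rewrite /l /rescaled !fine_orlicz ?mulr_ge0// -mulrA.
  congr (_ * _); rewrite -/S mulrCA; have [z|z] := eqVneq (S (s i j)) 0.
    rewrite z mul0r mulr0; apply/esym/eqP; rewrite eq_le Sg andbT.
    have [t1 th] := andP tI.
    have t1' : t <= 1 by rewrite (le_trans th)// invf_le1// ler1n.
    have := @young_scale _ _ yP t (s i j); rewrite t0 t1' => /(_ isT).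
    by rewrite -/S z mulr0 mulrC.
  by rewrite divff// mulr1.
apply: (@convex_hull_sum R (rescalings F b) (n i) l (fun j => rescaled F (s i j))).
- by move=> j; rewrite mulr_ge0//; exact: (young_ge0 yP).
- by rewrite -[RHS](mix1 i); apply: eq_bigr => j _; rewrite mulr1.
- move=> j jn lj; exists (s i j) => //=.
  have Sp : 0 < S (s i j).
    rewrite lt_neqAle Sg andbT; apply/eqP => h.
    by move: lj; rewrite /l -h mulr0 ltxx.
  split.
  + rewrite lt_neqAle s0 andbT; apply/eqP => h.
    by move: Sp; rewrite -h /S (young0 yP)// ltxx.
  + by rewrite real_formE// lte_fin.
  + by apply: hi2; rewrite ?leq_maxr.
Qed.

End limit_functions.

(** * The affine extension *)

(** The properties of normalized Orlicz functions that survive uniform limits on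
    [0, 1/2] and that the associated sequence space needs. *)
Definition sublinear_gauge {R : realType} (g : R -> R) : Prop :=
  [/\ forall t : R, 0 <= t <= 2^-1 -> 0 <= g t <= t,
      forall u t : R, 0 <= u -> u <= t -> t <= 2^-1 -> g u <= g t &
      forall t : R, 0 <= t <= 2^-1 -> g (t / 2) <= g t / 2].

Section affine_extension.
Set Implicit Arguments.
Unset Strict Implicit.
Context {R : realType}.
Variable g : R -> R.
Hypothesis gP : forall t : R, 0 <= t <= 2^-1 -> 0 <= g t <= t.

Definition affine_real (t : R) : R :=
  if t <= 2^-1 then g t else g 2^-1 + 2 * (1 - g 2^-1) * (t - 2^-1).

Lemma affine_extensionE t : affine_extension g t = (affine_real t)%:E.
Proof. by []. Qed.

Let h12 : (0 : R) <= 2^-1 <= (2^-1 : R). Proof. by rewrite invr_ge0 ler0n lexx. Qed.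

Lemma affine_real_ge0 t : 0 <= t -> 0 <= affine_real t.
Proof.
move=> t0; rewrite /affine_real; have /andP[g0 g1] := gP h12.
case: ifPn => [th|]; first by have := @gP t; rewrite t0 th => /(_ isT)/andP[].
rewrite -ltNge => th; have h1 : 0 <= (1 - g 2^-1) * (t - 2^-1) by rewrite mulr_ge0//; lra.
lra.
Qed.

Lemma affine_real_gt1 t : 1 <= t -> t <= affine_real t.
Proof.
move=> t1; rewrite /affine_real; have /andP[g0 g1] := gP h12.
have -> : (t <= 2^-1) = false by apply/negbTE; rewrite -ltNge; lra.
have h1 : 0 <= (2^-1 - g 2^-1) * (t - 1) by rewrite mulr_ge0//; lra.
lra.
Qed.

Lemma affine_real_le1 t : 0 <= t -> affine_real t <= 1 -> t <= 1.
Proof.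
move=> t0 h; rewrite leNgt; apply/negP => t1.
have := affine_real_gt1 (ltW t1); lra.
Qed.

Hypothesis gmono : forall s t : R, 0 <= s -> s <= t -> t <= 2^-1 -> g s <= g t.

Lemma le_affine_real s t : 0 <= s -> s <= t -> affine_real s <= affine_real t.
Proof.
move=> s0 st; have /andP[g0 g1] := gP h12.
rewrite /affine_real; case: ifPn => sh; case: ifPn => th.
- exact: gmono.
- apply: (@le_trans _ _ (g 2^-1)); first exact: gmono.
  rewrite -ltNge in th; rewrite lerDl mulr_ge0//; lra.
- by move: sh; rewrite (le_trans st th).
- rewrite lerD2l ler_wpM2l ?lerD2r//; lra.
Qed.

(** For u <= 1 the supremum that defines G^* may be taken over [0, 1/2], because
    beyond 1/2 the extension has slope at least 1. *)
Lemma affine_young_conjugate (u v : R) : 0 <= u -> u <= 1 ->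
  (forall t : R, 0 <= t <= 2^-1 -> t * u <= g t + v) ->
  (complementary (affine_extension g) u <= v%:E)%E.
Proof.
move=> u0 u1 h; have /andP[g0 g1] := gP h12.
apply: ge_ereal_sup => _ [t t0 <-]; rewrite affine_extensionE -EFinB lee_fin.
rewrite lerBlDl /affine_real; case: ifPn => th; first by rewrite h// ltW.
have := h _ h12; rewrite -ltNge in th.
have h1 : 0 <= (1 - u) * (t - 2^-1) by rewrite mulr_ge0//; lra.
have h2 : 0 <= (2^-1 - g 2^-1) * (t - 2^-1) by rewrite mulr_ge0//; lra.
lra.
Qed.

End affine_extension.

(** * Duality between the limits of mixtures *)
Section duality.
Set Implicit Arguments.
Unset Strict Implicit.
Context {R : realType}.
Variable F : R -> \bar R.
Hypothesis oF : finite_orlicz F.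
Hypothesis oFs : finite_orlicz (complementary F).
Local Notation Phi := (real_form F).
Local Notation Psi := (real_form (complementary F)).
Let yP : young Phi := young_real_form oF.
Let yPs : young Psi := young_real_form oFs.
Let P0 := young_ge0 yP.

Variables (J : nat -> nat) (m lv w : nat -> nat -> R) (B rmin cE : R).
Hypothesis m0 : forall i j, 0 <= m i j.
Hypothesis lv0 : forall i j, 0 < lv i j.
Hypothesis w0 : forall i j, 0 <= w i j.
Hypothesis mw : forall i j, m i j = 0 -> w i j = 0.
Hypothesis m1 : forall i, \sum_(j < J i) m i j <= 1.
Hypothesis wS : forall i, 4^-1 <= \sum_(j < J i) w i j.
Hypothesis lv_infty : forall X, exists i0, forall i j, (i0 <= i)%N -> X <= lv i j.
Hypothesis B0 : 0 < B.
Hypothesis mix_B : forall i, mixture Phi (J i) (m i) (lv i) B^-1 <= 1.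
Hypothesis rmin0 : 0 < rmin.
Hypothesis mix_rmin : forall i r, 0 < r ->
  mixture Phi (J i) (m i) (lv i) r^-1 <= 1 -> rmin <= r.
Hypothesis cE0 : 0 < cE.
Hypothesis mix_dual : forall (s : nat -> nat) N (al : nat -> nat -> R) t,
  injective s -> 0 < t -> (forall i j, 0 <= al i j) ->
  \sum_(i < N) \sum_(j < J (s i)) m (s i) j * Phi (al i j * lv (s i) j / t) <= 1 ->
  \sum_(i < N) mixture Phi (J (s i)) (m (s i)) (lv (s i))
     ((\sum_(j < J (s i)) al i j * w (s i) j) / (cE * t)) <= 1.

Let lv_ge0 i j : 0 <= lv i j. Proof. exact: ltW. Qed.

Let radius i : exists2 r : R, rmin <= r <= B &
  mixture Phi (J i) (m i) (lv i) r^-1 = 1.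
Proof.
have [|v v0 hv] := @mixture_normalize _ _ yP (J i) (m i) (lv i).
  apply: contrapT => h; pose v := 2 / rmin.
  have v0 : 0 < v by rewrite divr_gt0.
  have : rmin <= v^-1.
    apply: (@mix_rmin i); first by rewrite invr_gt0.
    rewrite invrK leNgt; apply/negP => hv; apply: h; exists v => //; exact: ltW.
  by rewrite /v invf_div ler_pdivlMr// ger_pMr//; lra.
have yM : young (mixture Phi (J i) (m i) (lv i)).
  by apply: young_mixture => //; exists v; rewrite ?hv.
exists v^-1; last by rewrite invrK.
apply/andP; split.
  by apply: (@mix_rmin i); rewrite ?invr_gt0// invrK hv.
rewrite leNgt; apply/negP => Bv.
have h1 : v * B < 1 by rewrite -ltr_pdivlMl// mulr1.
have h2 : 0 <= v * B <= 1 by rewrite (ltW h1) mulr_ge0// ltW.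
have := young_scale yM B^-1 h2; rewrite -mulrA mulfV ?gt_eqF// mulr1 hv.
have := mix_B i; have := young_ge0 yM B^-1.
have vB0 : 0 < v * B by rewrite mulr_gt0.
set M := mixture _ _ _ _ _ => M0 M1 M2.
have : v * B * M <= v * B * 1 by rewrite ler_wpM2l// ltW.
lra.
Qed.

Let r i := sval (cid2 (radius i)).
Let rP i : rmin <= r i <= B. Proof. by rewrite /r; case: cid2. Qed.
Let r1 i : mixture Phi (J i) (m i) (lv i) (r i)^-1 = 1.
Proof. by rewrite /r; case: cid2. Qed.
Let r0 i : 0 < r i. Proof. by have /andP[h _] := rP i; exact: lt_le_trans h. Qed.

Let sr i j := lv i j / r i.
Let sr_gt0 i j : 0 < sr i j. Proof. exact: divr_gt0. Qed.
Let sr0 i j : 0 <= sr i j. Proof. exact: ltW. Qed.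
Let G i := mixture Phi (J i) (m i) (sr i).

Let GE i t : G i t = mixture Phi (J i) (m i) (lv i) (t / r i).
Proof. by apply: eq_bigr => j _; rewrite /sr mulrAC -mulrA. Qed.

Let G1 i : G i 1 = 1. Proof. by rewrite GE mul1r. Qed.
Let yG i : young (G i).
Proof. by apply: young_mixture => //; exists 1; rewrite // -/(G i 1) G1. Qed.

Let Lam i := \sum_(j < J i) m i j * lv i j.

Let Lam_gt0 i : 0 < Lam i.
Proof.
rewrite lt_neqAle; apply/andP; split; last first.
  by apply: sumr_ge0 => j _; rewrite mulr_ge0.
apply/eqP => h; have := wS i; rewrite big1 ?leNgt ?invr_gt0 ?ltr0n// => j _.
apply: mw; apply/eqP; rewrite eq_le m0 andbT -(ler_pM2r (lv0 i j)) mul0r h.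
rewrite /Lam (bigD1 j)//= lerDl; apply: sumr_ge0 => j' _; by rewrite mulr_ge0.
Qed.

(** tau is the density of the weights relative to the function with values lv; its
    small values are cut off because only large arguments of F^* may enter
    C_{F^*}. *)
Let cut i := (8 * Lam i)^-1.
Let tau i j := w i j / (lv i j * m i j).
Let tau' i j := if cut i < tau i j then tau i j else 0.

Let tau_ge0 i j : 0 <= tau i j.
Proof. by rewrite divr_ge0// mulr_ge0. Qed.

Let tau'_ge0 i j : 0 <= tau' i j.
Proof. by rewrite /tau'; case: ifP. Qed.

Let tau'_le i j : tau' i j <= tau i j.
Proof. by rewrite /tau'; case: ifP. Qed.

Let m_tau i j : m i j * (lv i j * tau i j) = w i j.
Proof.
have [mz|mz] := eqVneq (m i j) 0; first by rewrite mz mul0r mw.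
by rewrite /tau; field; rewrite mz gt_eqF.
Qed.

Let tau'_mass i : 8^-1 <= \sum_(j < J i) m i j * (lv i j * tau' i j).
Proof.
apply: (@le_trans _ _ (\sum_(j < J i) (w i j - m i j * lv i j * cut i))).
  rewrite sumrB -mulr_suml -/(Lam i) /cut invfM mulrCA divff ?gt_eqF// mulr1.
  by have := wS i; lra.
apply: ler_sum => j _; rewrite /tau'; case: ifPn => [_|].
  by rewrite m_tau gerBl mulr_ge0 ?mulr_ge0// invr_ge0 mulr_ge0// ltW.
rewrite -leNgt => h; rewrite !mulr0 subr_le0 -{1}m_tau mulrA ler_wpM2l//.
by rewrite mulr_ge0.
Qed.

Let scale i : exists2 q : R, 0 < q & mixture Psi (J i) (m i) (tau' i) q^-1 = 1.
Proof.
have [|v v0 hv] := @mixture_normalize _ _ yPs (J i) (m i) (tau' i); last first.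
  by exists v^-1; rewrite ?invr_gt0// invrK.
have [c c0 hc] := young_linear_bound yPs.
pose T := \sum_(j < J i) m i j * tau' i j.
have T0 : 0 < T.
  rewrite lt_neqAle; apply/andP; split; last by apply: sumr_ge0 => j _; rewrite mulr_ge0.
  apply/eqP => h; have := tau'_mass i; rewrite big1 ?leNgt ?invr_gt0 ?ltr0n// => j _.
  rewrite mulrCA; apply/eqP; rewrite mulf_eq0; apply/orP; right.
  rewrite eq_le mulr_ge0// andbT h /T (bigD1 j)//= lerDl.
  by apply: sumr_ge0 => j' _; rewrite mulr_ge0.
exists (2 * c / T); first by rewrite divr_gt0// mulr_gt0.
apply: (@le_trans _ _ (\sum_(j < J i) (m i j * tau' i j * (2 / T) - m i j))).
  rewrite sumrB -mulr_suml -/T mulrC divfK ?gt_eqF//; have := m1 i; lra.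
apply: ler_sum => j _; rewrite -[X in _ - X]mulr1 -mulrA -mulrBr ler_wpM2l//.
rewrite lerBlDl -(ler_pM2l c0); apply: le_trans _ (hc _).
by rewrite le_eqVlt; apply/orP; left; apply/eqP; ring.
Qed.

Let q i := sval (cid2 (scale i)).
Let q0 i : 0 < q i. Proof. by rewrite /q; case: cid2. Qed.
Let q1 i : mixture Psi (J i) (m i) (tau' i) (q i)^-1 = 1.
Proof. by rewrite /q; case: cid2. Qed.

Let sg i j := tau' i j / q i.
Let sg0 i j : 0 <= sg i j. Proof. by rewrite divr_ge0// ltW. Qed.
Let H i := mixture Psi (J i) (m i) (sg i).

Let HE i t : H i t = mixture Psi (J i) (m i) (tau' i) (t / q i).
Proof. by apply: eq_bigr => j _; rewrite /sg mulrAC -mulrA. Qed.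

Let H1 i : H i 1 = 1. Proof. by rewrite HE mul1r. Qed.
Let yH i : young (H i).
Proof. by apply: young_mixture => //; exists 1; rewrite // -/(H i 1) H1. Qed.

(** The inequality of Young under the sum. *)
Let pairing i (t v : R) : 0 <= t -> 0 <= v ->
  (\sum_(j < J i) m i j * (sr i j * sg i j)) * (t * v) <= G i t + H i v.
Proof.
move=> t0 v0; rewrite mulr_suml /G /H /mixture -big_split/=.
apply: ler_sum => j _.
have := young_inequality oF oFs (mulr_ge0 (sr0 i j) t0) (mulr_ge0 (sg0 i j) v0).
move=> /(ler_wpM2l (m0 i j)); rewrite mulrDr; apply: le_trans.
by rewrite le_eqVlt; apply/orP; left; apply/eqP; ring.
Qed.

Let pairing_mass i : (8 * (r i * q i))^-1 <= \sum_(j < J i) m i j * (sr i j * sg i j).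
Proof.
have rq : 0 < r i * q i by rewrite mulr_gt0.
rewrite invfM -ler_pdivlMr ?invr_gt0// invrK; apply: le_trans (tau'_mass i) _.
rewrite mulr_suml; apply: ler_sum => j _; rewrite le_eqVlt; apply/orP; left; apply/eqP.
by rewrite /sr /sg; field; rewrite !gt_eqF.
Qed.

Let qmin := (16 * B)^-1.
Let qmin0 : 0 < qmin. Proof. by rewrite invr_gt0 mulr_gt0. Qed.

Let q_ge i : qmin <= q i.
Proof.
have rq : 0 < r i * q i by rewrite mulr_gt0.
have := pairing i ler01 ler01; rewrite G1 H1 !mulr1 => h.
have := le_trans (pairing_mass i) h.
rewrite invfM ler_pdivrMr// => h2; have /andP[_ rB] := rP i.
have : r i * q i <= B * q i by rewrite ler_wpM2r// ltW.
rewrite /qmin invfM ler_pdivrMr//; lra.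
Qed.

(** Near maximizers in the definition of F^* turn the mixtures of F^* into
    pairings with the weights. *)
Let near_optimal i (v d : R) : 0 <= v -> 0 < d -> exists e : nat -> R,
  [/\ forall j, 0 <= e j, forall j, tau' i j = 0 -> e j = 0 &
    mixture Psi (J i) (m i) (tau' i) v - d <=
    v * (\sum_(j < J i) e j / lv i j * w i j) - \sum_(j < J i) m i j * Phi (e j)].
Proof.
move=> v0 d0.
have /choice[e he] j : exists e : R, [/\ 0 <= e, tau' i j = 0 -> e = 0 &
    Psi (tau' i j * v) - d <= e * (tau' i j * v) - Phi e].
  have [z|z] := eqVneq (tau' i j) 0.
    by exists 0; split => //; rewrite z mul0r mul0r (young0 yPs)// (young0 yP)// subr0 sub0r oppr_le0 ltW.
  have [t t0 ht] := young_attained oF oFs (mulr_ge0 (tau'_ge0 i j) v0) d0.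
  by exists t; split => // h; rewrite h eqxx in z.
exists e; split=> [j|j|]; [by case: (he j)|by case: (he j)|].
apply: (@le_trans _ _ (\sum_(j < J i) m i j * (Psi (tau' i j * v) - d))).
  under eq_bigr do rewrite mulrBr.
  rewrite sumrB lerD2l lerN2 -mulr_suml ler_piMl ?m1//; exact: ltW.
rewrite mulr_sumr -sumrB; apply: ler_sum => j _; have [e0 _ hj] := he j.
apply: le_trans (ler_wpM2l (m0 i j) hj) _.
rewrite mulrBr lerD2r -m_tau.
have -> : v * (e j / lv i j * (m i j * (lv i j * tau i j))) = v * (e j * (m i j * tau i j)).
  by field; rewrite gt_eqF.
have -> : m i j * (e j * (tau' i j * v)) = v * (e j * (m i j * tau' i j)) by ring.
by rewrite ler_wpM2l// ler_wpM2l// ler_wpM2l.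
Qed.

Let qmax := 2 * (cE / rmin).
Let qmax0 : 0 < qmax. Proof. by rewrite mulr_gt0// divr_gt0. Qed.

(** The functions with values e_ij on the pieces have modular M, hence norm at most
    1 + M; pairing them with the weights produces admissible coefficients. *)
Let dual_test (s : nat -> nat) N (e : nat -> nat -> R) :
  injective s -> (forall i j, 0 <= e i j) ->
  let M := \sum_(i < N) \sum_(j < J (s i)) m (s i) j * Phi (e i j) in
  \sum_(i < N) mixture Phi (J (s i)) (m (s i)) (lv (s i))
     ((\sum_(j < J (s i)) e i j / lv (s i) j * w (s i) j) / (cE * (1 + M))) <= 1.
Proof.
move=> sI e0; cbv zeta; set M := \sum_(i < N) \sum_(j < J (s i)) _ * Phi _.
have M0 : 0 <= M by apply: sumr_ge0 => i _; apply: sumr_ge0 => j _; rewrite mulr_ge0.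
have M1 : 1 <= 1 + M by rewrite lerDl.
have M10 : 0 < 1 + M by exact: lt_le_trans M1.
apply: (@mix_dual s N (fun i j => e i j / lv (s i) j)) => //.
  by move=> i j; rewrite divr_ge0.
apply: (@le_trans _ _ (M / (1 + M))); last by rewrite ler_pdivrMr// mul1r lerDr.
rewrite /M mulr_suml; apply: ler_sum => i _; rewrite mulr_suml; apply: ler_sum => j _.
by rewrite divfK ?gt_eqF// -mulrA ler_wpM2l// young_div.
Qed.

(** Near maximizers for the mixture of F^* at a fixed argument have bounded pairing
    with the weights, so that mixture is at most 2 there. *)
Let q_le i : q i <= qmax.
Proof.
pose v := rmin / cE; have v0 : 0 < v by rewrite divr_gt0.
have [e [e0 _ he]] := near_optimal i (ltW v0) ltr01.
have := @dual_test (addn i) 1 (fun=> e) (@addnI i) (fun=> e0).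
rewrite /= !big_ord1 addn0; set M := \sum_(j < J i) m i j * Phi (e j) in he *.
set be := \sum_(j < J i) _ in he *.
have M0 : 0 <= M by apply: sumr_ge0 => j _; rewrite mulr_ge0.
have M10 : 0 < 1 + M by rewrite ltr_wpDr.
have be0 : 0 <= be by apply: sumr_ge0 => j _; rewrite !mulr_ge0// invr_ge0.
move=> hd; have beM : v * be <= 1 + M.
  move: be0; rewrite le_eqVlt => /orP[/eqP <-|be0]; first by rewrite mulr0 ltW.
  have r0' : 0 < cE * (1 + M) / be by rewrite divr_gt0// mulr_gt0.
  have := @mix_rmin i _ r0'; rewrite invf_div => /(_ hd).
  rewrite ler_pdivlMr// => h; rewrite /v mulrAC ler_pdivrMr// mulrC; lra.
have hM2 : mixture Psi (J i) (m i) (tau' i) v <= 2 by lra.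
rewrite leNgt; apply/negP => hq.
have e2 : (q i)^-1 = 2 / (v * q i) * (v / 2) by field; rewrite !gt_eqF.
have h2 : 2 / (v * q i) < 1.
  have vq : 0 < v * q i by rewrite mulr_gt0.
  rewrite (ltr_pdivrMr _ _ vq) mul1r /v mulrAC ltr_pdivlMr//.
  move: hq; rewrite -(ltr_pM2l rmin0); apply: le_lt_trans.
  by rewrite /qmax le_eqVlt; apply/orP; left; apply/eqP; field; rewrite gt_eqF.
have h20 : 0 < 2 / (v * q i) by rewrite divr_gt0// mulr_gt0.
have yM : young (mixture Psi (J i) (m i) (tau' i)).
  by apply: young_mixture => //; exists (q i)^-1; rewrite ?invr_gt0// q1.
have := q1 i; rewrite e2.
have h01 : 0 <= 2 / (v * q i) <= 1 by rewrite !ltW.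
have := young_scale yM (v / 2) h01.
have h12 : 1 <= (2 : R) by rewrite ler1n.
have := young_div yM v h12 => h3 h4 h5; rewrite h5 in h4.
have : mixture Psi (J i) (m i) (tau' i) (v / 2) <= 1 by lra.
set a := 2 / _ in h2 h20 h4 *; set M2 := mixture _ _ _ _ (v / 2) in h4 * => h6.
have : a * M2 <= a * 1 by rewrite ler_wpM2l// ltW.
lra.
Qed.

Let c0 := (8 * (B * qmax))^-1.
Let c00 : 0 < c0. Proof. by rewrite invr_gt0 mulr_gt0// mulr_gt0. Qed.

Let young_GH i t v : 0 <= t -> 0 <= v -> c0 * (t * v) <= G i t + H i v.
Proof.
move=> t0 v0; apply: le_trans (pairing i t0 v0); rewrite ler_wpM2r ?mulr_ge0//.
apply: le_trans (pairing_mass i); have /andP[_ rB] := rP i.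
have rq : r i * q i <= B * qmax by rewrite ler_pM ?q_le ?(ltW (r0 i)) ?(ltW (q0 i)).
have r8 : 8 * (r i * q i) <= 8 * (B * qmax) by rewrite ler_wpM2l.
by rewrite /c0 lef_pV2 ?posrE// mulr_gt0// mulr_gt0.
Qed.

Let levels_G b : exists i0, forall i j, (i0 <= i)%N -> b < sr i j.
Proof.
have [i0 hi] := lv_infty ((`|b| + 1) * B); exists i0 => i j ii.
rewrite /sr ltr_pdivlMr//; apply: lt_le_trans (hi i j ii).
have /andP[_ rB] := rP i.
apply: (@le_lt_trans _ _ (`|b| * B)).
  by apply: (@le_trans _ _ (`|b| * r i)); [rewrite ler_wpM2r ?ler_norm// ltW|rewrite ler_wpM2l].
by rewrite ltr_pM2r// ltrDl.
Qed.

(** The densities that were kept exceed cut i, a multiple of 1 / Lam_i; and Lam_i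
    is small compared with the radius because F is superlinear and the levels tend
    to infinity. *)
Let levels_H b : exists i0, forall i j, (i0 <= i)%N ->
  0 < m i j * Psi (sg i j) -> b < sg i j.
Proof.
pose X := 8 * B * (`|b| + 1) * qmax.
have b1 : 0 < `|b| + 1 by rewrite ltr_wpDl.
have X0 : 0 < X by apply: mulr_gt0 => //; rewrite mulr_gt0// mulr_gt0.
have [S S0 hS] := superlinear oF oFs X.
have [i0 hi] := levels_G S; exists i0 => i j ii hj.
have tp : cut i < tau' i j.
  rewrite /tau'; case: ifPn => // h; move: hj.
  by rewrite /sg /tau' (negbTE h) mul0r (young0 yPs)// mulr0 ltxx.
have LX : X * Lam i <= B.
  have /andP[_ rB] := rP i; apply: le_trans rB.
  have -> : Lam i = r i * \sum_(j < J i) m i j * sr i j.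
    rewrite mulr_sumr; apply: eq_bigr => j' _; rewrite /sr; field; rewrite gt_eqF//.
  rewrite mulrCA ler_piMr ?(ltW (r0 i))// -(G1 i) mulr_sumr.
  apply: ler_sum => j' _; rewrite mulrCA ler_wpM2l// mulr1.
  by apply: hS; apply: ltW; exact: hi.
have cX : X / (8 * B) <= cut i.
  rewrite /cut ler_pdivrMr ?mulr_gt0// ler_pdivlMl ?mulr_gt0//; lra.
have h1 : `|b| * qmax < tau' i j.
  apply: lt_trans tp; apply: lt_le_trans cX.
  have -> : X / (8 * B) = (`|b| + 1) * qmax by rewrite /X; field; rewrite gt_eqF.
  by rewrite ltr_pM2r// ltrDl.
rewrite /sg ltr_pdivlMr//; apply: le_lt_trans h1.
apply: (@le_trans _ _ (`|b| * q i)); first by rewrite ler_wpM2r ?ler_norm// ltW.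
by rewrite ler_wpM2l// q_le.
Qed.

Section limit.
Variables (s : nat -> nat) (g h : R -> R).
Hypothesis s_incr : {homo s : i j / (i < j)%N}.
Let eps (i : nat) : R := 2^-1 ^+ i.+2.
Hypothesis hg : forall i (t : R), 0 <= t <= 2^-1 -> `|G (s i) t - g t| < eps i.
Hypothesis hh : forall i (t : R), 0 <= t <= 2^-1 -> `|H (s i) t - h t| < eps i.

Let eps_small (e : R) : 0 < e -> exists i0, forall i, (i0 <= i)%N -> eps i < e.
Proof.
move=> e0; have [i0 hi] := expr_half_small e0; exists i0 => i ii.
apply: le_lt_trans hi; rewrite /eps.
have -> : i.+2 = (i0 + (i - i0).+2)%N by rewrite !addnS subnKC.
by rewrite exprD ler_piMr ?exprn_ge0 ?invr_ge0// exprn_ile1 ?invr_ge0// invf_le1// ler1n.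
Qed.

Let s_ge i : (i <= s i)%N.
Proof. by elim: i => // i IH; exact: leq_ltn_trans IH (s_incr (ltnSn i)). Qed.

Let s_inj : injective s.
Proof.
move=> i j; case: (ltngtP i j) => // /s_incr; by [move=> + e; rewrite e ltnn|move=> + e; rewrite e ltnn].
Qed.

Let limit_le (f : nat -> R -> R) (l : R -> R) (a b : R -> R) t :
  (forall i (t : R), 0 <= t <= 2^-1 -> `|f i t - l t| < eps i) -> 0 <= t <= 2^-1 ->
  ((forall i, f i t <= b t) -> l t <= b t) /\ ((forall i, a t <= f i t) -> a t <= l t).
Proof.
move=> hf ht; split=> hb; apply/ler_addgt0Pr => e e0; have [i hi] := eps_small e0;
  have := hi i (leqnn i); have := hf i t ht; have := hb i; rewrite ltr_norml => ? /andP[]; lra.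
Qed.

Let limit_props (f : nat -> R -> R) (l : R -> R) :
  (forall i, young (f i) /\ f i 1 = 1) ->
  (forall i (t : R), 0 <= t <= 2^-1 -> `|f i t - l t| < eps i) ->
  [/\ forall t : R, 0 <= t <= 2^-1 -> 0 <= l t <= t,
      forall u t : R, 0 <= u -> u <= t -> t <= 2^-1 -> l u <= l t &
      forall t : R, 0 <= t <= 2^-1 -> l (t / 2) <= l t / 2].
Proof.
move=> yf hf; split=> [t ht|u t u0 ut th|t ht]; last 1 first.
  apply/ler_addgt0Pr => e e0; have e20 : 0 < e / 2 by rewrite divr_gt0.
  have [i hi] := eps_small e20; have := hi i (leqnn i).
  have h2 : 0 <= t / 2 <= 2^-1.
    have /andP[t0 th] := ht; rewrite divr_ge0//=; lra.
  have h12 : 1 <= (2 : R) by rewrite ler1n.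
  have := hf i _ h2; have := hf i t ht; have := young_div (yf i).1 t h12.
  rewrite !ltr_norml => ? /andP[? ?] /andP[? ?]; lra.
  have /andP[t0 th] := ht.
  have t1 : t <= 1 by rewrite (le_trans th)// invf_le1// ler1n.
  have [h1 h2] := limit_le (fun=> 0) id hf ht.
  apply/andP; split; [apply: h2|apply: h1] => i; have [y1 y2] := yf i.
    exact: young_ge0.
  exact: normalized_le.
apply/ler_addgt0Pr => e e0; have e20 : 0 < e / 2 by rewrite divr_gt0.
have [i hi] := eps_small e20; have := hi i (leqnn i).
have hu : 0 <= u <= 2^-1 by rewrite u0 (le_trans ut).
have ht : 0 <= t <= 2^-1 by rewrite (le_trans u0).
have := hf i u hu; have := hf i t ht; have := le_young (yf i).1 ut.
rewrite !ltr_norml => ? /andP[? ?] /andP[? ?]; lra.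
Qed.

Let gP : (forall t : R, 0 <= t <= 2^-1 -> 0 <= g t <= t) /\
  (forall u t : R, 0 <= u -> u <= t -> t <= 2^-1 -> g u <= g t).
Proof. by have [] := limit_props (fun i => conj (yG (s i)) (G1 (s i))) hg. Qed.
Let hP : (forall t : R, 0 <= t <= 2^-1 -> 0 <= h t <= t) /\
  (forall u t : R, 0 <= u -> u <= t -> t <= 2^-1 -> h u <= h t).
Proof. by have [] := limit_props (fun i => conj (yH (s i)) (H1 (s i))) hh. Qed.

Let conjugate_le v : 0 <= v -> v <= 1 -> v / c0 <= 2^-1 ->
  (complementary (affine_extension g) v <= (h (v / c0))%:E)%E.
Proof.
move=> v0 v1 vc; apply: (affine_young_conjugate gP.1) => // t ht.
have hv : 0 <= v / c0 <= 2^-1 by rewrite vc divr_ge0// ltW.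
apply/ler_addgt0Pr => e e0; have e20 : 0 < e / 2 by rewrite divr_gt0.
have [i hi] := eps_small e20; have := hi i (leqnn i).
have := hg i ht; have := hh i hv.
have /andP[t0 _] := ht; have /andP[vc0 _] := hv.
have := young_GH (s i) t0 vc0.
have -> : c0 * (t * (v / c0)) = t * v by field; rewrite gt_eqF.
rewrite !ltr_norml => ? /andP[? ?] /andP[? ?]; lra.
Qed.

Let c1 := rmin * qmin / (6 * cE).
Let c10 : 0 < c1. Proof. by rewrite divr_gt0 ?mulr_gt0. Qed.

Let copies_bound (S X Y : R) : X / 2 <= S / 2 + (1 + Y) -> S <= 1 -> Y <= 1 -> X <= 6.
Proof. lra. Qed.

Let copies_bound' (Sb M u SH : R) : 0 <= M ->
  Sb * (rmin / (cE * (1 + M))) * u <= 6 ->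
  SH - 1 <= c1 * u / qmin * Sb - M -> SH <= 2.
Proof.
move=> M0 hX hS; have M10 : 0 < 1 + M by rewrite ltr_wpDr.
have : c1 * u / qmin * Sb = Sb * (rmin / (cE * (1 + M))) * u * ((1 + M) / 6).
  by rewrite /c1; field; rewrite !gt_eqF.
have : Sb * (rmin / (cE * (1 + M))) * u * ((1 + M) / 6) <= 6 * ((1 + M) / 6).
  by rewrite ler_wpM2r// divr_ge0// ltW.
move=> h1 h2; move: hS h1; rewrite h2 [6 * _]mulrC divfK//.
set A := Sb * _ * _ * _; lra.
Qed.

(** N disjoint copies of near optimal test functions: by duality their pairing
    with the weights is at most N times what G^* allows. *)
Let copies N (u kap : R) : (0 < N)%N -> 0 < u -> c1 * u <= 2^-1 ->
  (forall t : R, 0 <= t <= 2^-1 -> t * u <= g t + kap) -> N%:R * kap <= 1 ->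
  N%:R * h (c1 * u) <= 3.
Proof.
move=> N0 u0 cu hk Nk; set v := c1 * u in cu *.
have v0 : 0 < v by rewrite mulr_gt0.
have NR : 0 < N%:R :> R by rewrite ltr0n.
have d0 : 0 < N%:R^-1 :> R by rewrite invr_gt0.
have [n0 hn] := eps_small d0.
pose s' i := s (n0 + i)%N.
have s'I : injective s' by move=> i j /s_inj/addnI.
have hv : 0 <= v <= 2^-1 by rewrite (ltW v0).
have near i : exists e : nat -> R, (forall j, 0 <= e j) /\
    H (s' i) v - N%:R^-1 <= v / qmin * (\sum_(j < J (s' i)) e j / lv (s' i) j * w (s' i) j) -
      \sum_(j < J (s' i)) m (s' i) j * Phi (e j).
  have vq0 : 0 <= v / q (s' i) by rewrite divr_ge0// ltW.
  have [e [e0 _ he]] := near_optimal (s' i) vq0 d0.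
  exists e; split => //; rewrite HE; apply: le_trans he _; rewrite lerD2r.
  rewrite ler_wpM2r//; first by apply: sumr_ge0 => j _; rewrite !mulr_ge0// invr_ge0.
  by rewrite ler_wpM2l ?(ltW v0)// lef_pV2 ?posrE.
have /choice[e he] := near.
have := @dual_test s' N e s'I (fun i => (he i).1); cbv zeta.
set M := \sum_(i < N) _; pose be i := \sum_(j < J (s' i)) e i j / lv (s' i) j * w (s' i) j.
have M0 : 0 <= M.
  by apply: sumr_ge0 => i _; apply: sumr_ge0 => j _; rewrite mulr_ge0.
have M10 : 0 < 1 + M by rewrite ltr_wpDr.
have be0 i : 0 <= be i.
  by apply: sumr_ge0 => j _; rewrite !mulr_ge0 ?invr_ge0//; case: (he i).
pose x i := be i * rmin / (cE * (1 + M)).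
have cM0 : 0 < cE * (1 + M) by rewrite mulr_gt0.
have x0 i : 0 <= x i by rewrite divr_ge0 ?mulr_ge0// ltW.
move=> hd; have Gx : \sum_(i < N) G (s' i) (x i) <= 1.
  apply: le_trans hd; apply: ler_sum => i _; rewrite GE.
  have yM : young (mixture Phi (J (s' i)) (m (s' i)) (lv (s' i))).
    by apply: young_mixture => //; exists (r (s' i))^-1; rewrite ?invr_gt0// r1.
  apply: (le_young yM); rewrite -/(be i) ler_pdivrMr//.
  have -> : x i = be i / (cE * (1 + M)) * rmin by rewrite /x mulrAC.
  by rewrite ler_wpM2l ?divr_ge0 ?(ltW cM0)//; case/andP: (rP (s' i)).
have xu (i : 'I_N) : x i / 2 * u <= G (s' i) (x i) / 2 + N%:R^-1 + kap.
  have Gi1 : G (s' i) (x i) <= 1.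
    apply: le_trans Gx; rewrite (bigD1 i)//= lerDl; apply: sumr_ge0 => i' _.
    exact: (young_ge0 (yG _)).
  have x1 := normalized_le1 (yG _) (G1 _) (x0 i) Gi1.
  have xh : 0 <= x i / 2 <= 2^-1 by rewrite divr_ge0//= ler_pdivrMr// mulVf.
  have := hk _ xh; have := hg (n0 + i)%N xh; have := hn (n0 + i)%N (leq_addr _ _).
  have h12 : 1 <= (2 : R) by rewrite ler1n.
  have := young_div (yG (s' i)) (x i) h12; rewrite -/(s' i) ltr_norml => ? ? /andP[? ?]; lra.
have sx : (\sum_(i < N) x i) * u <= 6.
  have : \sum_(i < N) x i / 2 * u <= \sum_(i < N) (G (s' i) (x i) / 2 + (N%:R^-1 + kap)).
    by apply: ler_sum => i _; rewrite addrA; exact: xu.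
  have E : \sum_(i < N) (N%:R^-1 + kap) = 1 + N%:R * kap.
    by rewrite sumr_const card_ord -[_ *+ N]mulr_natl mulrDr divff ?gt_eqF.
  rewrite big_split/= E -!mulr_suml [_ / 2 * u]mulrAC.
  by move=> hx; apply: copies_bound hx Gx Nk.
have sH : \sum_(i < N) H (s' i) v <= 2.
  have : \sum_(i < N) (H (s' i) v - N%:R^-1) <= \sum_(i < N) (v / qmin * be i -
      \sum_(j < J (s' i)) m (s' i) j * Phi (e i j)).
    by apply: ler_sum => i _; exact: (he i).2.
  have E : \sum_(i < N) (N%:R^-1 : R) = 1.
    by rewrite sumr_const card_ord -[_ *+ N]mulr_natl divff ?gt_eqF.
  rewrite !sumrB -/M E -mulr_sumr; apply: copies_bound' => //.
  rewrite mulr_suml.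
  suff -> : \sum_(i < N) be i * (rmin / (cE * (1 + M))) = \sum_(i < N) x i by [].
  by apply: eq_bigr => i _; rewrite /x mulrA.
have : \sum_(i < N) h v <= \sum_(i < N) (H (s' i) v + N%:R^-1).
  apply: ler_sum => i _; have := hh (n0 + i)%N hv; have := hn (n0 + i)%N (leq_addr _ _).
  rewrite -/(s' i) ltr_norml => ? /andP[? ?]; lra.
have E : \sum_(i < N) (N%:R^-1 : R) = 1.
  by rewrite sumr_const card_ord -[_ *+ N]mulr_natl divff ?gt_eqF.
rewrite big_split/= E sumr_const card_ord -[_ *+ N]mulr_natl => hN.
by apply: le_trans hN _; lra.
Qed.

(** Take about 1 / G^*(u) copies, or arbitrarily many when G^*(u) = 0. *)
Let conjugate_ge u : 0 < u -> u <= 1 -> c1 * u <= 2^-1 ->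
  ((h (c1 * u))%:E <= 6%:E * complementary (affine_extension g) u)%E.
Proof.
move=> u0 u1 cu; set k := complementary _ u.
have cu0 : 0 <= c1 * u by rewrite mulr_ge0// ltW.
have k1 : (k <= 1)%E.
  apply: (affine_young_conjugate gP.1) => //; first exact: ltW.
  move=> t ht; have /andP[g0 _] := gP.1 t ht; have /andP[t0 th] := ht.
  have : t * u <= 1 * 1 by rewrite ler_pM ?(ltW u0)//; lra.
  lra.
have kge t : 0 < t -> t <= 2^-1 -> ((t * u - g t)%:E <= k)%E.
  move=> t0 th; rewrite /k; apply: ereal_sup_ubound; exists t => //.
  by rewrite affine_extensionE /affine_real th -EFinB.
have g00 : g 0 = 0.
  have := gP.1 0; rewrite lexx invr_ge0 ler0n => /(_ isT) /andP[h1 h2].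
  by apply/eqP; rewrite eq_le h1 h2.
have k0 : (0 <= k)%E.
  apply/lee_addgt0Pr => e e0; pose t := Num.min 2^-1 e.
  have t0 : 0 < t by rewrite lt_min invr_gt0 ltr0n e0.
  have th : t <= 2^-1 by rewrite ge_min lexx.
  have te : t <= e by rewrite ge_min lexx orbT.
  have := kge t t0 th => /(leeD2r e%:E); apply: le_trans; rewrite -EFinD lee_fin.
  have := gP.1 t; rewrite (ltW t0) th => /(_ isT) /andP[_ gt].
  have : 0 <= t * u by rewrite mulr_ge0// ltW.
  lra.
have kf : k \is a fin_num by rewrite ge0_fin_numE// (le_lt_trans k1)// ltry.
set kap := fine k; have kE : k = kap%:E by rewrite fineK.
rewrite kE in k1 k0 kge *; rewrite !lee_fin in k1 k0 *.
have hk t : 0 <= t <= 2^-1 -> t * u <= g t + kap.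
  move=> /andP[]; rewrite le_eqVlt => /orP[/eqP <- _|t0 th].
    by rewrite mul0r g00 add0r.
  by have := kge t t0 th; rewrite lee_fin; lra.
have h0 : 0 <= h (c1 * u) by have := hP.1 (c1 * u); rewrite cu0 cu => /(_ isT) /andP[].
move: k0; rewrite le_eqVlt => /orP[/eqP kap0|kap0].
  rewrite -kap0 mulr0; apply/ler_addgt0Pr => e e0; rewrite add0r.
  pose N := (Num.bound (3 / e)).+1.
  have hN : 3 / e < N%:R.
    by rewrite (lt_trans (archi_boundP _)) ?divr_ge0 ?(ltW e0)// ltr_nat.
  have := @copies N u kap isT u0 cu hk; rewrite -kap0 mulr0 => /(_ ler01) h3.
  have NR : 0 < N%:R :> R by rewrite ltr0n.
  rewrite -(ler_pM2l NR); apply: le_trans h3 _.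
  by rewrite -ler_pdivrMr// ltW.
pose N := Num.truncn (kap^-1).
have ki : 1 <= kap^-1 by rewrite invf_ge1.
have /andP[N1 N2] := truncn_itv (ltW (lt_le_trans ltr01 ki)).
have N0 : (0 < N)%N.
  rewrite lt0n; apply/eqP => NE; move: N2; rewrite -/N NE; lra.
have Nk : N%:R * kap <= 1 by rewrite -ler_pdivlMr// mul1r.
have := copies N0 u0 cu hk Nk => h3.
have NR : 1 <= N%:R :> R by rewrite ler1n.
have : 1 <= 2 * (N%:R * kap).
  move: N2; rewrite -/N -[N.+1%:R]natr1 => N2.
  have : 1 < (N%:R + 1) * kap by rewrite -ltr_pdivrMr// mul1r.
  have : (N%:R + 1) * kap <= 2 * N%:R * kap by rewrite ler_wpM2r ?(ltW kap0)//; lra.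
  lra.
move=> h4; have Np : 0 < N%:R :> R by exact: lt_le_trans NR.
rewrite -(ler_pM2l Np); apply: le_trans h3 _; lra.
Qed.

Let near_zero : equivalent_near_zero (complementary (affine_extension g)) (affine_extension h).
Proof.
pose k := Num.max c0^-1 c1^-1.
have kc0 : c0^-1 <= k by rewrite le_max lexx.
have kc1 : c1^-1 <= k by rewrite le_max lexx orbT.
have k0 : 0 < k by rewrite (lt_le_trans _ kc0)// invr_gt0.
pose t0 := Num.min 1 (Num.min (2 * k)^-1 (Num.min (k / 2) (2 * c1)^-1)).
have t00 : 0 < t0 by rewrite !lt_min ltr01/= invr_gt0 mulr_gt0//= divr_gt0//= invr_gt0 mulr_gt0.
exists 6, k, t0; split => // t /andP[tge0 tt0].
have t1 : t <= 1 by rewrite (le_trans tt0)// ge_min lexx.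
have t2 : k * t <= 2^-1.
  have : t <= (2 * k)^-1 by rewrite (le_trans tt0)// !ge_min lexx !orbT.
  by rewrite invfM ler_pdivlMr// mulrC.
have t3 : k^-1 * t <= 2^-1.
  have : t <= k / 2 by rewrite (le_trans tt0)// !ge_min lexx !orbT.
  by rewrite ler_pdivrMl.
have t4 : c1 * t <= 2^-1.
  have : t <= (2 * c1)^-1 by rewrite (le_trans tt0)// !ge_min lexx !orbT.
  by rewrite invfM ler_pdivlMr// mulrC.
have tc : t / c0 <= k * t by rewrite mulrC ler_wpM2r.
have hE x : x <= 2^-1 -> affine_extension h x = (h x)%:E.
  by move=> hx; rewrite affine_extensionE /affine_real hx.
have kt0 : 0 <= k * t by rewrite mulr_ge0// ltW.
have hkt0 : 0 <= h (k * t) by have := hP.1 (k * t); rewrite kt0 t2 => /(_ isT) /andP[].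
split; last first.
  rewrite hE//; apply: le_trans (conjugate_le tge0 t1 (le_trans tc t2)) _.
  rewrite -EFinM lee_fin; apply: (@le_trans _ _ (h (k * t))).
    by apply: hP.2 => //; rewrite divr_ge0// ltW.
  by lra.
have [t0'|tp] := eqVneq t 0.
  rewrite t0' mulr0 hE ?invr_ge0//.
  have h00 : h 0 = 0.
    have := hP.1 0; rewrite lexx invr_ge0 ler0n => /(_ isT) /andP[h1 h2].
    by apply/eqP; rewrite eq_le h1 h2.
  rewrite h00 mule0; apply/lee_addgt0Pr => e e0.
  pose x := Num.min 2^-1 e.
  have x0 : 0 < x by rewrite lt_min invr_gt0 ltr0n e0.
  have xh : x <= 2^-1 by rewrite ge_min lexx.
  have xe : x <= e by rewrite ge_min lexx orbT.
  apply: (@le_trans _ _ ((- g x)%:E + e%:E)%E).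
    rewrite -EFinD lee_fin; have := gP.1 x; rewrite (ltW x0) xh => /(_ isT) /andP[_ gx]; lra.
  apply: leeD2r; apply: ereal_sup_ubound; exists x => //.
  by rewrite affine_extensionE /affine_real xh -EFinB mulr0 sub0r.
have tgt0 : 0 < t by rewrite lt_neqAle eq_sym tp.
have kt : k^-1 * t <= c1 * t.
  by rewrite ler_wpM2r// -[leRHS]invrK lef_pV2 ?posrE ?invr_gt0.
have := conjugate_ge tgt0 t1 t4; rewrite hE//.
set C := complementary _ t => hC.
rewrite -(@lee_pmul2l _ 6%:E)// muleA -EFinM divff ?mul1e ?pnatr_eq0//.
apply: le_trans hC; rewrite mul1r lee_fin; apply: hP.2 => //.
by rewrite mulr_ge0// invr_ge0 ltW.
Qed.

Lemma limit_gauge : sublinear_gauge g.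
Proof. exact: (limit_props (fun i => conj (yG (s i)) (G1 (s i))) hg). Qed.

Lemma limit_conclusion :
  [/\ C_infty F (affine_extension g),
      C_infty (complementary F) (affine_extension h) &
      equivalent_near_zero (complementary (affine_extension g)) (affine_extension h)].
Proof.
split; last exact: near_zero.
- apply: (@C_infty_mixture _ F (J \o s) (m \o s) (sr \o s) g eps oF) => //=.
  + by move=> i; exact: G1.
  + move=> b; have [i0 hi] := levels_G b; exists i0 => i j ii _ _.
    by apply: hi; exact: leq_trans ii (s_ge i).
- apply: (@C_infty_mixture _ _ (J \o s) (m \o s) (sg \o s) h eps oFs) => //=.
  + by move=> i; exact: H1.
  + move=> b; have [i0 hi] := levels_H b; exists i0 => i j ii _.
    by apply: hi; exact: leq_trans ii (s_ge i).
Qed.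

End limit.

(** The numbers m_ij are measures of pieces, lv_ij the values of |y_i| on them and
    w_ij the weights of the pieces. The limit g of the mixtures of F and the limit
    h of the mixtures of F^* at the densities tau_ij are complementary to each
    other: Young's inequality bounds g^* by h, and mix_dual, applied to near
    maximizers on many indices at once, bounds h by g^*. *)
Theorem mixture_duality : exists (s : nat -> nat) (g h : R -> R) (rr : nat -> R),
  [/\ {homo s : i j / (i < j)%N} /\ forall i, rmin <= rr i <= B,
      forall i, young (fun t => mixture Phi (J i) (m i) (lv i) (t / rr i)) /\
        mixture Phi (J i) (m i) (lv i) (1 / rr i) = 1,
      forall i (t : R), 0 <= t <= 2^-1 ->
        `|mixture Phi (J (s i)) (m (s i)) (lv (s i)) (t / rr (s i)) - g t| < 2^-1 ^+ i.+2,
      sublinear_gauge g &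
      [/\ C_infty F (affine_extension g),
          C_infty (complementary F) (affine_extension h) &
          equivalent_near_zero (complementary (affine_extension g)) (affine_extension h)]].
Proof.
have [|||s [g [h [s1 hg hh]]]] := @common_limit R G H (fun i => 2^-1 ^+ i.+2).
- by move=> i; rewrite exprn_gt0// invr_gt0.
- by move=> i; split; [exact: yG|exact: G1].
- by move=> i; split; [exact: yH|exact: H1].
have GE' i : G i = (fun t => mixture Phi (J i) (m i) (lv i) (t / r i)).
  by apply/funext => t; exact: GE.
exists s, g, h, r; split => //.
- by move=> i; split; [rewrite -GE'; exact: yG|rewrite -GE; exact: G1].
- by move=> i t ht; rewrite -GE; exact: hg.
- exact: (limit_gauge hg).
- exact: (limit_conclusion s1 hg hh).
Qed.

End duality.

(** * Sequence spaces given by a gauge *)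
Section gauge_sequences.
Set Implicit Arguments.
Unset Strict Implicit.
Context {R : realType} {k : scalar_kind}.
Local Notation K := (Defs.scalar R k).

(** Both the space l_2, with A (t) = t^2, and Orlicz sequence spaces have the unit
    ball described by a gauge A. *)
Definition gauge_le (A : R -> R) (t : R) (a : nat -> K) : Prop :=
  forall N, \sum_(i < N) A (modulus (a i) / t) <= 1.

Lemma nneseries_le1 (f : nat -> R) : (forall i, 0 <= f i) ->
  (\sum_(0 <= i <oo) (f i)%:E <= 1)%E <-> forall N, \sum_(i < N) f i <= 1.
Proof.
move=> f0; have f0' i : (0 <= (f i)%:E)%E by rewrite lee_fin.
split=> [h N|h].
  rewrite -lee_fin; apply: le_trans h; rewrite -sumEFin.
  by rewrite -(big_mkord xpredT (fun i => (f i)%:E)); exact: nneseries_lim_ge.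
apply: nneseries_bounded => // n; rewrite big_mkord sumEFin lee_fin; exact: h.
Qed.

Lemma sum_cut_le (f : nat -> R) n N : (forall i, 0 <= f i) ->
  \sum_(i < N) (if (i < n)%N then f i else 0) <= \sum_(i < n) f i.
Proof.
move=> f0; rewrite -(big_mkord xpredT (fun i => if (i < n)%N then f i else 0)).
have [nN|Nn] := leqP n N.
  rewrite (big_cat_nat (n := n))//= [X in _ + X]big1_seq ?addr0.
    rewrite big_mkord le_eqVlt; apply/orP; left; apply/eqP.
    by apply: eq_bigr => i _; rewrite ltn_ord.
  by move=> i; rewrite mem_index_iota => /andP[_ /andP[Ni _]]; rewrite ltnNge Ni.
rewrite -(big_mkord xpredT f) [leRHS](big_cat_nat (n := N))//=; last exact: ltnW.
apply: ler_wpDr; first by apply: sumr_ge0 => i _.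
by rewrite !big_mkord; apply: ler_sum => i _; rewrite (ltn_trans (ltn_ord i)).
Qed.

Variable A : R -> R.
Hypothesis A_ge0 : forall t, 0 <= t -> 0 <= A t.
Hypothesis A_mono : forall s t, 0 <= s -> s <= t -> A s <= A t.
Hypothesis A_quarter : forall t, 0 <= t -> A t <= 1 -> A (t / 4) <= A t / 2.
Hypothesis A_le : forall t : R, 0 <= t <= 2^-1 -> A t <= t.

Let A0 : A 0 = 0.
Proof.
apply/eqP; rewrite eq_le A_ge0// andbT; apply: A_le.
by rewrite lexx invr_ge0 ler0n.
Qed.

Let Am (a : K) t : 0 < t -> 0 <= A (modulus a / t).
Proof. by move=> t0; rewrite A_ge0// divr_ge0 ?modulus_ge0// ltW. Qed.

Lemma gauge_le_solid t (a b : nat -> K) : 0 < t ->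
  (forall i, modulus (a i) <= modulus (b i)) -> gauge_le A t b -> gauge_le A t a.
Proof.
move=> t0 ab hb N; apply: le_trans (hb N); apply: ler_sum => i _; apply: A_mono.
  by rewrite divr_ge0 ?modulus_ge0// ltW.
by rewrite ler_pM2r ?invr_gt0.
Qed.

Lemma gauge_le_truncate t (a : nat -> K) N : 0 < t ->
  gauge_le A t (truncate a N) <-> \sum_(i < N) A (modulus (a i) / t) <= 1.
Proof.
move=> t0; split=> [/(_ N)|h M].
  by under eq_bigr do rewrite /truncate ltn_ord.
apply: le_trans h; have h i : A (modulus (truncate a N i) / t) =
    if (i < N)%N then A (modulus (a i) / t) else 0.
  by rewrite /truncate; case: ifP; rewrite ?modulus0 ?mul0r.
under eq_bigr do rewrite h.
by apply: (sum_cut_le (f := fun i => A (modulus (a i) / t))) => i; exact: Am.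
Qed.

(** Enlarging t four times halves the sum over the tail, and a finite number of
    terms is made small by enlarging t further. *)
Lemma gauge_le_tail t (a b : nat -> K) n : 0 < t -> gauge_le A t b ->
  exists2 t', 0 < t' & gauge_le A t' (b - truncate a n).
Proof.
move=> t0 hb; pose S := \sum_(i < n) modulus (b i - a i).
have S0 : 0 <= S by apply: sumr_ge0 => i _; exact: modulus_ge0.
pose t' := 4 * t + 2 * S; have t'0 : 0 < t' by rewrite /t'; lra.
exists t' => // N; pose d i := (b - truncate a n) i : K.
have dE i : d i = if (i < n)%N then b i - a i else b i.
  by rewrite /d /truncate !fctE/=; case: ifP; rewrite ?subr0.
have hd i : A (modulus (d i) / t') <=
    (if (i < n)%N then modulus (b i - a i) / t' else 0) + A (modulus (b i) / t) / 2.
  have bt : 0 <= modulus (b i) / t by rewrite divr_ge0 ?modulus_ge0// ltW.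
  rewrite dE; case: ifPn => ni.
    apply: ler_wpDr; first by rewrite divr_ge0// Am.
    apply: A_le; rewrite divr_ge0 ?modulus_ge0 ?(ltW t'0)//= ler_pdivrMr//.
    have : modulus (b i - a i) <= S.
      rewrite /S (bigD1 (Ordinal ni))//= lerDl.
      by apply: sumr_ge0 => j _; exact: modulus_ge0.
    by rewrite /t'; lra.
  rewrite add0r; apply: le_trans (A_quarter bt _); last first.
    apply: le_trans (hb i.+1); rewrite big_ord_recr/= lerDr.
    by apply: sumr_ge0 => j _; exact: Am.
  apply: A_mono; first by rewrite divr_ge0 ?modulus_ge0// ltW.
  rewrite -mulrA ler_wpM2l ?modulus_ge0// -invfM lef_pV2 ?posrE ?mulr_gt0//.
  by rewrite /t'; lra.
apply: (@le_trans _ _ (\sum_(i < N) ((if (i < n)%N then modulus (b i - a i) / t' else 0) + A (modulus (b i) / t) / 2))).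
  by apply: ler_sum => i _; exact: hd.
rewrite big_split/= -mulr_suml.
have h1 : \sum_(i < N) (if (i < n)%N then modulus (b i - a i) / t' else 0) <= S / t'.
  rewrite /S mulr_suml.
  apply: (sum_cut_le (f := fun i => modulus (b i - a i) / t')) => i.
  by rewrite divr_ge0 ?modulus_ge0// ltW.
have h2 : S / t' <= 2^-1 by rewrite ler_pdivrMr// /t'; lra.
have := hb N; lra.
Qed.

Variables (car : set (nat -> K^o)) (nY : (nat -> K^o) -> R).
Hypothesis nY_ge0 : forall a, car a -> 0 <= nY a.
Hypothesis gauge_nY : forall (a : nat -> K) t, 0 < t -> gauge_le A t a -> car a /\ nY a <= t.
Hypothesis nY_gauge : forall (a : nat -> K) t, car a -> nY a < t -> gauge_le A t a.

Lemma equivalent_gauge (X : nspace R K) (x : nat -> X) (c : R) :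
  seminormed X -> complete X -> basic_sequence x -> spreading x -> unconditional x ->
  0 < c ->
  (forall (a : nat -> K) N (t : R), 0 < t -> \sum_(i < N) A (modulus (a i) / t) <= 1 ->
     nrm (partial_sum x a N) <= c * t) ->
  (forall (a : nat -> K) N (t : R), nrm (partial_sum x a N) < t ->
     \sum_(i < N) A (modulus (a i) / (c * t)) <= 1) ->
  equivalent x (unit_vector R k : nat -> @NSpace R K (nat -> K^o) car nY).
Proof.
move=> sX kX bx spx ux c0 h1 h2.
have cx i : carrier (x i) by case: bx.
have n0 a N : 0 <= nrm (partial_sum x a N).
  by apply: (nrm_ge0 sX); exact: carrier_partial_sum.
have trunc_in a N t : nrm (partial_sum x a N) < t -> gauge_le A (c * t) (truncate a N).
  move=> h; apply/gauge_le_truncate; last exact: h2.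
  by rewrite mulr_gt0// (le_lt_trans (n0 a N)).
have carT a N : car (truncate a N).
  have h : nrm (partial_sum x a N) < nrm (partial_sum x a N) + 1 by rewrite ltrDl.
  apply: (gauge_nY _ (trunc_in _ _ _ h)).1.
  by rewrite mulr_gt0// (le_lt_trans (n0 a N)).
have car_gauge a : car a -> exists2 t, 0 < t & gauge_le A t a.
  move=> ca; exists (nY a + 1); first by rewrite ltr_wpDl ?nY_ge0.
  by apply: nY_gauge; rewrite ?ltrDl.
apply: (equivalent_unit_vector sX kX bx spx ux nY_ge0 _ _ _ _ c0).
- move=> a b cb ab; have [t t0 /(gauge_le_solid t0 ab) /(gauge_nY t0)[ca _]] := car_gauge b cb.
  split=> //; apply/ler_addgt0Pr => e e0.
  have t0' : 0 < nY b + e by rewrite ltr_wpDl ?nY_ge0.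
  apply: (gauge_nY t0' _).2; apply: (gauge_le_solid t0' ab).
  by apply: nY_gauge => //; rewrite ltrDl.
- move=> a d d0 h; have key e : 0 < e -> gauge_le A (d + e) a.
    move=> e0 N; have de : 0 < d + e by rewrite ltr_wpDl.
    apply/(gauge_le_truncate a N de); apply: nY_gauge; first by case: (h N).
    by apply: le_lt_trans (h N).2 _; rewrite ltrDl.
  have d1 : 0 < d + 1 by rewrite ltr_wpDl.
  split; first exact: (gauge_nY d1 (key _ ltr01)).1.
  apply/ler_addgt0Pr => e e0; apply: (gauge_nY _ (key e e0)).2.
  by rewrite ltr_wpDl.
- move=> a b n cb; have [t t0 /(gauge_le_tail a n t0)[t' t'0 /(gauge_nY t'0)[]]] := car_gauge b cb.
  by [].
- have := carT 0 0%N; congr car; by apply/funext => i; rewrite /truncate if_same.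
- move=> a N; apply/ler_addgt0Pr => e e0.
  have ec : 0 < e / c by rewrite divr_gt0.
  have h : nrm (partial_sum x a N) < nrm (partial_sum x a N) + e / c by rewrite ltrDl.
  have := (gauge_nY _ (trunc_in _ _ _ h)).2; rewrite mulrDr [c * (e / c)]mulrC divfK ?gt_eqF//.
  by apply; rewrite ltr_wpDl// mulr_ge0// ltW.
- move=> a N; apply/ler_addgt0Pr => e e0.
  have ec : 0 < e / c by rewrite divr_gt0.
  have nt : 0 <= nY (truncate a N) by exact: nY_ge0.
  have t0 : 0 < nY (truncate a N) + e / c by rewrite ltr_wpDl.
  have h : gauge_le A (nY (truncate a N) + e / c) (truncate a N).
    by apply: nY_gauge => //; rewrite ltrDl.
  have := h1 a N _ t0 ((gauge_le_truncate a N t0).1 h).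
  by rewrite mulrDr [c * (e / c)]mulrC divfK ?gt_eqF.
Qed.

End gauge_sequences.

Section sequence_models.
Set Implicit Arguments.
Unset Strict Implicit.
Context {R : realType} {k : scalar_kind}.
Local Notation K := (Defs.scalar R k).
Variables (X : nspace R K) (x : nat -> X) (c : R).
Hypotheses (sX : seminormed X) (kX : complete X).
Hypotheses (bx : basic_sequence x) (spx : spreading x) (ux : unconditional x).
Hypothesis c0 : 0 < c.

Lemma equivalent_ell2 :
  (forall (a : nat -> K) N,
     nrm (partial_sum x a N) <= c * Num.sqrt (\sum_(i < N) modulus (a i) ^+ 2) /\
     Num.sqrt (\sum_(i < N) modulus (a i) ^+ 2) <= c * nrm (partial_sum x a N)) ->
  equivalent x (unit_vector R k : nat -> ell2 R k).
Proof.
move=> h; pose sq (t : R) := t ^+ 2.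
have sqE (a : nat -> K) N t : 0 < t ->
    \sum_(i < N) sq (modulus (a i) / t) = (\sum_(i < N) modulus (a i) ^+ 2) / t ^+ 2.
  by move=> t0; rewrite mulr_suml; apply: eq_bigr => i _; rewrite /sq exprMn exprVn.
have sq1 (a : nat -> K) N t : 0 < t -> (\sum_(i < N) sq (modulus (a i) / t) <= 1) =
    (\sum_(i < N) modulus (a i) ^+ 2 <= t ^+ 2).
  by move=> t0; rewrite sqE// ler_pdivrMr ?exprn_gt0// mul1r.
have s0 (a : nat -> K) i : 0 <= modulus (a i) ^+ 2 by rewrite sqr_ge0.
have S0 (a : nat -> K) : (0 <= sum_squares a)%E by apply: nneseries_ge0 => i _ _; rewrite lee_fin.
have gaugeE (a : nat -> K) t : 0 < t -> gauge_le sq t a <-> (sum_squares a <= (t ^+ 2)%:E)%E.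
  move=> t0; split=> [g|g N].
    apply: nneseries_bounded => [i|n]; first by rewrite lee_fin.
    by rewrite big_mkord sumEFin lee_fin -sq1.
  rewrite sq1// -lee_fin -sumEFin; apply: le_trans g.
  by rewrite -(big_mkord xpredT (fun i => (modulus (a i) ^+ 2)%:E)); apply: nneseries_lim_ge => i _ _; rewrite lee_fin.
apply: (@equivalent_gauge R k sq _ _ _ _ _ _ _ _ _ X x c) => //.
- by move=> t _; exact: sqr_ge0.
- by move=> s t s0' st; rewrite /sq lerXn2r ?nnegrE//; exact: le_trans st.
- move=> t t0 _; rewrite /sq exprMn exprVn; have := sqr_ge0 t; lra.
- move=> t /andP[t0 th]; rewrite /sq expr2 ler_piMr//; lra.
- move=> a t t0 /(gaugeE _ _ t0) g; have fa : (sum_squares a < +oo)%E by rewrite (le_lt_trans g)// ltry.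
  split=> //=; rewrite -[leRHS](ger0_norm (ltW t0)) -sqrtr_sqr ler_wsqrtr//.
  by rewrite -lee_fin fineK// ge0_fin_numE.
- move=> a t /= fa lt; have t0 : 0 < t by rewrite (le_lt_trans _ lt)// sqrtr_ge0.
  apply/(gaugeE _ _ t0); rewrite -(fineK (_ : sum_squares a \is a fin_num)) ?ge0_fin_numE//.
  rewrite lee_fin -(sqr_sqrtr (fine_ge0 (S0 a))) lerXn2r ?nnegrE ?sqrtr_ge0 ?(ltW t0)//.
  exact: ltW.
- move=> a N t t0; rewrite sq1// => hs; apply: le_trans (h a N).1 _.
  by rewrite ler_wpM2l ?(ltW c0)// -[leRHS](ger0_norm (ltW t0)) -sqrtr_sqr ler_wsqrtr.
- move=> a N t ht; have n0 : 0 <= nrm (partial_sum x a N).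
    by apply: (nrm_ge0 sX); apply: (carrier_partial_sum sX); case: bx.
  have t0 : 0 < t by exact: le_lt_trans ht.
  have S1 : 0 <= \sum_(i < N) modulus (a i) ^+ 2 by exact: sumr_ge0.
  rewrite sq1 ?mulr_gt0// -(sqr_sqrtr S1) lerXn2r ?nnegrE ?sqrtr_ge0 ?mulr_ge0 ?(ltW c0) ?(ltW t0)//.
  by apply: le_trans (h a N).2 _; rewrite ler_wpM2l ?(ltW c0)// ltW.
Qed.

Lemma equivalent_ell_orlicz (g : R -> R) : sublinear_gauge g ->
  (forall (a : nat -> K) N (t : R), 0 < t ->
     \sum_(i < N) affine_real g (modulus (a i) / t) <= 1 ->
     nrm (partial_sum x a N) <= c * t) ->
  (forall (a : nat -> K) N (t : R), nrm (partial_sum x a N) < t ->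
     \sum_(i < N) affine_real g (modulus (a i) / (c * t)) <= 1) ->
  equivalent x (unit_vector R k : nat -> ell_ k (affine_extension g)).
Proof.
move=> [g1 g2 g3] h1 h2.
have A0 t : 0 <= t -> 0 <= affine_real g t by exact: affine_real_ge0.
have Am s t : 0 <= s -> s <= t -> affine_real g s <= affine_real g t by exact: le_affine_real.
have gaugeE (a : nat -> K) t : 0 < t -> gauge_le (affine_real g) t a <->
    (\sum_(0 <= n <oo) affine_extension g (modulus (a n) / t)%R <= 1)%E.
  move=> t0; apply: iff_sym; apply: (@nneseries_le1 R (fun n => affine_real g (modulus (a n) / t))) => i.
  by rewrite A0// divr_ge0 ?modulus_ge0// ltW.
have n0 (a : nat -> K) : (0 <= luxemburg_seq (affine_extension g) a)%E.
  by apply: le_ereal_inf_tmp => _ [t [t0 _] <-]; rewrite lee_fin ltW.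
apply: (@equivalent_gauge R k (affine_real g) _ _ _ _ _ _ _ _ _ X x c) => //.
- move=> t t0 At; have t1 := affine_real_le1 g1 t0 At.
  have h0 : 0 <= t / 2 <= 2^-1 by rewrite divr_ge0//; lra.
  have t4 : t / 4 = t / 2 / 2 by field.
  have := g3 _ h0; rewrite -t4 => h3.
  have e1 : affine_real g (t / 4) = g (t / 4) by rewrite /affine_real ifT//; lra.
  have e2 : affine_real g (t / 2) = g (t / 2) by rewrite /affine_real ifT//; lra.
  have : affine_real g (t / 2) <= affine_real g t by apply: Am; lra.
  rewrite e1 e2; lra.
- by move=> t ht; rewrite /affine_real ifT; case/andP: (ht) => // _ _; case/andP: (g1 _ ht).
- by move=> a _; exact: fine_ge0.
- move=> a t t0 /(gaugeE _ _ t0) ga.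
  have lt : (luxemburg_seq (affine_extension g) a <= t%:E)%E by apply: ereal_inf_lbound; exists t.
  have fa : (luxemburg_seq (affine_extension g) a < +oo)%E by rewrite (le_lt_trans lt)// ltry.
  by split=> //=; rewrite -lee_fin fineK// ge0_fin_numE.
- move=> a t /= fa lt.
  have : (luxemburg_seq (affine_extension g) a < t%:E)%E.
    by rewrite -(fineK (_ : luxemburg_seq (affine_extension g) a \is a fin_num)) ?lte_fin// ge0_fin_numE.
  move=> /ereal_inf_lt[_ [s [s0 /(gaugeE _ _ s0) hs] <-]]; rewrite lte_fin => st N.
  have t0 : 0 < t := lt_trans s0 st.
  apply: le_trans (hs N); apply: ler_sum => i _; apply: Am.
    by rewrite divr_ge0 ?modulus_ge0// ltW.
  by rewrite ler_wpM2l ?modulus_ge0// lef_pV2 ?posrE// ltW.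
Qed.

End sequence_models.

(** * Disjoint pieces produce an Orlicz sequence space *)
Section disjoint_sequence.
Set Implicit Arguments.
Unset Strict Implicit.
Context {R : realType} {k : scalar_kind}.
Local Notation K := (Defs.scalar R k).
Local Notation D := (`[0, 1[%classic : set R).
Local Notation mu := (@lebesgue_measure R).
Variable F : R -> \bar R.
Hypothesis oF : finite_orlicz F.
Hypothesis oFs : finite_orlicz (complementary F).
Local Notation Phi := (real_form F).
Local Notation L := (L_ k F).

Let yP : young Phi := young_real_form oF.
Let sL : seminormed L := L_seminormed oF.
Let P0 := young_ge0 yP.

Variables (y : nat -> L) (psi : nat -> L -> K) (C b B : R).
Hypothesis uy : usystem y psi C.
Hypothesis b0 : 0 < b.
Hypothesis yb : forall i, b <= nrm (y i) <= B.
Variables (E : nat -> nat -> set R) (s : nat -> nat -> R) (J : nat -> nat).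
Hypothesis mE : forall i j, measurable (E i j).
Hypothesis ED : forall i j, E i j `<=` D.
Hypothesis disjE : forall x i j i' j', E i j x -> E i' j' x -> i = i' /\ j = j'.
Hypothesis sE : forall i j x, E i j x ->
  s i j < modulus (y i x : K) <= 2 * s i j.
Hypothesis s0 : forall i j, 0 < s i j.
Hypothesis s_infty : forall X, exists i0, forall i j, (i0 <= i)%N -> X <= s i j.

Local Notation m := (piece_measure E).
Local Notation w := (piece_weight y psi E).
Hypothesis wS : forall i, 4^-1 <= \sum_(j < J i) w i j.

Let C0 : 0 < C := usys_gt0 uy.
Let ny i : 0 < nrm (y i). Proof. by case/andP: (yb i) => h _; exact: lt_le_trans h. Qed.
Let B0 : 0 < B. Proof. by case/andP: (yb 0%N) => h1 h2; exact: lt_le_trans (le_trans h1 h2). Qed.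
Let w0 i j : 0 <= w i j. Proof. exact: modulus_ge0. Qed.
Let m0 i j : 0 <= m i j. Proof. exact: piece_measure_ge0. Qed.

Local Notation mix i := (mixture Phi (J i) (m i) (s i)).

Let lower (sg : nat -> nat) N (a : nat -> K) t : injective sg ->
  nrm (partial_sum (y \o sg) a N) < t ->
  \sum_(i < N) mix (sg i) (modulus (a i) / (2 * C * t)) <= 1.
Proof.
move=> sgI h; pose E' i := E (sg i); pose s' i := s (sg i).
have dE x i j i' j' : E' i j x -> E' i' j' x -> i = i' /\ j = j'.
  by move=> h1 h2; have [/sgI -> ->] := disjE h1 h2.
have sE' i j x : E' i j x -> s' i j < modulus ((y \o sg) i x : K) <= 2 * s' i j by exact: sE.
have := pieces_lower oF (usystem_comp sgI uy) (J \o sg) (fun i => mE (sg i))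
  (fun i => @ED (sg i)) dE sE' h.
apply: le_trans; rewrite le_eqVlt; apply/orP; left; apply/eqP.
apply: eq_bigr => i _; apply: eq_bigr => j _; rewrite /E' /s' /= mulrC; congr (Phi _ * _).
by rewrite mulrCA mulrA.
Qed.

Let upper (sg : nat -> nat) N (a : nat -> K) (al : nat -> nat -> R) t : injective sg ->
  0 < t -> (forall i j, 0 <= al i j) ->
  \sum_(i < N) \sum_(j < J (sg i)) m (sg i) j * Phi (modulus (a i) * (al i j * s (sg i) j) / t) <= 1 ->
  nrm (partial_sum (y \o sg) (fun i => a i *
    scalar_of k (\sum_(j < J (sg i)) al i j * w (sg i) j) 0) N) <= 4 * C * t.
Proof.
move=> sgI t0 al0 h; pose E' i := E (sg i); pose s' i := s (sg i).
have t20 : 0 < 2 * t by rewrite mulr_gt0.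
have dE x i j i' j' : E' i j x -> E' i' j' x -> i = i' /\ j = j'.
  by move=> h1 h2; have [/sgI -> ->] := disjE h1 h2.
have sE' i j x : E' i j x -> s' i j < modulus ((y \o sg) i x : K) <= 2 * s' i j by exact: sE.
have := @pieces_upper _ _ _ oF _ _ _ (usystem_comp sgI uy) E' s' (J \o sg) (fun i => mE (sg i))
  (fun i => @ED (sg i)) dE sE' N a al _ t20 al0.
have -> : 2 * C * (2 * t) = 4 * C * t by ring.
apply; apply: le_trans h; rewrite le_eqVlt; apply/orP; left; apply/eqP.
apply: eq_bigr => i _; apply: eq_bigr => j _; rewrite /E' /s' /= mulrC; congr (_ * Phi _).
by field; rewrite gt_eqF.
Qed.

Let single i (c : K) : partial_sum (y \o addn i) (fun=> c) 1 = c *: y i.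
Proof. by rewrite /partial_sum big_ord1 /= addn0. Qed.

(* The pieces are disjoint subsets of [0, 1). *)
Let m1 i : \sum_(j < J i) m i j <= 1.
Proof.
have tr : trivIset setT (E i).
  by move=> j j' _ _ [x [h1 h2]]; case: (disjE h1 h2).
rewrite -lee_fin -sumEFin.
rewrite (eq_bigr (fun j : 'I_(J i) => mu (E i j))) => [|j _]; last first.
  rewrite /piece_measure fineK// ge0_fin_numE ?measure_ge0//.
  apply: (@le_lt_trans _ _ (mu D)); last by rewrite mu_unit_itv ltry.
  apply: le_measure; rewrite ?inE; [exact: mE|exact: measurable_unit_itv|exact: ED].
rewrite -(big_mkord xpredT (fun j => mu (E i j))) big_mkord -measure_bigsetU//.
rewrite -mu_unit_itv; apply: le_measure; rewrite ?inE.
- by apply: bigsetU_measurable => j _; exact: mE.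
- exact: measurable_unit_itv.
- by rewrite -bigcup_mkord => x [j _ h]; exact: (ED h).
by move=> j; exact: mE.
Qed.

Let Bmix := 2 * C * (B + 1).
Let Bmix0 : 0 < Bmix. Proof. by rewrite !mulr_gt0// addr_gt0. Qed.

(* Lower estimate for a single vector, of norm at most B. *)
Let mix_B i : mix i Bmix^-1 <= 1.
Proof.
have h : nrm (partial_sum (y \o addn i) (fun=> 1) 1) < B + 1.
  by rewrite single scale1r; case/andP: (yb i) => _ h; rewrite (le_lt_trans h)// ltrDl.
by have := lower (@addnI i) h; rewrite big_ord1 /= addn0 modulus1 mul1r.
Qed.

Let rmin := b / (16 * C).
Let rmin0 : 0 < rmin. Proof. by rewrite divr_gt0// mulr_gt0. Qed.

(* Upper estimate for a single vector, of norm at least b. *)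
Let mix_rmin i r : 0 < r -> mix i r^-1 <= 1 -> rmin <= r.
Proof.
move=> r0 h; have := @upper (addn i) 1 (fun=> 1) (fun _ _ => 1) r (@addnI i) r0 (fun _ _ => @ler01 R).
rewrite big_ord1 addn0; under eq_bigr do rewrite modulus1 !mul1r.
move=> /(_ h); rewrite /partial_sum big_ord1 mul1r.
rewrite (_ : (y \o addn i) _ = y i); last by rewrite /comp addn0.
rewrite (nrmZ sL _ (usys_carrier uy i)).
under eq_bigr do rewrite mul1r.
rewrite modulus_scalar_of ger0_norm; last by apply: sumr_ge0.
move=> h2; rewrite ler_pdivrMr ?mulr_gt0//.
have : 4^-1 * b <= 4 * C * r.
  by apply: le_trans h2; rewrite ler_pM ?invr_ge0 ?(ltW b0)//; case/andP: (yb i).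
lra.
Qed.

Let cE := 16 * C ^+ 2.
Let cE0 : 0 < cE. Proof. by rewrite mulr_gt0 ?exprn_gt0. Qed.

(* Upper estimate for the coefficients produced by the test functions al, then
   lower estimate for the vector with these coefficients. *)
Let mix_dual (sg : nat -> nat) N (al : nat -> nat -> R) t :
  injective sg -> 0 < t -> (forall i j, 0 <= al i j) ->
  \sum_(i < N) \sum_(j < J (sg i)) m (sg i) j * Phi (al i j * s (sg i) j / t) <= 1 ->
  \sum_(i < N) mix (sg i) ((\sum_(j < J (sg i)) al i j * w (sg i) j) / (cE * t)) <= 1.
Proof.
move=> sgI t0 al0 h.
have := @upper sg N (fun=> 1) al t sgI t0 al0.
under eq_bigr do (under eq_bigr do rewrite modulus1 mul1r); move=> /(_ h) h1.
have Ct : 0 < C * t by rewrite mulr_gt0.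
have h2 : 4 * C * t < 8 * C * t by lra.
have := lower sgI (le_lt_trans h1 h2).
apply: le_trans; rewrite le_eqVlt; apply/orP; left; apply/eqP.
apply: eq_bigr => i _; rewrite mul1r modulus_scalar_of ger0_norm; last first.
  by apply: sumr_ge0 => j _; rewrite mulr_ge0.
by congr mixture; rewrite /cE; congr (_ / _); ring.
Qed.

Let half_powers N : \sum_(i < N) (2^-1 : R) ^+ i.+2 <= 2^-1.
Proof.
rewrite (eq_bigr (fun i : 'I_N => 2^-1 ^+ 2 * 2^-1 ^+ i)); last first.
  by move=> i _; rewrite -exprD.
rewrite -mulr_sumr -(big_mkord xpredT (fun i => 2^-1 ^+ i)) sum_half// expr0.
have : 0 <= (2^-1 : R) ^+ N by rewrite exprn_ge0// invr_ge0.
set e := _ ^+ N; rewrite expr2; lra.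
Qed.

(** The estimates for the mixtures G_i pass to their limit, because the errors
    2^-(i+2) add up to at most 1/2 and halving the argument halves the value. *)
Theorem disjoint_sequence_orlicz : exists (sg : nat -> nat) (g h : R -> R),
  [/\ {homo sg : i j / (i < j)%N}, sublinear_gauge g,
      [/\ C_infty F (affine_extension g),
          C_infty (complementary F) (affine_extension h) &
          equivalent_near_zero (complementary (affine_extension g)) (affine_extension h)] &
      exists2 c : R, 0 < c &
      (forall (a : nat -> K) N (t : R), 0 < t ->
         \sum_(i < N) affine_real g (modulus (a i) / t) <= 1 ->
         nrm (partial_sum (y \o sg) a N) <= c * t) /\
      (forall (a : nat -> K) N (t : R), nrm (partial_sum (y \o sg) a N) < t ->
         \sum_(i < N) affine_real g (modulus (a i) / (c * t)) <= 1)].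
Proof.
have mw i j : m i j = 0 -> w i j = 0 by exact: (piece_weight_null oF uy ny mE ED sE).
have [sg [g [h [r [[sgm rB] yG hg gg concl]]]]] := mixture_duality oF oFs m0 s0 w0 mw m1 wS
  s_infty Bmix0 mix_B rmin0 mix_rmin cE0 mix_dual.
exists sg, g, h; split => //.
have sgI : injective sg.
  move=> i j e; case: (ltngtP i j) => // /sgm; by rewrite e ltnn.
have [g1 g2 g3] := gg.
have r0 i : 0 < r i by case/andP: (rB i) => hh _; exact: lt_le_trans hh.
pose G i t := mix (sg i) (t / r (sg i)).
have yG' i : young (G i) by case: (yG (sg i)).
have G1 i : G i 1 = 1 by case: (yG (sg i)).
have h12 : 1 <= (2 : R) by rewrite ler1n.
have Gle1 N (x : nat -> R) : (forall i, 0 <= x i) -> \sum_(i < N) G i (x i) <= 1 ->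
    forall i : 'I_N, x i <= 1.
  move=> x0 hS i; apply: (normalized_le1 (yG' i) (G1 i)) => //; apply: le_trans hS.
  by rewrite (bigD1 i)//= lerDl; apply: sumr_ge0 => j _; exact: (young_ge0 (yG' j)).
have Ale1 N (x : nat -> R) : (forall i, 0 <= x i) ->
    \sum_(i < N) affine_real g (x i) <= 1 -> forall i : 'I_N, x i <= 1.
  move=> x0 hS i; apply: (affine_real_le1 g1) => //; apply: le_trans hS.
  by rewrite (bigD1 i)//= lerDl; apply: sumr_ge0 => j _; exact: affine_real_ge0.
have to_g N (x : nat -> R) : (forall i, 0 <= x i) -> \sum_(i < N) G i (x i) <= 1 ->
    \sum_(i < N) affine_real g (x i / 2) <= 1.
  move=> x0 hS; apply: (@le_trans _ _ (\sum_(i < N) (G i (x i) / 2 + 2^-1 ^+ i.+2))).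
    apply: ler_sum => i _; have x1 := Gle1 _ _ x0 hS i.
    have xh : 0 <= x i / 2 <= 2^-1 by rewrite divr_ge0//=; lra.
    rewrite /affine_real ifT; last by case/andP: xh.
    have := hg i _ xh; rewrite -/(G i (x i / 2)) ltr_norml => /andP[? ?].
    have := young_div (yG' i) (x i) h12; lra.
  rewrite big_split/= -mulr_suml; have := half_powers N; lra.
have to_G N (x : nat -> R) : (forall i, 0 <= x i) ->
    \sum_(i < N) affine_real g (x i) <= 1 -> \sum_(i < N) G i (x i / 4) <= 1.
  move=> x0 hS.
  apply: (@le_trans _ _ (\sum_(i < N) (affine_real g (x i) / 2 + 2^-1 ^+ i.+2))).
    apply: ler_sum => i _; have x1 := Ale1 _ _ x0 hS i.
    have xh : 0 <= x i / 2 <= 2^-1 by rewrite divr_ge0//=; lra.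
    have := hg i _ xh; rewrite -/(G i (x i / 2)) ltr_norml => /andP[? ?].
    have t4 : x i / 4 = x i / 2 / 2 by field.
    have := young_div (yG' i) (x i / 2) h12; rewrite -t4.
    have : affine_real g (x i / 2) <= affine_real g (x i).
      apply: le_affine_real => //; [by rewrite divr_ge0|by have := x0 i; lra].
    have -> : affine_real g (x i / 2) = g (x i / 2).
      by rewrite /affine_real ifT//; case/andP: xh.
    have : 0 <= (2^-1 : R) ^+ i.+2 by rewrite exprn_ge0// invr_ge0.
    lra.
  rewrite big_split/= -mulr_suml; have := half_powers N; lra.
pose c := 64 * C * Bmix + 4 * C / rmin.
have c10 : 0 < 64 * C * Bmix by rewrite mulr_gt0// mulr_gt0.
have c20 : 0 < 4 * C / rmin by rewrite divr_gt0// mulr_gt0.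
exists c; first exact: addr_gt0.
split=> [a N t t0 hS|a N t ht].
- have x0 i : 0 <= modulus (a i) / t by rewrite divr_ge0 ?modulus_ge0// ltW.
  have hG := to_G N _ x0 hS.
  pose W i := \sum_(j < J (sg i)) w (sg i) j.
  have W4 i : 4^-1 <= W i by exact: wS.
  have W0 i : 0 < W i by apply: lt_le_trans (W4 i); rewrite invr_gt0.
  have t'0 : 0 < 16 * t * Bmix by rewrite mulr_gt0// mulr_gt0.
  have al0 i (j : nat) : 0 <= (W i)^-1 by rewrite invr_ge0 ltW.
  have := @upper sg N a (fun i _ => (W i)^-1) _ sgI t'0 al0.
  have -> : partial_sum (y \o sg) (fun i => a i *
      scalar_of k (\sum_(j < J (sg i)) (W i)^-1 * w (sg i) j) 0) N = partial_sum (y \o sg) a N.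
    apply: eq_bigr => i _; rewrite -mulr_sumr -/(W i) mulVf ?gt_eqF//.
    by rewrite scalar_of1 mulr1.
  move=> hu; apply: le_trans (hu _) _.
    apply: le_trans hG; apply: ler_sum => i _; apply: ler_sum => j _.
    rewrite ler_wpM2l//; apply: (le_young yP).
    have /andP[_ rB'] := rB (sg i).
    have -> : modulus (a i) * ((W i)^-1 * s (sg i) j) / (16 * t * Bmix) =
        s (sg i) j * (modulus (a i) / t / 4) * ((4 * W i)^-1 * Bmix^-1).
      by field; rewrite !gt_eqF.
    have -> : s (sg i) j * (modulus (a i) / t / 4 / r (sg i)) =
        s (sg i) j * (modulus (a i) / t / 4) * (1 * (r (sg i))^-1) by ring.
    have sx0 : 0 <= s (sg i) j * (modulus (a i) / t / 4).
      by rewrite mulr_ge0 ?(ltW (s0 _ _))// divr_ge0.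
    have W41 : (4 * W i)^-1 <= 1.
      by rewrite invf_le1 ?mulr_gt0//; have := W4 i; lra.
    rewrite ler_wpM2l// ler_pM ?invr_ge0 ?(ltW Bmix0)//.
      by rewrite mulr_ge0// ltW.
    by rewrite lef_pV2 ?posrE.
  have -> : 4 * C * (16 * t * Bmix) = 64 * C * Bmix * t by ring.
  by rewrite ler_wpM2r ?(ltW t0)// lerDl ltW.
- have t0 : 0 < t.
    apply: le_lt_trans ht; apply: (nrm_ge0 sL); apply: (carrier_partial_sum sL).
    by move=> i; exact: (usys_carrier uy).
  pose x i := modulus (a i) / (2 * C * t) * rmin.
  have a0 i : 0 <= modulus (a i) / (2 * C * t).
    by rewrite divr_ge0 ?modulus_ge0// ltW// !mulr_gt0.
  have x0 i : 0 <= x i by rewrite mulr_ge0// ltW.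
  have hG : \sum_(i < N) G i (x i) <= 1.
    apply: le_trans (lower sgI ht); apply: ler_sum => i _.
    apply: ler_sum => j _; rewrite ler_wpM2l//; apply: (le_young yP).
    rewrite ler_wpM2l ?(ltW (s0 _ _))// /x ler_pdivrMr// ler_wpM2l//.
    by case/andP: (rB (sg i)).
  apply: le_trans (to_g N x x0 hG); apply: ler_sum => i _.
  have ct : 0 < c * t by rewrite mulr_gt0// addr_gt0.
  apply: (le_affine_real g1 g2); first by rewrite divr_ge0 ?modulus_ge0// ltW.
  have -> : x i / 2 = modulus (a i) / (4 * C / rmin * t).
    by rewrite /x; field; rewrite !gt_eqF.
  rewrite ler_wpM2l ?modulus_ge0// lef_pV2 ?posrE ?(mulr_gt0 c20 t0)//.
  by rewrite ler_wpM2r ?(ltW t0)// lerDr ltW.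
Qed.

End disjoint_sequence.

(** * Selection of disjoint pieces *)
Section truncation_estimates.
Set Implicit Arguments.
Unset Strict Implicit.
Context {R : realType} {k : scalar_kind}.
Local Notation K := (Defs.scalar R k).
Local Notation D := (`[0, 1[%classic : set R).
Local Notation mu := (@lebesgue_measure R).
Variable F : R -> \bar R.
Hypothesis oF : finite_orlicz F.
Local Notation Phi := (real_form F).
Local Notation L := (L_ k F).

Let yP : young Phi := young_real_form oF.
Let sL : seminormed L := L_seminormed oF.
Let P0 := young_ge0 yP.

Lemma integral_scaled_indic (E : set R) (c : R) : measurable E -> E `<=` D -> 0 <= c ->
  (\int[mu]_(x in D) (c * \1_E x)%:E = c%:E * mu E)%E.
Proof.
move=> mE ED c0.
have -> : (\int[mu]_(x in D) (c * \1_E x)%:E = \int[mu]_(x in D) (0 + c * (\1_E x : R))%:E)%E.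
  by apply: eq_integral => x _; rewrite add0r.
rewrite integral_affine_unit//.
by rewrite add0e integral_indic// (setIidl ED).
Qed.


Lemma nrm_cutoff_small (f : L) (E : set R) (M r t : R) : carrier f ->
  measurable E -> E `<=` D -> (forall x, E x -> modulus (f x : K) <= M) ->
  0 < t -> (mu E <= r%:E)%E -> Phi (M / t) * r <= 1 -> nrm (cutoff E f : L) <= t.
Proof.
move=> cf mE ED hM t0 Er hr; have [cc _] := carrier_cutoff oF mE cf.
apply: (modular_nrm_le oF (carrier_measurable cc) t0 _).2.
apply: (@le_trans _ _ (\int[mu]_(x in D) (Phi (M / t) * \1_E x)%:E)%E).
  apply: le_integral_unit.
  - by move=> x _; exact: P0.
  - apply: (measurable_young yP); apply: measurable_modulus_div.
    exact: (carrier_measurable cc).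
  - by apply: measurable_funM; [exact: measurable_cst|exact: measurable_indic].
  move=> x _; rewrite /cutoff indicE; case: ifPn => [/set_mem Ex|_].
    by rewrite mulr1; apply: (le_young yP); rewrite ler_wpM2r ?invr_ge0 ?(ltW t0)// hM.
  by rewrite modulus0 mul0r (young0 yP)// mulr0.
rewrite integral_scaled_indic//.
apply: (@le_trans _ _ ((Phi (M / t))%:E * r%:E)%E).
  by apply: lee_wpmul2l; rewrite ?lee_fin.
by rewrite -EFinM lee_fin.
Qed.

(** Chebyshev inequality, with a constant that depends only on F. *)
Lemma chebyshev_L : exists2 c : R, 0 < c & forall (f : L) (E : set R) (M : R), carrier f ->
  measurable E -> E `<=` D -> (forall x, E x -> M <= modulus (f x : K)) -> 0 < M ->
  (mu E <= (c * nrm f / M)%:E)%E.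
Proof.
have [c c0 hc] := @L1_bound R k F oF; exists c => // f E M cf mE ED hM M0.
rewrite -(@lee_pmul2l _ M%:E)// -EFinM [X in (_ <= X%:E)%E](_ : _ = c * nrm f); last first.
  by rewrite mulrC divfK ?gt_eqF.
apply: le_trans (hc f cf); rewrite -integral_scaled_indic ?(ltW M0)//.
apply: le_integral_unit.
- by move=> x _; rewrite mulr_ge0 ?(ltW M0)// indicE.
- by apply: measurable_funM; [exact: measurable_cst|exact: measurable_indic].
- exact: measurable_modulus (carrier_measurable cf).
move=> x _; rewrite indicE; have [/set_mem Ex|_] := boolP (x \in E); first by rewrite mulr1 hM.
by rewrite mulr0 modulus_ge0.
Qed.

Variable Cd : R.
Hypothesis hCd : doubling Phi Cd.

Let dilation_bound n : exists a d : R, [/\ 0 <= a, 0 <= d & forall u, 0 <= u ->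
  Phi (2 ^+ n * u) <= d + a * Phi u].
Proof.
elim: n => [|n [a [d [a0 d0 h]]]].
  by exists 1, 0; split => // u _; rewrite expr0 !mul1r add0r.
pose C := `|Cd|; have C0 : 0 <= C by exact: normr_ge0.
exists (C * a), (C * d + Phi 2); split.
- by rewrite mulr_ge0.
- by rewrite addr_ge0 ?mulr_ge0.
move=> u u0; rewrite exprS -mulrA; set v := 2 ^+ n * u.
have v0 : 0 <= v by rewrite mulr_ge0 ?exprn_ge0.
have Pv : Phi v <= d + a * Phi u by exact: h.
have CPv : C * Phi v <= C * (d + a * Phi u) by rewrite ler_wpM2l.
have CP0 : 0 <= C * Phi v by rewrite mulr_ge0.
have [v1|v1] := leP 1 v.
  have h1 := hCd v1; have : Cd * Phi v <= C * Phi v by rewrite ler_wpM2r ?ler_norm.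
  by have := P0 2; lra.
have : Phi (2 * v) <= Phi 2 by apply: (le_young yP); lra.
lra.
Qed.

Lemma modular_finite (f : L) t : carrier f -> 0 < t ->
  (modular Phi (fun x => (modulus (f x : K) / t)%R) < +oo)%E.
Proof.
move=> cf t0; have mf := carrier_measurable cf.
pose t1 := nrm f + 1; have n0 := nrm_ge0 sL cf.
have t10 : 0 < t1 by rewrite ltr_wpDl.
have [n hn] : exists n, t1 / t <= 2 ^+ n.
  exists (Num.bound (t1 / t)); apply: ltW.
  apply: lt_trans (archi_boundP _) _; first by rewrite divr_ge0// ltW.
  by rewrite -natrX ltr_nat ltn_expl.
have [a [d [a0 d0 h]]] := dilation_bound n.
have hm := nrm_lt_modular oF cf (_ : nrm f < t1).
have {}hm := hm (ltac:(by rewrite ltrDl)).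
have mp := measurable_young yP (measurable_modulus_div t1 mf).
apply: (@le_lt_trans _ _ (\int[mu]_(x in D) (d + a * Phi (modulus (f x : K) / t1))%:E)%E).
  apply: le_integral_unit.
  - by move=> x _; exact: P0.
  - exact: (measurable_young yP (measurable_modulus_div t mf)).
  - apply: measurable_funD; first exact: measurable_cst.
    by apply: measurable_funM => //; exact: measurable_cst.
  move=> x _; apply: le_trans (h _ _); last by rewrite divr_ge0 ?modulus_ge0// ltW.
  apply: (le_young yP).
  have -> : modulus (f x : K) / t = t1 / t * (modulus (f x : K) / t1).
    by field; rewrite !gt_eqF.
  by rewrite ler_wpM2r// divr_ge0 ?modulus_ge0// ltW.
rewrite integral_affine_unit//.
rewrite -/(modular Phi (fun x => modulus (f x : K) / t1)).
apply: (@le_lt_trans _ _ (d%:E + a%:E * 1)%E).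
  by apply: leeD2l; apply: lee_wpmul2l; rewrite ?lee_fin.
by rewrite mule1 -EFinD ltry.
Qed.

(** By doubling all dilates of f have finite modular, so its large values
    carry little norm. *)
Lemma nrm_tail (f : L) t : carrier f -> 0 < t -> exists M : R, forall M', M <= M' ->
  nrm (cutoff (~` bounded_part M' f) f : L) <= t.
Proof.
move=> cf t0; have mf := carrier_measurable cf.
have mD := @measurable_unit_itv R.
pose A M := ~` bounded_part M f.
have mA M : measurable (A M) by apply: measurableC; exact: measurable_bounded_part.
pose g x : R := Phi (modulus (f x : K) / t).
have mg : measurable_fun D g by exact: (measurable_young yP (measurable_modulus_div t mf)).
pose h (n : nat) x : R := Phi (modulus (cutoff (A n%:R) f x : K) / t).
have mh n : measurable_fun D (h n).
  apply: (measurable_young yP); apply: measurable_modulus_div.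
  exact: measurable_cutoff.
have cvgh : (\int[mu]_(x in D) (h n x)%:E)%E @[n --> \oo] --> (\int[mu]_(x in D) (0 : R)%:E)%E.
  apply: (@dominated_cvg _ _ _ mu D mD (fun n x => (h n x)%:E) (fun=> 0%:E) (fun x => (g x)%:E)).
  - by move=> n; apply/measurable_EFinP; exact: mh.
  - move=> x Dx; apply/cvg_EFin; first by near=> n.
    apply: cvg_near_cst; near=> n; rewrite /= /h /cutoff memNset ?modulus0 ?mul0r ?(young0 yP)//.
    move=> /= nA; apply: nA; split => //=.
    near: n; exists (Num.bound (modulus (f x : K))) => // n /= bn.
    rewrite ltW// (lt_le_trans (archi_boundP (modulus_ge0 _)))// ler_nat//.
  - by [].
  - apply/integrableP; split; first by apply/measurable_EFinP.
    under eq_integral do rewrite gee0_abs ?lee_fin ?P0//.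
    exact: modular_finite.
  - move=> n x _; rewrite gee0_abs ?lee_fin ?P0//.
    apply: (le_young yP); rewrite ler_wpM2r ?invr_ge0 ?(ltW t0)// /cutoff.
    by case: ifP => // _; rewrite modulus0 modulus_ge0.
rewrite integral0 in cvgh.
have [n hn] : exists n, (\int[mu]_(x in D) (h n x)%:E <= 1)%E.
  apply: contrapT => /forallNP hN.
  have : (1 <= limn (fun n => \int[mu]_(x in D) (h n x)%:E))%E.
    apply: lime_ge; first exact: cvgP cvgh.
    by apply: nearW => n; rewrite ltW// ltNge; apply/negP; exact: hN.
  by rewrite (cvg_lim _ cvgh)// leNgt lte01.
exists n%:R => M' nM'; have [cc _] := carrier_cutoff oF (mA M') cf.
apply: (modular_nrm_le oF (carrier_measurable cc) t0 _).2.
apply: le_trans hn; apply: le_modular => //.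
- by apply: measurable_modulus_div; exact: (carrier_measurable cc).
- by apply: measurable_modulus_div; exact: measurable_cutoff.
move=> x _; rewrite ler_wpM2r ?invr_ge0 ?(ltW t0)// /cutoff.
case: ifPn => [/set_mem h1|_]; last by rewrite modulus0 modulus_ge0.
rewrite ifT//; apply/mem_set => h2; apply: h1; case: h2 => h2 h3; split => //=.
exact: le_trans nM'.
Unshelve. all: by end_near. Qed.

End truncation_estimates.

Section selection.
Set Implicit Arguments.
Unset Strict Implicit.
Context {R : realType} {k : scalar_kind}.
Local Notation K := (Defs.scalar R k).
Local Notation D := (`[0, 1[%classic : set R).
Local Notation mu := (@lebesgue_measure R).
Variable F : R -> \bar R.
Hypothesis oF : finite_orlicz F.
Local Notation Phi := (real_form F).
Local Notation L := (L_ k F).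

Let yP : young Phi := young_real_form oF.
Let sL : seminormed L := L_seminormed oF.
Let P0 := young_ge0 yP.

Variable Cd : R.
Hypothesis hCd : doubling Phi Cd.
Variables (y : nat -> L) (psi : nat -> L -> K) (C b B : R).
Hypothesis uy : usystem y psi C.
Hypothesis b0 : 0 < b.
Hypothesis yb : forall i, b <= nrm (y i) <= B.
Hypothesis unbounded : forall M : R, exists m, forall n, (m < n)%N ->
  modulus (psi n (cutoff (bounded_part M (y n)) (y n))) < 2^-1.

Let C0 : 0 < C := usys_gt0 uy.
Let cy i : carrier (y i) := usys_carrier uy i.
Let my i : measurable_scalar D (y i) := carrier_measurable (cy i).
Let B0 : 0 < B.
Proof. by case/andP: (yb 0%N) => h1 h2; apply: lt_le_trans (le_trans h1 h2). Qed.

Local Notation part n A := (psi n (cutoff A (y n))).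

Let ccut n A : measurable A -> carrier (cutoff A (y n) : L).
Proof. by move=> mA; case: (carrier_cutoff oF mA (cy n)). Qed.

Let part_le n A : measurable A ->
  modulus (part n A) <= C / b * nrm (cutoff A (y n) : L).
Proof.
move=> mA; have := usys_functional sL uy n (ccut n mA) => h.
rewrite mulrAC ler_pdivlMr//; apply: le_trans h; rewrite ler_wpM2l ?modulus_ge0//.
by case/andP: (yb n).
Qed.

Let part_setU n A A' : measurable A -> measurable A' -> (forall x, A x -> ~ A' x) ->
  modulus (part n (A `|` A')) <= modulus (part n A) + modulus (part n A').
Proof.
move=> mA mA' d.
have -> : cutoff (A `|` A') (y n) = (cutoff A (y n) : L) + cutoff A' (y n).
  apply/funext => x; rewrite [RHS]/(cutoff A (y n) x + cutoff A' (y n) x) /cutoff in_setU.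
  have [/set_mem Ax|_] := boolP (x \in A); last exact: (esym (@add0r K _)).
  by rewrite /= (memNset (d x Ax)); exact: (esym (@addr0 K _)).
by rewrite (usysD uy) ?ler_modulusD//; exact: ccut.
Qed.

Let part_setT n : part n setT = 1.
Proof.
have -> : cutoff setT (y n) = y n by apply/funext => x; rewrite /cutoff in_setT.
by rewrite (usys_biorth uy) eqxx.
Qed.

Let band n (i j : nat) : set R :=
  bounded_part (2 ^+ (i + j)) (y n) `\` bounded_part (2 ^+ i) (y n).

Let mbp n (M : R) : measurable (bounded_part M (y n)).
Proof. exact: measurable_bounded_part. Qed.

Let mband n i j : measurable (band n i j).
Proof. by apply: measurableD; exact: mbp. Qed.

Let bandD n i j : band n i j `<=` D.
Proof. by move=> x [[]]. Qed.

Let band_gt n i j x : band n i j x -> 2 ^+ i < modulus (y n x : K).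
Proof. by move=> [[Dx _] h]; rewrite ltNge; apply/negP => h'; apply: h; split. Qed.

Let band_le n i j x : band n i j x -> modulus (y n x : K) <= 2 ^+ (i + j).
Proof. by move=> [[_ h] _]. Qed.

Let bound_pow (M : R) : exists i : nat, M <= 2 ^+ i.
Proof.
exists (Num.bound `|M|); apply: le_trans (ler_norm _) _; apply: ltW.
apply: lt_trans (archi_boundP (normr_ge0 _)) _.
by rewrite -natrX ltr_nat ltn_expl.
Qed.

Let pow2_le (i j : nat) : (i <= j)%N -> (2 : R) ^+ i <= 2 ^+ j.
Proof. by move=> ij; rewrite ler_weXn2l// ler1n. Qed.

(** A robust band carries a fixed part of the coordinate of y_n even after
    removing any set of measure 2 d. *)
Let robust n i j d := forall U, measurable U -> (mu U <= (2 * d)%:E)%E ->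
  4^-1 <= modulus (part n (band n i j `\` U)).

(** Cut off the values up to 2^i, which by assumption carry less than half of the
    coordinate for n large, and the values above 2^(i+j), which carry at most 1/8
    since the tail of y_n has small norm. Sets of small measure carry at most 1/8
    of the rest, which leaves 1/4; and i large makes the band itself small. *)
Let select_band (p i0 : nat) (d : R) : 0 < d -> exists n i j (d' : R),
  [/\ (p < n)%N, (i0 <= i)%N, (mu (band n i j) <= d%:E)%E, 0 < d' <= d / 2 &
    robust n i j d'].
Proof.
move=> d0; have [c c0 hc] := @chebyshev_L R k F oF.
have [i1 hi1] := bound_pow (c * B / d); pose i := maxn i0 i1.
have [m hm] := unbounded (2 ^+ i); pose n := (maxn p m).+1.
have pn : (p < n)%N by rewrite ltnS leq_maxl.
have mn : (m < n)%N by rewrite ltnS leq_maxr.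
pose e := b / (8 * C); have e0 : 0 < e by rewrite divr_gt0// mulr_gt0.
have Ce : C / b * e = 8^-1 by rewrite /e; field; rewrite !gt_eqF.
have [M hM] := nrm_tail oF hCd (cy n) e0; have [j hj] := bound_pow M.
have {}hj : M <= 2 ^+ (i + j) by apply: le_trans hj _; apply: pow2_le; exact: leq_addl.
pose q := Phi (2 ^+ (i + j) / e) + 1.
have q0 : 0 < q by rewrite ltr_wpDl.
exists n, i, j, (Num.min (d / 2) (2 * q)^-1).
have i2 : 0 < (2 : R) ^+ i by rewrite exprn_gt0.
split => //.
- exact: leq_maxl.
- apply: le_trans (hc (y n) _ (2 ^+ i) (cy n) (mband n i j) (@bandD n i j) _ i2) _.
    by move=> x /band_gt/ltW.
  rewrite lee_fin ler_pdivrMr// [d * _]mulrC -ler_pdivrMr//.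
  apply: (@le_trans _ _ (c * B / d)).
    rewrite ler_wpM2r ?invr_ge0 ?(ltW d0)// ler_wpM2l ?(ltW c0)//.
    by case/andP: (yb n).
  by apply: le_trans hi1 _; apply: pow2_le; exact: leq_maxr.
- by rewrite lt_min divr_gt0//= invr_gt0 mulr_gt0//= ge_min lexx.
move=> U mU hU; set d' := Num.min _ _ in hU.
have dq : 2 * d' <= q^-1.
  have : d' <= (2 * q)^-1 by rewrite ge_min lexx orbT.
  by rewrite invfM; lra.
have mBU : measurable (band n i j `&` U) by apply: measurableI.
have h1 : modulus (part n (band n i j `&` U)) <= 8^-1.
  rewrite -Ce; apply: le_trans (part_le n mBU) _; rewrite ler_wpM2l//.
    by rewrite divr_ge0 ?ltW.
  apply: (nrm_cutoff_small oF (M := 2 ^+ (i + j)) (r := q^-1) (cy n)) => //.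
  - by move=> x [/bandD].
  - by move=> x [/band_le].
  - apply: (@le_trans _ _ (mu U)).
      by apply: le_measure; rewrite ?inE//; exact: subIsetr.
    by apply: le_trans hU _; rewrite lee_fin.
  - by rewrite ler_pdivrMr// mul1r lerDl.
have h2 : modulus (part n (~` bounded_part (2 ^+ (i + j)) (y n))) <= 8^-1.
  rewrite -Ce; apply: le_trans (part_le n (measurableC (mbp n _))) _; rewrite ler_wpM2l//.
    by rewrite divr_ge0 ?ltW.
  exact: hM.
have h3 : modulus (part n (bounded_part (2 ^+ i) (y n))) < 2^-1 by exact: hm.
have h4 : modulus (part n (band n i j)) <= modulus (part n (band n i j `&` U)) +
    modulus (part n (band n i j `\` U)).
  rewrite -{1}(setUIDK (band n i j) U); apply: part_setU => //.
  - exact: measurableD.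
  - by move=> x [_ ?] [].
have h5 : 1 <= modulus (part n (bounded_part (2 ^+ i) (y n))) + (modulus (part n (band n i j)) +
    modulus (part n (~` bounded_part (2 ^+ (i + j)) (y n)))).
  apply: (@le_trans _ _ (modulus (part n setT))); first by rewrite part_setT modulus1.
  have e1 : setT = bounded_part (2 ^+ i) (y n) `|` ~` bounded_part (2 ^+ i) (y n).
    by rewrite setUv.
  have e2 : ~` bounded_part (2 ^+ i) (y n) = band n i j `|` ~` bounded_part (2 ^+ (i + j)) (y n).
    apply/seteqP; split=> [x h|x [[//]|h1']].
      have [hx|hx] := pselect (bounded_part (2 ^+ (i + j)) (y n) x); [by left|by right].
    move=> [Dx hx]; apply: h1'; split => //=; apply: le_trans hx _.
    by apply: pow2_le; exact: leq_addr.
  rewrite {1}e1; apply: le_trans (part_setU n (mbp n _) (measurableC (mbp n _)) _) _.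
    by move=> x h /(_ h).
  rewrite lerD2l e2; apply: part_setU; [exact: mband|exact: measurableC (mbp n _)|].
  by move=> x [h _] /(_ h).
lra.
Qed.

(** Bands are selected one after the other, each so small that all later ones
    together do not spoil the earlier ones; removing the later bands from each band
    makes them disjoint, and dyadic levels cut them into pieces. *)
Lemma disjoint_selection : exists (sg : nat -> nat) (E : nat -> nat -> set R)
    (s : nat -> nat -> R) (J : nat -> nat),
  [/\ {homo sg : i j / (i < j)%N},
      (forall i j, measurable (E i j)) /\ (forall i j, E i j `<=` D),
      forall x i j i' j', E i j x -> E i' j' x -> i = i' /\ j = j',
      (forall i j x, E i j x -> s i j < modulus (y (sg i) x : K) <= 2 * s i j) /\
      (forall i j, 0 < s i j) /\
      forall X, exists i0, forall i j, (i0 <= i)%N -> X <= s i j &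
      forall i, 4^-1 <= \sum_(j < J i) piece_weight (y \o sg) (psi \o sg) E i j].
Proof.
pose St := (nat * nat * nat * R)%type.
have step (z : St) : exists z' : St, 0 < z.2 -> [/\ (z.1.1.1 < z'.1.1.1)%N, (z.1.1.2 < z'.1.1.2)%N,
    (mu (band z'.1.1.1 z'.1.1.2 z'.1.2) <= z.2%:E)%E, 0 < z'.2 <= z.2 / 2 &
    robust z'.1.1.1 z'.1.1.2 z'.1.2 z'.2].
  have [z0|z0] := ltP 0 z.2; last by exists z.
  have [n [i [j [d [? ? ? ? ?]]]]] := select_band z.1.1.1 z.1.1.2.+1 z0.
  by exists (n, i, j, d).
have [f hf] := choice step; pose z m : St := iter m.+1 f (0%N, 0%N, 0%N, 1).
have z0 m : 0 < (iter m f ((0%N, 0%N, 0%N, 1) : St)).2.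
  by elim: m => [|m IH]; [exact: ltr01|have [_ _ _ /andP[]] := hf _ IH].
have zS m := hf _ (z0 m.+1); rewrite -/(z _) in zS.
pose sg m := (z m).1.1.1; pose lo m := (z m).1.1.2; pose J m := (z m).1.2; pose d m := (z m).2.
have d0 m : 0 < d m by exact: z0.
have sgm : {homo sg : i j / (i < j)%N}.
  by apply: homo_ltn => [|m]; [exact: ltn_trans|case: (zS m)].
have lom m : (m <= lo m)%N.
  elim: m => // m IH; apply: leq_ltn_trans IH _; by case: (zS m).
have rob m : robust (sg m) (lo m) (J m) (d m).
  by case: m => [|m]; [case: (hf _ (z0 0%N))|case: (zS m)].
pose Bd m := band (sg m) (lo m) (J m).
have mBd m : measurable (Bd m) by exact: mband.
have dexp m l : d (m + l)%N <= d m * 2^-1 ^+ l.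
  elim: l => [|l IH]; first by rewrite addn0 expr0 mulr1.
  rewrite addnS exprSr mulrA; have [_ _ _ /andP[_ h] _] := zS (m + l)%N.
  by apply: le_trans h _; rewrite -/(d _) ler_wpM2r ?invr_ge0.
pose U m := \bigcup_l Bd (m.+1 + l)%N.
have mU m : measurable (U m) by apply: bigcupT_measurable => l; exact: mBd.
have hU m : (mu (U m) <= (2 * d m)%:E)%E.
  apply: le_trans (measure_sigma_subadditive (mu : measure _ R) (fun l => mBd (m.+1 + l)%N) (mU m) _) _ => //.
  apply: nneseries_bounded => [l|N]; first exact: measure_ge0.
  apply: (@le_trans _ _ (\sum_(0 <= l < N) (d m * 2^-1 ^+ l)%:E)%E).
    apply: lee_sum => l _; have [_ _ h _ _] := zS (m + l)%N.
    by rewrite addSn; apply: le_trans h _; rewrite lee_fin; exact: dexp.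
  rewrite sumEFin lee_fin -mulr_sumr sum_half// expr0 mulr1 mulrC.
  rewrite ler_wpM2r ?(ltW (d0 m))// gerBl mulr_ge0// exprn_ge0// invr_ge0//.
pose A m := Bd m `\` U m.
have mA m : measurable (A m) by exact: measurableD.
pose E m j := A m `&` band (sg m) (lo m + j) 1.
pose s m j : R := 2 ^+ (lo m + j).
have mE m j : measurable (E m j) by apply: measurableI => //; exact: mband.
exists sg, E, s, J; split => //.
- split => // i j x [_ h]; exact: (@bandD _ _ _ x h).
- move=> x i j i' j' [A1 b1] [A2 b2].
  have Aneq l l' : (l < l')%N -> A l x -> A l' x -> False.
    move=> ll [_ nU] [h _]; apply: nU; exists (l' - l.+1)%N => //.
    by rewrite subnKC.
  have ii : i = i' by case: (ltngtP i i') => // h; [case: (Aneq _ _ h A1 A2)|case: (Aneq _ _ h A2 A1)].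
  subst i'; split => //.
  have jneq l l' : (l < l')%N -> band (sg i) (lo i + l) 1 x -> band (sg i) (lo i + l') 1 x -> False.
    move=> ll /band_le h1 /band_gt h2; have := lt_le_trans h2 h1.
    rewrite ltNge => /negP; apply; apply: pow2_le; lia.
  by case: (ltngtP j j') => // h; [case: (jneq _ _ h b1 b2)|case: (jneq _ _ h b2 b1)].
- split; first move=> i j x [_ h].
    rewrite (band_gt h)/= /s -exprS -[X in 2 ^+ X]addn1; exact: (band_le h).
  split=> [i j|X]; first exact: exprn_gt0.
  have [i0 hi0] := bound_pow X; exists i0 => i j ii; apply: le_trans hi0 _.
  apply: pow2_le; apply: leq_trans ii _; apply: leq_trans (lom i) _; exact: leq_addr.
move=> i; apply: le_trans (rob i _ (mU i) (hU i)) _.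
have key q : modulus (part (sg i) (A i `&` band (sg i) (lo i) q)) <=
    \sum_(j < q) piece_weight (y \o sg) (psi \o sg) E i j.
  elim: q => [|q IH].
    rewrite big_ord0; have -> : A i `&` band (sg i) (lo i) 0 = set0.
      by apply/seteqP; split=> // x [_]; rewrite /band addn0 => -[].
    apply: le_trans (part_le _ measurable0) _.
    have -> : (cutoff set0 (y (sg i)) : L) = 0 by apply/funext => x; rewrite /cutoff in_set0.
    by rewrite (nrm0 sL) mulr0.
  rewrite big_ord_recr/=.
  have -> : A i `&` band (sg i) (lo i) q.+1 = (A i `&` band (sg i) (lo i) q) `|` E i q.
    rewrite -setIUr; congr (_ `&` _); apply/seteqP; split=> x.
      rewrite /band addn1 addnS => -[h1 h2].
      have [hx|hx] := pselect (bounded_part (2 ^+ (lo i + q)) (y (sg i)) x); [by left|by right].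
    rewrite /band addn1 addnS => -[[[Dx h1] h2]|[h1 h2]]; split => //.
      by split => //=; apply: le_trans h1 _; exact: pow2_le.
    move=> [Dx hx]; apply: h2; split => //=; apply: le_trans hx _.
    by apply: pow2_le; exact: leq_addr.
  apply: le_trans (part_setU _ _ _ _) _.
  - by apply: measurableI => //; exact: mband.
  - exact: mE.
  - by move=> x [_ [h _]] [_ [_ h']].
  by rewrite lerD2r.
apply: le_trans (key (J i)); rewrite le_eqVlt; apply/orP; left; apply/eqP.
congr (modulus (psi _ (cutoff _ _))); apply/seteqP; split=> [x h|x []//].
by split => //; case: h.
Qed.

End selection.

(** * The dichotomy *)
Section subsequences.
Set Implicit Arguments.
Unset Strict Implicit.
Context {R : realType} {k : scalar_kind}.
Local Notation K := (Defs.scalar R k).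

Lemma equivalent_sym (X Y : nspace R K) (x : nat -> X) (y : nat -> Y) :
  seminormed X -> seminormed Y -> (forall n, carrier (x n)) -> (forall n, carrier (y n)) ->
  equivalent x y -> equivalent y x.
Proof.
move=> sX sY cx cy [T [S [bT bS ST TS Txy]]]; exists S, T; split => // n.
have xn := closed_span_mem sX cx n; have yn := closed_span_mem sY cy n.
have [ES LS _] := bS; have [ET _ _] := bT; have Tn := ET _ xn.
have [M M0 hM] := bounded_linear_bound bS (fun u hu => nrm_ge0 sY hu.1).
have d0 : nrm (S (-1 *: T (x n) + y n)) = 0.
  have cd : closed_span y (-1 *: T (x n) + y n) by exact: (closed_spanL sY).
  apply/eqP; rewrite eq_le (nrm_ge0 sX) ?andbT; last by case: (ES _ cd).
  apply: le_trans (hM _ cd) _; rewrite addrC scaleN1r.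
  have := Txy n; rewrite /same (nrm_subC sY) ?(cy n)//; last by case: Tn.
  by move=> ->; rewrite mulr0.
have cSy : carrier (S (y n)) by case: (ES _ yn).
have cST : carrier (S (T (x n))) by case: (ES _ Tn).
have cd : carrier (S (-1 *: T (x n) + y n)).
  by have := ES _ (closed_spanL sY cy (-1) Tn yn) => -[].
apply/eqP; rewrite eq_le (nrm_ge0 sX) ?andbT; last exact: (carrierB sX).
apply: le_trans (nrm_triangle sX cSy cST (cx n)) _.
rewrite (ST _ xn) addr0 (nrm_subC sX)//.
have := LS (-1) _ _ Tn yn; rewrite /same => h.
have e : nrm (-1 *: S (T (x n)) + S (y n)) = 0.
  rewrite -d0; symmetry; apply: (same_nrm sX) => //.
  by apply: (carrierD sX) => //; exact: (carrierZ sX).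
by rewrite -(nrm_subC sX)// -[X in nrm X]addrC -scaleN1r e.
Qed.

(** Estimates along a subsequence are estimates for x itself. *)
Lemma spreading_subsequence (X : nspace R K) (x : nat -> X) (s : nat -> nat) :
  seminormed X -> basic_sequence x -> spreading x -> {homo s : i j / (i < j)%N} ->
  exists2 M : R, 0 < M & forall a N,
    nrm (partial_sum x a N) <= M * nrm (partial_sum (x \o s) a N) /\
    nrm (partial_sum (x \o s) a N) <= M * nrm (partial_sum x a N).
Proof.
move=> sX [cx _] spx hs; have cs n : carrier ((x \o s) n) by exact: cx.
have [M M0 hM] := equivalent_partial_sum sX sX cx cs (spx s hs).
have [M' M'0 hM'] := equivalent_partial_sum sX sX cs cx (equivalent_sym sX sX cx cs (spx s hs)).
exists (M + M'); first exact: addr_gt0.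
move=> a N; have n1 : 0 <= nrm (partial_sum x a N) by apply: (nrm_ge0 sX); exact: carrier_partial_sum.
have n2 : 0 <= nrm (partial_sum (x \o s) a N) by apply: (nrm_ge0 sX); exact: carrier_partial_sum.
split; [apply: le_trans (hM' a N) _|apply: le_trans (hM a N) _];
  by rewrite ler_wpM2r// ?lerDl ?lerDr ltW.
Qed.

End subsequences.

Section dichotomy.
Set Implicit Arguments.
Unset Strict Implicit.
Context {R : realType} {k : scalar_kind}.
Local Notation K := (Defs.scalar R k).
Variable F : R -> \bar R.
Hypothesis oF : finite_orlicz F.
Hypothesis oFs : finite_orlicz (complementary F).
Local Notation Phi := (real_form F).
Local Notation L := (L_ k F).
Variables C2 Cd : R.
Hypothesis P1 : 0 < Phi 1.
Hypothesis hCd : doubling Phi Cd.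
Hypothesis hC2 : two_concave Phi C2 \/ two_convex Phi C2.

(** Either the bounded parts of x_n carry half of the coordinate for infinitely
    many n and some bound M, or large values carry the coordinates. *)
Lemma complemented_subsymmetric_dichotomy (x : nat -> L) :
  basic_sequence x -> complemented x -> subsymmetric x ->
  equivalent x (unit_vector R k : nat -> ell2 R k) \/
  exists G : R -> \bar R,
    [/\ C_infty F G,
        exists2 H, C_infty (complementary F) H &
          equivalent_near_zero (complementary G) H &
        equivalent x (unit_vector R k : nat -> ell_ k G)].
Proof.
move=> bx px [ux spx].
have sL : seminormed L := L_seminormed oF.
have kL : complete L := @L_complete R k F oF.
have [psi [C uy]] := complemented_usystem sL kL bx spx ux px.
have [b [B [b0 xb]]] := spreading_bounds sL bx spx.
pose big M n := 2^-1 <= modulus (psi n (cutoff (bounded_part M (x n)) (x n)) : K).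
have [[M hM]|hM] := pselect (exists M : R, forall m, exists n, (m < n)%N /\ big M n).
  left; have [s [sm hs]] := @increasing_choice (fun _ => big M) (fun _ => hM).
  have sI : injective s by move=> i j e; case: (ltngtP i j) => // /sm; rewrite e ltnn.
  have uys := usystem_comp sI uy.
  have [c c0 hc] : exists2 c : R, 0 < c & forall (a : nat -> K) N,
      nrm (partial_sum (x \o s) a N) <= c * Num.sqrt (\sum_(i < N) modulus (a i) ^+ 2) /\
      Num.sqrt (\sum_(i < N) modulus (a i) ^+ 2) <= c * nrm (partial_sum (x \o s) a N).
    case: hC2 => h.
      exact: (concave_hilbertian oF uys b0 (fun i => xb (s i)) hs P1 h).
    exact: (convex_hilbertian oF uys b0 (fun i => xb (s i)) hs P1 h hCd).
  have [Q Q0 hQ] := spreading_subsequence sL bx spx sm.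
  apply: (equivalent_ell2 sL kL bx spx ux (mulr_gt0 Q0 c0)) => a N.
  have [h1 h2] := hc a N; have [h3 h4] := hQ a N; split.
    by apply: le_trans h3 _; rewrite -mulrA ler_wpM2l// ltW.
  by apply: le_trans h2 _; rewrite [Q * c]mulrC -mulrA ler_wpM2l// ltW.
right.
have unb (M : R) : exists m, forall n, (m < n)%N ->
    modulus (psi n (cutoff (bounded_part M (x n)) (x n)) : K) < 2^-1.
  apply: contrapT => /forallNP h; apply: hM; exists M => m.
  have /existsNP[n /not_implyP[mn /negP]] := h m.
  by rewrite -leNgt => hn; exists n.
have [s [E [lv [J [sm [mE ED] dE [sE [lv0 lvi]] wS]]]]] := disjoint_selection oF hCd uy b0 xb unb.
have sI : injective s by move=> i j e; case: (ltngtP i j) => // /sm; rewrite e ltnn.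
have [s' [g [h [sm' gg [Cg Ch gh] [c c0 [h1 h2]]]]]] :=
  disjoint_sequence_orlicz oF oFs (usystem_comp sI uy) b0 (fun i => xb (s i)) mE ED dE sE lv0 lvi wS.
have smm : {homo s \o s' : i j / (i < j)%N} by move=> i j /sm'/sm.
have [Q Q0 hQ] := spreading_subsequence sL bx spx smm.
exists (affine_extension g); split => //; first by exists (affine_extension h).
apply: (equivalent_ell_orlicz sL kL bx spx ux (mulr_gt0 Q0 c0) gg) => a N t.
  move=> t0 ht; apply: le_trans (hQ a N).1 _; rewrite -mulrA ler_wpM2l ?(ltW Q0)//.
  exact: h1.
move=> ht; have Qt : nrm (partial_sum ((x \o s) \o s') a N) < Q * t.
  by apply: le_lt_trans (hQ a N).2 _; rewrite ltr_pM2l.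
by have := h2 a N _ Qt; rewrite mulrA (mulrC c).
Qed.

End dichotomy.

Section hypotheses.
Set Implicit Arguments.
Unset Strict Implicit.
Context {R : realType}.
Variable F : R -> \bar R.
Hypothesis oF : finite_orlicz F.
Local Notation Phi := (real_form F).
Let yP : young Phi := young_real_form oF.
Let P0 := young_ge0 yP.

Lemma ess_increasing_two_convex : ess_increasing (fun t => fine (F t) * t ^- 2) ->
  exists C, two_convex Phi C.
Proof.
move=> [C hC]; exists C => s t s1 st.
have s0 : 0 < s by lra.
have t0 : 0 < t by lra.
have := hC s t s1 st; rewrite /= !fine_orlicz ?(ltW s0) ?(ltW t0)// ler_pdivrMr ?exprn_gt0//.
by rewrite mulrA mulrAC ler_pdivlMr ?exprn_gt0.
Qed.

Lemma ess_decreasing_two_concave : ess_decreasing (fun t => fine (F t) * t ^- 2) ->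
  exists C, two_concave Phi C.
Proof.
move=> [C hC]; exists C => s t s1 st.
have s0 : 0 < s by lra.
have t0 : 0 < t by lra.
have := hC s t s1 st; rewrite /= !fine_orlicz ?(ltW s0) ?(ltW t0)// ler_pdivrMr ?exprn_gt0//.
by rewrite mulrA mulrAC ler_pdivlMr ?exprn_gt0.
Qed.

Lemma doubling_infty_doubling : doubling_infty F -> exists C, doubling Phi C.
Proof.
move=> [_ [C hC]]; exists C => t t1; have := hC t t1.
by rewrite !(real_formE oF) -?EFinM ?lee_fin//; lra.
Qed.

(* If F (1) = 0, then doubling gives F (2^n) = 0 for all n. *)
Lemma doubling_gt0 C : doubling Phi C -> 0 < Phi 1.
Proof.
move=> hC; rewrite lt_neqAle P0 andbT; apply/eqP => P1.
have pow n : Phi (2 ^+ n) = 0.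
  elim: n => [|n IH]; first by rewrite expr0.
  apply/eqP; rewrite eq_le P0 andbT exprS; apply: le_trans (hC _ _) _; last by rewrite IH mulr0.
  by rewrite exprn_ege1// ler1n.
have [T T0] := young_neq0 yP; rewrite ltNge => /negP; apply.
rewrite -(pow (Num.bound T)); apply: (le_young yP); apply: ltW.
apply: lt_trans (archi_boundP (ltW T0)) _.
by rewrite -natrX ltr_nat ltn_expl.
Qed.

Lemma two_concave_gt0 C : two_concave Phi C -> 0 < Phi 1.
Proof.
move=> hC; rewrite lt_neqAle P0 andbT; apply/eqP => P1.
have [T T0] := young_neq0 yP; rewrite ltNge => /negP; apply.
have T1 : 1 <= Num.max 1 T by rewrite le_max lexx.
have := hC 1 (Num.max 1 T) (lexx 1) T1; rewrite -P1 mulr0 mul0r expr1n mulr1.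
by apply: le_trans; apply: (le_young yP); rewrite le_max lexx orbT.
Qed.

(** Quadratic growth makes the complementary function finite. *)
Lemma two_convex_complementary C : 0 < Phi 1 -> two_convex Phi C ->
  finite_orlicz (complementary F).
Proof.
move=> P1 hC; apply: finite_orlicz_complementary => // u u0.
have C1 : 1 <= C.
  have := hC 1 1 (lexx 1) (lexx 1); rewrite expr1n !mulr1 => h.
  by rewrite -(ler_pM2r P1) mul1r.
have C0 : 0 < C by lra.
pose c := Phi 1 / C; have c0 : 0 < c by rewrite divr_gt0.
apply: (@le_lt_trans _ _ (u + u ^+ 2 / c)%:E); last by rewrite ltry.
apply: complementary_le => // t t0; rewrite lee_fin.
have q0 : 0 <= u ^+ 2 / c by rewrite divr_ge0 ?sqr_ge0// ltW.
have Pt := P0 t.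
have [t1|t1] := leP t 1.
  have : t * u <= u by rewrite ler_piMl.
  lra.
have h1 : c * t ^+ 2 <= Phi t.
  rewrite /c mulrAC ler_pdivrMr// mulrC [Phi t * C]mulrC.
  by have := hC 1 t (lexx 1) (ltW t1); rewrite expr1n mulr1 mulrC.
have h2 : t * u <= c * t ^+ 2 + u ^+ 2 / c.
  have : 0 <= (c * t - u / 2) ^+ 2 / c by rewrite divr_ge0 ?sqr_ge0// ltW.
  have -> : (c * t - u / 2) ^+ 2 / c = c * t ^+ 2 - t * u + u ^+ 2 / c / 4.
    by field; rewrite gt_eqF.
  lra.
lra.
Qed.

End hypotheses.

Theorem theorem6p6 (R : realType) (k : scalar_kind) (F : R -> \bar R)
  (F_finite : finite_orlicz F)
  (F_hyp :
    (doubling_infty F /\ ess_increasing (fun t => fine (F t) * t ^- 2)) \/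
    (doubling_infty (complementary F) /\
     ess_decreasing (fun t => fine (F t) * t ^- 2)))
  (x : nat -> L_ k F)
  (x_basic : basic_sequence x) (x_compl : complemented x)
  (x_subsym : subsymmetric x) :
  equivalent x (unit_vector R k : nat -> ell2 R k) \/
  exists G : R -> \bar R,
    [/\ C_infty F G,
        exists2 H, C_infty (complementary F) H &
          equivalent_near_zero (complementary G) H &
        equivalent x (unit_vector R k : nat -> ell_ k G)].

Proof.
case: F_hyp => -[].
  move=> dF /ess_increasing_two_convex[C hC].
  have [Cd hCd] := doubling_infty_doubling F_finite dF.
  have P1 := doubling_gt0 F_finite hCd.
  have oFs := two_convex_complementary F_finite P1 hC.
  exact: (complemented_subsymmetric_dichotomy F_finite oFs P1 hCd (or_intror hC)).
move=> [oFs _] /ess_decreasing_two_concave[C hC].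
have P1 := two_concave_gt0 F_finite hC.
have hCd : doubling (real_form F) (4 * C) by exact: two_concave_doubling hC.
exact: (complemented_subsymmetric_dichotomy F_finite oFs P1 hCd (or_introl hC)).
Qed.
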